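(* Let $\mu\in(0,1)$, let $N\ge1$ and $\nu\ge0$ be integers, and write $\alpha=\frac{1+\mu}{2\mu}$, $\delta=\frac{1-\mu}{2\mu}$. The correlation kernel $K_N(x,y)$ defined in the context can be written, for $x,y>0$, as $$K_N(x,y)=\sum_{k=0}^{N-1}K_N^{(k)}(x,y)\left(\frac{\delta}{\alpha}\right)^{2k},$$ where $$K_N^{(k)}(x,y)=\sum_{m=0}^k\frac{(-1)^m}{(2\pi i)^2}\binom{N}{m}\oint_\Sigma dt\int_{c-i\infty}^{c+i\infty}ds\,\frac{\Gamma^2(s)\Gamma(s+\nu+k)\Gamma(s-t+m-1)\Gamma(t-N+1)}{\Gamma^2(t+1)\Gamma(t+\nu+1)\Gamma(s-N+m)\Gamma(s-t+k)}$$ $$\qquad\times\left(1-\frac{\delta^2}{\alpha^2}\right)^\nu(\alpha^2-\delta^2)^{t+1}x^t\,{}_0F_1\left(\begin{array}{c}-\\t+1\end{array}\Big|\,\delta^2x\right)(\alpha^2y)^{-s}.$$ Here $\Sigma$ is a closed contour that encircles $0,1,\ldots,N-1$ once in the positive direction, and $c>0$.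
   Context: $I_\kappa$ and $K_\kappa$ are the modified Bessel functions of the first and second kind; $(a)_k=a(a+1)\cdots(a+k-1)$ is the Pochhammer symbol; ${}_0F_1$ is the generalised hypergeometric function. For $n=0,1,\ldots$, $$P_n(x)=(-1)^n(\nu+n)!\,n!\sum_{k=0}^n\frac{(\alpha^2-\delta^2)^{k+\frac12}}{\delta^k}\frac{(-n)_k}{(\nu+k)!\,k!}\,x^{\frac k2}I_k(2\delta\sqrt x),$$ $$Q_n(y)=(-1)^n\frac{2}{(n!)^2}\sum_{l=0}^n\frac{(\alpha^2-\delta^2)^{l+\nu+\frac12}}{\alpha^{l+\nu}}\frac{(-n)_l}{(\nu+l)!\,l!}\,y^{\frac{l+\nu}2}K_{l+\nu}(2\alpha\sqrt y),$$ and $K_N(x,y)=\sum_{n=0}^{N-1}P_n(x)Q_n(y)$. This is the correlation kernel of the determinantal point process formed by the squared singular values of $X_1X_2$, where $X_1$, $X_2$ are $N\times M$ and $M\times N$ complex random matrices, $M=N+\nu$, with joint density $(\pi^2\mu)^{-NM}\exp[-\alpha\operatorname{Tr}(X_1X_1^*+X_2^*X_2)+\delta\operatorname{Tr}(X_1X_2+X_2^*X_1^* )]$.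
   Formalization: It is assumed in addition that the points s+j-1 with Re s = c and 0 ≤ j < N neither lie on Σ nor are encircled by it (otherwise the right side depends on Σ); Σ may consist of several closed curves. *)

(* Defs.v *)
From HB Require Import structures.
From mathcomp Require Import all_boot all_order all_algebra.
From mathcomp Require Import all_classical all_reals all_analysis.
From mathcomp Require Import complex.
Set Implicit Arguments.
Unset Strict Implicit.
Unset Printing Implicit Defensive.
Import Order.TTheory GRing.Theory Num.Theory.
Import numFieldNormedType.Exports.
Local Open Scope classical_set_scope.
Local Open Scope ring_scope.
Local Open Scope complex_scope.

Definition pochhammer (A : pzRingType) (a : A) (k : nat) : A :=
  \prod_(i < k) (a + i%:R).

Definition cintegral (R : realType) (D : set R) (f : R -> R[i]) : R[i] :=
  (\int[@lebesgue_measure R]_(u in D) complex.Re (f u)) +i*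
  (\int[@lebesgue_measure R]_(u in D) complex.Im (f u)).

Definition cseries (R : realType) (a : nat -> R[i]) : R[i] :=
  limn (series (fun j => complex.Re (a j))) +i*
  limn (series (fun j => complex.Im (a j))).

Definition cexp (R : realType) (z : R[i]) : R[i] :=
  (expR (complex.Re z))%:C * (cos (complex.Im z) +i* sin (complex.Im z)).

(* [b ^ z] for a real base [b > 0] *)
Definition cpow (R : realType) (b : R) (z : R[i]) : R[i] :=
  cexp (z * (ln b)%:C).

Definition Gamma_integral (R : realType) (z : R[i]) : R[i] :=
  cintegral `]0, +oo[ (fun u => cpow u (z - 1) * (expR (- u))%:C).

(* For [Re z <= 0], [Gamma z = Gamma (z + n) / (z)_n] with [Re (z + n) > 0].
   At the poles [0, -1, -2, ...], [(z)_n = 0], so [Gamma z = 0] there and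
   hence [(Gamma z)^-1 = 0], which is the value of the entire function
   [1 / Gamma]. *)
Definition Gamma (R : realType) (z : R[i]) : R[i] :=
  if 0 < complex.Re z then Gamma_integral z
  else let n := `|Num.floor (complex.Re z)|%N.+1 in
       Gamma_integral (z + n%:R) / pochhammer z n.

Definition hyp0F1 (R : realType) (b z : R[i]) : R[i] :=
  cseries (fun j => z ^+ j / (pochhammer b j * j`!%:R)).

Definition besselI (R : realType) (k : nat) (z : R) : R :=
  limn (series (fun j => (z / 2) ^+ (2 * j + k) / (j`!%:R * (j + k)`!%:R))).

(* For [z > 0], [K_k(z) = \int_0^oo exp (- z cosh u) cosh (k u) du]. *)
Definition besselK (R : realType) (k : nat) (z : R) : R :=
  let ch (u : R) := (expR u + expR (- u)) / 2 in
  \int[@lebesgue_measure R]_(u in `[0, +oo[) (expR (- z * ch u) * ch (k%:R * u)).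

Definition C1 (R : realType) (f : R -> R) : Prop :=
  (forall u, derivable f u 1) /\ continuous (derive1 f).

Definition piecewise_C1 (R : realType) (g : R -> R[i]) : Prop :=
  exists (n : nat) (t : nat -> R),
    [/\ t 0%N = 0, t n = 1 &
      forall i, (i < n)%N -> t i < t i.+1 /\
        exists h : R -> R[i],
          [/\ C1 (fun u => complex.Re (h u)), C1 (fun u => complex.Im (h u)) &
              forall u, t i <= u <= t i.+1 -> g u = h u]].

(* A closed contour may have several components, each parametrised by
   [[0, 1]]; integrals over the components are added. *)
Record contour (R : realType) := Contour {
  ncomp : nat;
  component :> 'I_ncomp -> R -> R[i];
  contour_piecewise_C1 : forall i, piecewise_C1 (component i);
  contour_closed : forall i, component i 0 = component i 1 }.

Definition on_contour (R : realType) (S : contour R) (a : R[i]) : Prop :=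
  exists (i : 'I_(ncomp S)) (u : R), 0 <= u <= 1 /\ S i u = a.

Definition cderive (R : realType) (g : R -> R[i]) (u : R) : R[i] :=
  derive1 (fun v => complex.Re (g v)) u +i*
  derive1 (fun v => complex.Im (g v)) u.

Definition contour_integral (R : realType) (S : contour R)
    (f : R[i] -> R[i]) : R[i] :=
  \sum_(i < ncomp S) cintegral `[0, 1] (fun u => f (S i u) * cderive (S i) u).

Definition two_pi_i (R : realType) : R[i] := 0 +i* (2 * pi).

Definition winding (R : realType) (S : contour R) (a : R[i]) : R[i] :=
  (two_pi_i R)^-1 * contour_integral S (fun z => (z - a)^-1).

Definition encircles_once (R : realType) (S : contour R) (a : R[i]) : Prop :=
  ~ on_contour S a /\ winding S a = 1.

Definition is_outside (R : realType) (S : contour R) (a : R[i]) : Prop :=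
  ~ on_contour S a /\ winding S a = 0.

Definition vertical_integral (R : realType) (c : R) (f : R[i] -> R[i]) : R[i] :=
  (0 +i* 1) * cintegral setT (fun eta => f (c +i* eta)).

Definition P (R : realType) (alpha delta : R) (nu n : nat) (x : R) : R :=
  (-1) ^+ n * (nu + n)`!%:R * n`!%:R *
  \sum_(k < n.+1)
    ((alpha ^+ 2 - delta ^+ 2) `^ (k%:R + 1 / 2) / delta ^+ k
     * (pochhammer (- n%:R) k / ((nu + k)`!%:R * k`!%:R))
     * x `^ (k%:R / 2) * besselI k (2 * delta * Num.sqrt x)).

Definition Q (R : realType) (alpha delta : R) (nu n : nat) (y : R) : R :=
  (-1) ^+ n * (2 / n`!%:R ^+ 2) *
  \sum_(l < n.+1)
    ((alpha ^+ 2 - delta ^+ 2) `^ (l%:R + nu%:R + 1 / 2) / alpha ^+ (l + nu)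
     * (pochhammer (- n%:R) l / ((nu + l)`!%:R * l`!%:R))
     * y `^ ((l + nu)%:R / 2) * besselK (l + nu) (2 * alpha * Num.sqrt y)).

Definition corr_kernel (R : realType) (alpha delta : R) (nu N : nat) (x y : R) : R :=
  \sum_(n < N) (P alpha delta nu n x * Q alpha delta nu n y).

Definition integrand (R : realType) (alpha delta : R) (nu N k m : nat)
    (x y : R) (t s : R[i]) : R[i] :=
  (Gamma s ^+ 2 * Gamma (s + nu%:R + k%:R) * Gamma (s - t + m%:R - 1)
     * Gamma (t - N%:R + 1))
  / (Gamma (t + 1) ^+ 2 * Gamma (t + nu%:R + 1) * Gamma (s - N%:R + m%:R)
     * Gamma (s - t + k%:R))
  * ((1 - delta ^+ 2 / alpha ^+ 2) ^+ nu)%:C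
  * cpow (alpha ^+ 2 - delta ^+ 2) (t + 1)
  * cpow x t * hyp0F1 (t + 1) ((delta ^+ 2 * x)%:C)
  * cpow (alpha ^+ 2 * y) (- s).

Definition corr_kernel_term (R : realType) (alpha delta : R) (nu N k : nat)
    (S : contour R) (c x y : R) : R[i] :=
  \sum_(m < k.+1)
    ((-1) ^+ m / two_pi_i R ^+ 2 * 'C(N, m)%:R
     * contour_integral S (fun t =>
         vertical_integral c (fun s =>
           integrand alpha delta nu N k m x y t s))).

(* Main.v *)
(** In the variable [t] the integrand is an entire function times a transform [Phi t]
    over the line [Re s = c], divided by [t (t - 1) ... (t - N + 1)].  The transform
    is holomorphic off the lines [Re t = c + j - 1], none of which meets the contour,
    so that every component of the contour lies in a strip on which [Phi] is
    holomorphic, and the [t]-integral is the sum of the residues at [0, ..., N - 1].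

    In the residue at [n], the sum over [m] of rational functions of [s] telescopes to
    polynomials in [s]; an Euler transformation turns the sum of these over [k] with
    weights [(delta / alpha) ^ 2k] into sums of [(s + nu)_l] with weights
    [(1 - delta^2 / alpha^2) ^ l].  The Mellin-Barnes integrals of
    [Gamma s * Gamma (s + nu + l)] are Bessel functions [K_(nu + l)] and produce [Q],
    while the entire factor at [n] is a Bessel function [I_n] and produces [P].

    Complex differentiability is used in a quantitative form (the predicate [holK]),
    for which Cauchy's formula follows by contracting the contour to the pole. *)

Require Import Defs.
From HB Require Import structures.
From mathcomp Require Import all_boot all_order all_algebra.
From mathcomp Require Import all_classical all_reals all_analysis.
From mathcomp Require Import measurable_realfun complex ring lra.
Set Implicit Arguments.
Unset Strict Implicit.
Unset Printing Implicit Defensive.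
Import Order.TTheory GRing.Theory Num.Theory.
Import numFieldNormedType.Exports.
Local Open Scope classical_set_scope.
Local Open Scope ring_scope.
Local Open Scope complex_scope.

(** Two features of the statement shape the argument. The contour is arbitrary: it may have several
    components, and may pass through -1, -2, ..., where [integrand] has the values dictated by
    [Gamma] = 0 at poles and x / 0 = 0. The factor 1 / Gamma (t + 1)^2 is therefore shared out: one
    half makes the 0F1 entire in t, the other turns Gamma (t - N + 1) into the product of the 1 / (t
    - n), and the wrong values remain on a null set of parameters. Secondly, poles in t move with s,
    so estimates in t have to be uniform, or integrable, along the line of s. This is why [holK]
    carries one explicit constant: it can be summed over a series and integrated over a parameter.
    Holomorphy of 1 / Gamma needs a lower bound for |Gamma| that is uniform on compact sets. It
    comes from probability: the Gamma law of large shape, rescaled, concentrates at 1, so that a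
    suitably normalised Gamma (t + n) is close to a positive number for all t in a bounded part of a
    strip, and the functional equation carries this elsewhere. *)

Notation nc := Normc.normc.

(** * The real-valued modulus *)

Section modulus.
Context {R : realType}.
Implicit Types (a b : R) (z w : R[i]).

Lemma ncE z : nc z = Num.sqrt (complex.Re z ^+ 2 + complex.Im z ^+ 2).
Proof. by case: z. Qed.

Lemma nc_sqr z : nc z ^+ 2 = complex.Re z ^+ 2 + complex.Im z ^+ 2.
Proof. by rewrite ncE sqr_sqrtr // addr_ge0 ?sqr_ge0. Qed.

Lemma nc_ge0 z : 0 <= nc z.
Proof. by rewrite ncE sqrtr_ge0. Qed.

Lemma ncD z w : nc (z + w) <= nc z + nc w.
Proof. exact: le_normcD. Qed.

Lemma ncN z : nc (- z) = nc z.
Proof. by case: z => a b /=; rewrite !sqrrN. Qed.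

Lemma ncBC z w : nc (z - w) = nc (w - z).
Proof. by rewrite -ncN opprB. Qed.

Lemma ncB z w : nc (z - w) <= nc z + nc w.
Proof. by rewrite (le_trans (ncD _ _)) // ncN. Qed.

Lemma nc_real a : nc a%:C = `|a|.
Proof. by rewrite /= expr0n /= addr0 sqrtr_sqr. Qed.

Lemma nc0 : nc (0 : R[i]) = 0.
Proof. by rewrite -[0]/(0%:C) nc_real normr0. Qed.

Lemma nc1 : nc (1 : R[i]) = 1.
Proof. by rewrite -[1]/(1%:C) nc_real normr1. Qed.

Lemma nc_nat n : nc (n%:R : R[i]) = n%:R.
Proof. by rewrite -(rmorph_nat (real_complex R)) nc_real normr_nat. Qed.

Lemma nc_eq0 z : (nc z == 0) = (z == 0).
Proof. by apply/eqP/eqP => [/Normc.eq0_normc //|->]; rewrite nc0. Qed.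

Lemma nc_gt0 z : (0 < nc z) = (z != 0).
Proof. by rewrite lt_def nc_eq0 nc_ge0 andbT. Qed.

Lemma ncX z n : nc (z ^+ n) = nc z ^+ n.
Proof.
elim: n => [|n IH]; first by rewrite !expr0 nc1.
by rewrite !exprS Normc.normcM IH.
Qed.

Lemma nc_i : nc (0 +i* 1 : R[i]) = 1.
Proof. by rewrite /= expr0n expr1n add0r sqrtr1. Qed.

Lemma nc_sum (I : Type) (r : seq I) (P : pred I) (F : I -> R[i]) :
  nc (\sum_(i <- r | P i) F i) <= \sum_(i <- r | P i) nc (F i).
Proof.
elim/big_ind2: _ => [|x1 x2 y1 y2 h1 h2|//]; first by rewrite nc0.
by rewrite (le_trans (ncD _ _)) // lerD.
Qed.

Lemma nc_prod (I : Type) (r : seq I) (P : pred I) (F : I -> R[i]) :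
  nc (\prod_(i <- r | P i) F i) = \prod_(i <- r | P i) nc (F i).
Proof.
by elim/big_ind2: _ => [|x1 x2 y1 y2 h1 h2|//]; rewrite ?nc1 // Normc.normcM h1 h2.
Qed.

Lemma normr_Re_le_nc z : `|complex.Re z| <= nc z.
Proof.
by rewrite -[leLHS]sqrtr_sqr ncE ler_wsqrtr // lerDl sqr_ge0.
Qed.

Lemma normr_Im_le_nc z : `|complex.Im z| <= nc z.
Proof.
by rewrite -[leLHS]sqrtr_sqr ncE ler_wsqrtr // lerDr sqr_ge0.
Qed.

Lemma nc_le_ReIm z : nc z <= `|complex.Re z| + `|complex.Im z|.
Proof.
rewrite -(@ler_pXn2r _ 2) ?nnegrE ?nc_ge0 ?addr_ge0 // nc_sqr.
rewrite sqrrD !real_normK ?num_real // addrAC lerDl.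
by rewrite mulrn_wge0 // mulr_ge0.
Qed.

Lemma ReD z w : complex.Re (z + w) = complex.Re z + complex.Re w.
Proof. by case: z; case: w. Qed.
Lemma ImD z w : complex.Im (z + w) = complex.Im z + complex.Im w.
Proof. by case: z; case: w. Qed.
Lemma ReN z : complex.Re (- z) = - complex.Re z.
Proof. by case: z. Qed.
Lemma ImN z : complex.Im (- z) = - complex.Im z.
Proof. by case: z. Qed.
Lemma ReM z w : complex.Re (z * w) =
  complex.Re z * complex.Re w - complex.Im z * complex.Im w.
Proof. by case: z; case: w. Qed.
Lemma ImM z w : complex.Im (z * w) =
  complex.Re z * complex.Im w + complex.Im z * complex.Re w.
Proof. by case: z => a b; case: w => c d. Qed.
Lemma Re_nat n : complex.Re (n%:R : R[i]) = n%:R.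
Proof. by rewrite -(rmorph_nat (real_complex R)). Qed.
Lemma Im_nat n : complex.Im (n%:R : R[i]) = 0.
Proof. by rewrite -(rmorph_nat (real_complex R)). Qed.
Lemma Re_sum (I : Type) (r : seq I) (P : pred I) (F : I -> R[i]) :
  complex.Re (\sum_(i <- r | P i) F i) = \sum_(i <- r | P i) complex.Re (F i).
Proof. exact: (big_morph _ ReD). Qed.
Lemma Im_sum (I : Type) (r : seq I) (P : pred I) (F : I -> R[i]) :
  complex.Im (\sum_(i <- r | P i) F i) = \sum_(i <- r | P i) complex.Im (F i).
Proof. exact: (big_morph _ ImD). Qed.
Lemma eqc z w : complex.Re z = complex.Re w -> complex.Im z = complex.Im w -> z = w.
Proof. by case: z => a b; case: w => c d /= -> ->. Qed.
Lemma ReV z : complex.Re z^-1 = complex.Re z / nc z ^+ 2.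
Proof. by rewrite nc_sqr; case: z. Qed.
Lemma ImV z : complex.Im z^-1 = - complex.Im z / nc z ^+ 2.
Proof. by rewrite nc_sqr; case: z => a b /=; rewrite mulNr. Qed.

End modulus.

(** * The complex exponential *)

Section complex_exp.
Context {R : realType}.
Implicit Types (a b : R) (z w : R[i]).

Lemma Re_cexp z : complex.Re (cexp z) = expR (complex.Re z) * cos (complex.Im z).
Proof. by rewrite /cexp ReM /= mul0r subr0. Qed.
Lemma Im_cexp z : complex.Im (cexp z) = expR (complex.Re z) * sin (complex.Im z).
Proof. by rewrite /cexp ImM /= mul0r addr0. Qed.

Lemma cexpD z w : cexp (z + w) = cexp z * cexp w.
Proof.
apply: eqc.
  by rewrite [RHS]ReM !Re_cexp !Im_cexp ReD ImD expRD cosD; ring.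
by rewrite [RHS]ImM !Re_cexp !Im_cexp ReD ImD expRD sinD; ring.
Qed.

Lemma cexp0 : cexp (0 : R[i]) = 1.
Proof.
apply: eqc; first by rewrite Re_cexp /= expR0 cos0 mul1r.
by rewrite Im_cexp /= expR0 sin0 mul1r.
Qed.

Lemma cexp_real a : cexp a%:C = (expR a)%:C.
Proof.
by apply: eqc; [rewrite Re_cexp /= cos0 mulr1|rewrite Im_cexp /= sin0 mulr0].
Qed.

Lemma cexpN z : cexp (- z) = (cexp z)^-1.
Proof.
have h : cexp z * cexp (- z) = 1 by rewrite -cexpD subrr cexp0.
have z0 : cexp z != 0 by apply/eqP => z0; move: h; rewrite z0 mul0r => /esym/eqP; rewrite oner_eq0.
by apply: (mulfI z0); rewrite h divff.
Qed.

Lemma nc_cexp z : nc (cexp z) = expR (complex.Re z).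
Proof.
rewrite /cexp Normc.normcM nc_real ger0_norm ?expR_ge0 //=.
by rewrite cos2Dsin2 sqrtr1 mulr1.
Qed.

End complex_exp.

(** * First and second order bounds for the exponential *)

Section real_estimates.
Context {R : realType}.
Implicit Types a b : R.

Lemma mean_value_le (f df : R -> R) (M b : R) :
  (forall x : R, is_derive x 1 f (df x)) ->
  (forall x, `|x| <= `|b| -> `|df x| <= M) -> `|f b - f 0| <= M * `|b|.
Proof.
move=> fdf dfM.
have cf : continuous f.
  by move=> x; apply: differentiable_continuous; apply/derivable1_diffP; have [] := fdf x.
have [b0|b0] := leP 0 b.
- have [c] := @MVT_segment _ f df 0 b b0 (fun x _ => fdf x) (continuous_subspaceT cf).
  rewrite in_itv /= subr0 => /andP[c0 cb] ->.
  rewrite normrM ler_wpM2r // dfM // !ger0_norm //.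
- have [c] := @MVT_segment _ f df b 0 (ltW b0) (fun x _ => fdf x) (continuous_subspaceT cf).
  rewrite in_itv /= sub0r => /andP[c0 cb] h.
  rewrite distrC h normrM normrN ler_wpM2r // dfM // !ler0_norm ?(ltW b0) //.
  by rewrite lerN2.
Qed.

Lemma normr_sin_le b : `|sin b| <= `|b|.
Proof.
have := @mean_value_le sin cos 1 b.
by rewrite sin0 subr0 mul1r; apply => // x _; exact: cos_max.
Qed.

Lemma normr_cosB1_le b : `|cos b - 1| <= `|b|.
Proof.
have := @mean_value_le cos (fun x => - sin x) 1 b.
by rewrite cos0 mul1r; apply => // x _; rewrite normrN sin_max.
Qed.

Lemma normr_cosB1_le2 b : `|cos b - 1| <= b ^+ 2.
Proof.
have := @mean_value_le cos (fun x => - sin x) `|b| b.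
rewrite cos0 -expr2 real_normK ?num_real //; apply => // x xb.
by rewrite normrN (le_trans (normr_sin_le _)).
Qed.

Lemma normr_sinB_le2 b : `|sin b - b| <= b ^+ 2.
Proof.
have := @mean_value_le (fun x => sin x - x) (fun x => cos x - 1) `|b| b.
rewrite sin0 !subr0 -expr2 real_normK ?num_real //; apply => // x xb.
by rewrite (le_trans (normr_cosB1_le _)).
Qed.

Lemma expRB1_le a : expR a - 1 <= a * expR a.
Proof.
have := expR_ge1Dx (- a); rewrite -(ler_pM2r (expR_gt0 a)) -expRD addNr expR0.
lra.
Qed.

Lemma normr_expRB1_le a : `|expR a - 1| <= `|a| * (1 + expR a).
Proof.
have h1 := expRB1_le a; have h2 := expR_ge1Dx a; have h3 := expR_gt0 a.
have [a0|a0] := leP 0 a.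
  rewrite (ger0_norm a0) ger0_norm; lra.
have a1 : expR a <= 1 by rewrite -expR0 ler_expR ltW.
rewrite (ler0_norm (ltW a0)) ler0_norm; nra.
Qed.

Lemma normr_expRB1B_le a : `|expR a - 1 - a| <= a ^+ 2 * (1 + expR a).
Proof.
have h1 := expRB1_le a; have h2 := expR_ge1Dx a; have h3 := expR_gt0 a.
rewrite ger0_norm; last lra.
have := normr_expRB1_le a.
have [a0|a0] := leP 0 a.
  rewrite (ger0_norm a0) ger0_norm; last lra.
  nra.
rewrite (ler0_norm (ltW a0)) ler0_norm; last by rewrite subr_le0 -expR0 ler_expR ltW.
nra.
Qed.

(** On the segment from 0 to z the modulus of [cexp] is at most max (1, e^(Re z)), hence the factor
    1 + e^(Re z). Multiplied by the modulus of [cexp a], it becomes the sum of the moduli at a and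
    at a + z, the form exploited in [holK_gumbel]. *)
Lemma nc_cexpB1_le (z : R[i]) :
  nc (cexp z - 1) <= 3 * nc z * (1 + expR (complex.Re z)).
Proof.
apply: (le_trans (nc_le_ReIm _)).
rewrite ReD ImD ReN ImN Re_cexp Im_cexp /= subr0.
set a := complex.Re z; set b := complex.Im z.
have ha : `|a| <= nc z := normr_Re_le_nc z; have hb : `|b| <= nc z := normr_Im_le_nc z.
have e0 := expR_gt0 a.
have -> : expR a * cos b - 1 = (expR a - 1) + expR a * (cos b - 1) by ring.
have h1 := normr_expRB1_le a; have h2 := normr_cosB1_le b; have h3 := normr_sin_le b.
have h4 := ler_normD (expR a - 1) (expR a * (cos b - 1)).
have h5 : `|expR a * (cos b - 1)| <= expR a * nc z.
  by rewrite normrM ger0_norm ?(ltW e0) // ler_pM2l // (le_trans h2).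
have h6 : `|expR a * sin b| <= expR a * nc z.
  by rewrite normrM ger0_norm ?(ltW e0) // ler_pM2l // (le_trans h3).
have h7 : `|a| * (1 + expR a) <= nc z * (1 + expR a).
  by rewrite ler_wpM2r // addr_ge0 ?expR_ge0.
have := nc_ge0 z.
nra.
Qed.

Lemma nc_cexpB1B_le (z : R[i]) :
  nc (cexp z - 1 - z) <= 4 * nc z ^+ 2 * (1 + expR (complex.Re z)).
Proof.
apply: (le_trans (nc_le_ReIm _)).
rewrite !ReD !ImD !ReN !ImN Re_cexp Im_cexp /= subr0.
set a := complex.Re z; set b := complex.Im z.
have ha : `|a| <= nc z := normr_Re_le_nc z; have hb : `|b| <= nc z := normr_Im_le_nc z.
have e0 := expR_gt0 a.
have ha2 : a ^+ 2 <= nc z ^+ 2 by rewrite nc_sqr lerDl sqr_ge0.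
have hb2 : b ^+ 2 <= nc z ^+ 2 by rewrite nc_sqr lerDr sqr_ge0.
have -> : expR a * cos b - 1 - a = (expR a - 1 - a) + expR a * (cos b - 1) by ring.
have -> : expR a * sin b - b = (expR a - 1) * sin b + (sin b - b) by ring.
have h1 := normr_expRB1B_le a; have h1' := normr_expRB1_le a.
have h2 := normr_cosB1_le2 b; have h3 := normr_sin_le b; have h3' := normr_sinB_le2 b.
have h4 := ler_normD (expR a - 1 - a) (expR a * (cos b - 1)).
have h4' := ler_normD ((expR a - 1) * sin b) (sin b - b).
have h5 : `|expR a * (cos b - 1)| <= expR a * nc z ^+ 2.
  by rewrite normrM ger0_norm ?(ltW e0) // ler_pM2l // (le_trans h2).
have h6 : `|(expR a - 1) * sin b| <= (nc z * (1 + expR a)) * nc z.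
  rewrite normrM ler_pM //; last exact: le_trans hb.
  by rewrite (le_trans h1') // ler_wpM2r // addr_ge0 ?expR_ge0.
have h7 : a ^+ 2 * (1 + expR a) <= nc z ^+ 2 * (1 + expR a).
  by rewrite ler_wpM2r // addr_ge0 ?expR_ge0.
have := sqr_ge0 (nc z).
nra.
Qed.

End real_estimates.

(** * Integration of complex-valued functions *)

Section complex_measurability.
Context d (T : measurableType d) {R : realType}.
Implicit Types (D : set T) (f g : T -> R[i]).

Definition cmeas D f :=
  measurable_fun D (fun u => complex.Re (f u)) /\
  measurable_fun D (fun u => complex.Im (f u)).

Lemma cmeasT_sub D f : cmeas setT f -> cmeas D f.
Proof. by move=> [h1 h2]; split; exact: measurable_funTS. Qed.

Lemma cmeas_real D (h : T -> R) : measurable_fun D h -> cmeas D (fun u => (h u)%:C).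
Proof. by move=> mh; split => //=; exact: measurable_cst. Qed.

Lemma cmeas_cst D (z : R[i]) : cmeas D (fun=> z).
Proof. by split; exact: measurable_cst. Qed.

Lemma cmeasD D f g : cmeas D f -> cmeas D g -> cmeas D (fun u => f u + g u).
Proof.
move=> [f1 f2] [g1 g2]; split.
  by under eq_fun do rewrite ReD; exact: measurable_funD.
by under eq_fun do rewrite ImD; exact: measurable_funD.
Qed.

Lemma cmeasM D f g : cmeas D f -> cmeas D g -> cmeas D (fun u => f u * g u).
Proof.
move=> [f1 f2] [g1 g2]; split.
  by under eq_fun do rewrite ReM; apply: measurable_funB; exact: measurable_funM.
by under eq_fun do rewrite ImM; apply: measurable_funD; exact: measurable_funM.
Qed.

Lemma cmeasN D f : cmeas D f -> cmeas D (fun u => - f u).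
Proof.
move=> mf; under eq_fun do rewrite -mulN1r; apply: cmeasM => //; exact: cmeas_cst.
Qed.

Lemma cmeasB D f g : cmeas D f -> cmeas D g -> cmeas D (fun u => f u - g u).
Proof. by move=> mf mg; apply: cmeasD => //; exact: cmeasN. Qed.

Lemma measurable_nc D f : cmeas D f -> measurable_fun D (fun u => nc (f u)).
Proof.
move=> [f1 f2]; under eq_fun do rewrite ncE.
apply: (@measurableT_comp _ _ _ _ _ _ (@Num.sqrt R)).
  by apply: continuous_measurable_fun; exact: sqrt_continuous.
by apply: measurable_funD; exact: measurable_funX.
Qed.

(** Inversion is continuous off 0, and the value 0^-1 = 0 only concerns the measurable set {0}. *)
Lemma measurable_invr : measurable_fun setT (@GRing.inv R).
Proof.
have m0 : measurable [set 0 : R] := measurable_set1 0.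
rewrite -(setUv [set 0 : R]).
apply/(measurable_funU _ m0 (measurableC m0)); split.
  move=> _ Y mY; have [h|h] := pselect (Y 0^-1).
    by rewrite (_ : _ `&` _ = [set 0]) //; apply/seteqP; split => [x []|x ->].
  rewrite (_ : _ `&` _ = set0) //.
  by apply/seteqP; split => // x [] /= ->.
apply: open_continuous_measurable_fun; first by apply: closed_openC; exact: closed_eq.
by move=> x; rewrite inE /= => /eqP x0; apply: inv_continuous.
Qed.

Lemma cmeasV D f : cmeas D f -> cmeas D (fun u => (f u)^-1).
Proof.
move=> mf; have [f1 f2] := mf.
have mn : measurable_fun D (fun u => (nc (f u) ^+ 2)^-1).
  apply: (@measurableT_comp _ _ _ _ _ _ (@GRing.inv R)); first exact: measurable_invr.
  exact/measurable_funX/measurable_nc.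
split.
  by under eq_fun do rewrite ReV; exact: measurable_funM.
under eq_fun do rewrite ImV; apply: measurable_funM => //.
exact: measurable_funN.
Qed.

Lemma cmeasX D f n : cmeas D f -> cmeas D (fun u => f u ^+ n).
Proof.
move=> mf; elim: n => [|n IH]; first by under eq_fun do rewrite expr0; exact: cmeas_cst.
by under eq_fun do rewrite exprS; exact: cmeasM.
Qed.

Lemma cmeas_prod D (I : Type) (r : seq I) (F : I -> T -> R[i]) :
  (forall i, cmeas D (F i)) -> cmeas D (fun u => \prod_(i <- r) F i u).
Proof.
move=> h; elim: r => [|i r IH].
  by under eq_fun do rewrite big_nil; exact: cmeas_cst.
by under eq_fun do rewrite big_cons; exact: cmeasM.
Qed.

Lemma cmeas_cexp D f : cmeas D f -> cmeas D (fun u => cexp (f u)).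
Proof.
move=> [f1 f2]; split.
  under eq_fun do rewrite Re_cexp; apply: measurable_funM.
    exact: measurableT_comp (@measurable_expR R) f1.
  by apply: measurableT_comp f2; apply: continuous_measurable_fun; exact: continuous_cos.
under eq_fun do rewrite Im_cexp; apply: measurable_funM.
  exact: measurableT_comp (@measurable_expR R) f1.
by apply: measurableT_comp f2; apply: continuous_measurable_fun; exact: continuous_sin.
Qed.

Lemma cmeas_eq D f g : {in D, f =1 g} -> cmeas D f -> cmeas D g.
Proof.
by move=> fg [f1 f2]; split; [apply: eq_measurable_fun f1|apply: eq_measurable_fun f2]
  => x Dx; rewrite (fg x Dx).
Qed.

End complex_measurability.

Section complex_integration.
Context {R : realType}.
Notation mu := (@lebesgue_measure R).
Implicit Types (D : set R) (f g : R -> R[i]) (h : R -> R).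

Definition rint D h := mu.-integrable D (fun u => (h u)%:E).

Definition cint D f :=
  rint D (fun u => complex.Re (f u)) /\ rint D (fun u => complex.Im (f u)).

Lemma rint_meas D h : rint D h -> measurable_fun D h.
Proof. by move=> /measurable_int /measurable_EFinP. Qed.

Lemma rint_dom D (h k : R -> R) : measurable D -> measurable_fun D h ->
  rint D k -> (forall u, D u -> `|h u| <= k u) -> rint D h.
Proof.
move=> mD mh ik hk; apply: le_integrable ik => //; first exact/measurable_EFinP.
move=> x Dx; rewrite lee_fin (le_trans (hk x Dx)) // ler_norm //.
Qed.

Lemma rintD D (h k : R -> R) : measurable D -> rint D h -> rint D k ->
  rint D (fun u => h u + k u).
Proof. by move=> mD ih ik; apply: eq_integrable (integrableD _ ih ik). Qed.

Lemma rintZ D (a : R) (h : R -> R) : measurable D -> rint D h ->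
  rint D (fun u => a * h u).
Proof. by move=> mD ih; apply: eq_integrable (integrableZl _ a ih). Qed.

Lemma rint_eq D (h k : R -> R) : measurable D -> (forall u, D u -> h u = k u) ->
  rint D h -> rint D k.
Proof. by move=> mD hk; apply: eq_integrable => // x; rewrite inE => /hk ->. Qed.

Lemma rint_sub (D E : set R) h : measurable D -> measurable E -> D `<=` E ->
  rint E h -> rint D h.
Proof. by move=> mD mE DE; exact: integrableS. Qed.

Lemma cint_meas D f : cint D f -> cmeas D f.
Proof. by move=> [/rint_meas h1 /rint_meas h2]. Qed.

Lemma cint_dom D f h : measurable D -> cmeas D f ->
  rint D h -> (forall u, D u -> nc (f u) <= h u) -> cint D f.
Proof.
move=> mD [f1 f2] ih fh; split; apply: rint_dom ih _ => // u Du.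
  exact: le_trans (normr_Re_le_nc _) (fh u Du).
exact: le_trans (normr_Im_le_nc _) (fh u Du).
Qed.

Lemma rint_nc D f : measurable D -> cint D f -> rint D (fun u => nc (f u)).
Proof.
move=> mD cf; have [f1 f2] := cf.
apply: (@rint_dom _ _ (fun u => `|complex.Re (f u)| + `|complex.Im (f u)|)) => //.
- exact/measurable_nc/cint_meas.
- by apply: rintD => //; exact: integrable_norm.
- by move=> u _; rewrite ger0_norm ?nc_ge0 ?nc_le_ReIm.
Qed.

Lemma cint_sub (D E : set R) f : measurable D -> measurable E -> D `<=` E ->
  cint E f -> cint D f.
Proof. by move=> mD mE DE [f1 f2]; split; apply: rint_sub DE _. Qed.

Lemma cint_eq D f g : measurable D -> (forall u, D u -> f u = g u) ->
  cint D f -> cint D g.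
Proof. by move=> mD fg [f1 f2]; split; [apply: rint_eq f1|apply: rint_eq f2] => // u /fg ->. Qed.

Lemma cintD D f g : measurable D -> cint D f -> cint D g -> cint D (fun u => f u + g u).
Proof.
move=> mD [f1 f2] [g1 g2]; split.
  by apply: rint_eq (rintD mD f1 g1) => // u _; rewrite ReD.
by apply: rint_eq (rintD mD f2 g2) => // u _; rewrite ImD.
Qed.

Lemma cintZ D (z : R[i]) f : measurable D -> cint D f -> cint D (fun u => z * f u).
Proof.
move=> mD cf; apply: (@cint_dom _ _ (fun u => nc z * nc (f u))) => //.
- by apply: cmeasM; [exact: cmeas_cst|exact: cint_meas].
- by apply: rintZ => //; exact: rint_nc.
- by move=> u _; rewrite Normc.normcM.
Qed.

Lemma cintB D f g : measurable D -> cint D f -> cint D g -> cint D (fun u => f u - g u).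
Proof.
move=> mD cf cg; apply: cintD => //.
by apply: cint_eq (cintZ (-1) mD cg) => // u _; rewrite mulN1r.
Qed.

Lemma rint0 D : measurable D -> rint D (fun=> 0).
Proof. by move=> mD; exact: integrable0. Qed.

Lemma cint_sum D (I : Type) (r : seq I) (F : I -> R -> R[i]) : measurable D ->
  (forall i, cint D (F i)) -> cint D (fun u => \sum_(i <- r) F i u).
Proof.
move=> mD h; elim: r => [|i r IH].
  by under eq_fun do rewrite big_nil; split; exact: rint0.
by under eq_fun do rewrite big_cons; exact: cintD.
Qed.

Lemma eq_cintegral D f g : (forall u, D u -> f u = g u) -> cintegral D f = cintegral D g.
Proof.
by move=> fg; rewrite /cintegral; congr (_ +i* _); apply: eq_Rintegral => u;
  rewrite inE => /fg ->.
Qed.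

Lemma cintegralD D f g : measurable D -> cint D f -> cint D g ->
  cintegral D (fun u => f u + g u) = cintegral D f + cintegral D g.
Proof.
move=> mD [f1 f2] [g1 g2]; apply: eqc; rewrite /cintegral /=.
  by under eq_Rintegral do rewrite ReD; rewrite RintegralD.
by under eq_Rintegral do rewrite ImD; rewrite RintegralD.
Qed.

Lemma cintegralZ D (z : R[i]) f : measurable D -> cint D f ->
  cintegral D (fun u => z * f u) = z * cintegral D f.
Proof.
move=> mD [f1 f2]; apply: eqc.
  rewrite ReM /cintegral /=; under eq_Rintegral do rewrite ReM.
  by rewrite RintegralB ?RintegralZl //; exact: rintZ.
rewrite ImM /cintegral /=; under eq_Rintegral do rewrite ImM.
by rewrite RintegralD ?RintegralZl //; exact: rintZ.
Qed.

Lemma cintegralZr D (z : R[i]) f : measurable D -> cint D f ->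
  cintegral D (fun u => f u * z) = cintegral D f * z.
Proof.
move=> mD cf; rewrite mulrC -cintegralZ //.
by apply: eq_cintegral => u _; rewrite mulrC.
Qed.

Lemma cintegralB D f g : measurable D -> cint D f -> cint D g ->
  cintegral D (fun u => f u - g u) = cintegral D f - cintegral D g.
Proof.
move=> mD cf cg.
rewrite cintegralD //; last by apply: cint_eq (cintZ (-1) mD cg) => // u _; rewrite mulN1r.
congr (_ + _); rewrite -mulN1r -cintegralZ //.
by apply: eq_cintegral => u _; rewrite mulN1r.
Qed.

Lemma cintegral_sum D (I : Type) (r : seq I) (F : I -> R -> R[i]) : measurable D ->
  (forall i, cint D (F i)) ->
  cintegral D (fun u => \sum_(i <- r) F i u) = \sum_(i <- r) cintegral D (F i).
Proof.
move=> mD h; elim: r => [|i r IH].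
  rewrite big_nil; under eq_cintegral do rewrite big_nil.
  by rewrite /cintegral /= /Rintegral integral0.
rewrite big_cons -IH -cintegralD //; last exact: cint_sum.
by apply: eq_cintegral => u _; rewrite big_cons.
Qed.

(** The factor 2 comes from bounding the real and the imaginary part separately; later constants
    account for it. *)
Lemma nc_cintegral_le D f h : measurable D -> cmeas D f -> rint D h ->
  (forall u, D u -> nc (f u) <= h u) ->
  nc (cintegral D f) <= 2 * (\int[mu]_(u in D) h u).
Proof.
move=> mD mf ih fh; have [f1 f2] := cint_dom mD mf ih fh.
apply: (le_trans (nc_le_ReIm _)); rewrite mulr2n mulrDl mul1r; apply: lerD => /=.
  apply: (le_trans (le_normr_Rintegral _ f1)) => //; apply: le_Rintegral => //.
    exact: integrable_norm.
  by move=> u Du; rewrite (le_trans (normr_Re_le_nc _)) ?fh.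
apply: (le_trans (le_normr_Rintegral _ f2)) => //; apply: le_Rintegral => //.
  exact: integrable_norm.
by move=> u Du; rewrite (le_trans (normr_Im_le_nc _)) ?fh.
Qed.

End complex_integration.

(** * Countable sets, dominated convergence and Fubini *)

Section integral_tools.
Context {R : realType}.
Notation mu := (@lebesgue_measure R).
Implicit Types (D : set R) (f g : R -> R[i]) (h : R -> R).

(** Every subset of a countable set is Borel, so changing a function on N keeps it measurable
    without completing the measure. *)
Lemma measurable_fun_countable_eq D N (h k : R -> R) : measurable D -> countable N ->
  (forall u, D u -> ~ N u -> h u = k u) -> measurable_fun D h -> measurable_fun D k.
Proof.
move=> mD cN hk mh.
have mN : measurable N by apply: countable_measurable => // t; exact: measurable_set1.
rewrite -(setUIDK D N) setUC.
have mDN : measurable (D `\` N) by exact: measurableD.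
have mDIN : measurable (D `&` N) by exact: measurableI.
apply/(measurable_funU _ mDN mDIN); split.
  apply: (@eq_measurable_fun _ _ _ _ _ h).
    by move=> u /set_mem [Du Nu]; exact: hk.
  by apply: measurable_funS mh => // u [].
move=> _ Y mY; apply: countable_measurable; first by move=> t; exact: measurable_set1.
by apply: sub_countable cN; apply: subset_card_le => u [[]].
Qed.

Lemma cmeas_countable_eq D N f g : measurable D -> countable N ->
  (forall u, D u -> ~ N u -> f u = g u) -> cmeas D f -> cmeas D g.
Proof.
move=> mD cN fg [f1 f2].
by split; [apply: (measurable_fun_countable_eq mD cN _ f1)|
  apply: (measurable_fun_countable_eq mD cN _ f2)] => u Du Nu; rewrite fg.
Qed.

Lemma eq_Rintegral_countable D N (h k : R -> R) : measurable D -> countable N ->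
  (forall u, D u -> ~ N u -> h u = k u) -> measurable_fun D h ->
  \int[mu]_(u in D) h u = \int[mu]_(u in D) k u.
Proof.
move=> mD cN hk mh; rewrite /Rintegral; congr fine.
have mk := measurable_fun_countable_eq mD cN hk mh.
have mN : measurable N by apply: countable_measurable => // t; exact: measurable_set1.
apply: ae_eq_integral => //; [exact/measurable_EFinP|exact/measurable_EFinP|].
exists N; split => //; first exact: countable_lebesgue_measure0.
by move=> u /= /not_implyP [Du huk]; apply: contrapT => Nu; apply: huk; rewrite hk.
Qed.

(** This discards the parameters at which a conventional value, of [Gamma] at a pole or of a
    derivative at a corner, differs from the expected one. *)
Lemma eq_cintegral_countable D N f g : measurable D -> countable N ->
  (forall u, D u -> ~ N u -> f u = g u) -> cmeas D f -> cintegral D f = cintegral D g.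
Proof.
move=> mD cN fg [f1 f2]; apply: eqc => /=.
  by apply: (eq_Rintegral_countable mD cN _ f1) => u Du Nu; rewrite fg.
by apply: (eq_Rintegral_countable mD cN _ f2) => u Du Nu; rewrite fg.
Qed.

Lemma Rintegral_dct D (h_ : nat -> R -> R) h k : measurable D ->
  (forall n, measurable_fun D (h_ n)) ->
  (forall u, D u -> h_ n u @[n --> \oo] --> h u) ->
  rint D k -> (forall n u, D u -> `|h_ n u| <= k u) ->
  rint D h /\ (\int[mu]_(u in D) h_ n u @[n --> \oo] --> \int[mu]_(u in D) h u).
Proof.
move=> mD mh hh ik hk.
have mlim : measurable_fun D h.
  apply: (measurable_fun_cvg mh) => u Du; exact: hh.
have [||||||ih _ H] := @dominated_convergence _ _ _ mu D _ (fun n u => (h_ n u)%:E)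
   (EFin \o h) (EFin \o k).
- by [].
- by move=> n; apply/measurable_EFinP; exact: (mh n).
- by apply/measurable_EFinP; exact: mlim.
- by apply: aeW => u Du; apply: cvg_EFin; [exact: nearW|exact: hh].
- exact: ik.
- by apply: aeW => u n Du; rewrite lee_fin hk.
split => //.
have fin : (\int[mu]_(u in D) (h u)%:E)%E \is a fin_num by exact: integrable_fin_num.
apply: fine_cvg; rewrite fineK //.
Qed.

Definition ccvg (z_ : nat -> R[i]) (z : R[i]) :=
  (complex.Re (z_ n) @[n --> \oo] --> complex.Re z) /\
  (complex.Im (z_ n) @[n --> \oo] --> complex.Im z).

Lemma ccvg_unique (z_ : nat -> R[i]) z w : ccvg z_ z -> ccvg z_ w -> z = w.
Proof.
by move=> [z1 z2] [w1 w2]; apply: eqc; [apply: cvg_unique z1 w1|apply: cvg_unique z2 w2].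
Qed.

Lemma cintegral_dct D (f_ : nat -> R -> R[i]) f h : measurable D ->
  (forall n, cmeas D (f_ n)) ->
  (forall u, D u -> ccvg (f_ ^~ u) (f u)) ->
  rint D h -> (forall n u, D u -> nc (f_ n u) <= h u) ->
  cint D f /\ ccvg (fun n => cintegral D (f_ n)) (cintegral D f).
Proof.
move=> mD mf ff ih fh.
have [|||i1 c1] := @Rintegral_dct D (fun n u => complex.Re (f_ n u))
  (fun u => complex.Re (f u)) h mD _ _ ih.
- by move=> n; exact: (mf n).1.
- by move=> u Du; exact: (ff u Du).1.
- by move=> n u Du; rewrite (le_trans (normr_Re_le_nc _)) ?fh.
have [|||i2 c2] := @Rintegral_dct D (fun n u => complex.Im (f_ n u))
  (fun u => complex.Im (f u)) h mD _ _ ih.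
- by move=> n; exact: (mf n).2.
- by move=> u Du; exact: (ff u Du).2.
- by move=> n u Du; rewrite (le_trans (normr_Im_le_nc _)) ?fh.
by split.
Qed.

(** The product majorant makes F integrable on the plane and each of its sections integrable, so the
    real-valued iterated integrals agree with the extended ones, to which Fubini's theorem
    applies. *)
Lemma Rintegral_Fubini (F : R * R -> R) (a b : R -> R) :
  measurable_fun setT F -> rint setT a -> rint setT b ->
  (forall x y, `|F (x, y)| <= a x * b y) ->
  \int[mu]_x \int[mu]_y F (x, y) = \int[mu]_y \int[mu]_x F (x, y).
Proof.
move=> mF ia ib Fab.
have m1 x : measurable_fun setT (fun y => F (x, y)) by exact: measurableT_comp.
have m2 y : measurable_fun setT (fun x => F (x, y)) by exact: measurableT_comp.
have i1 x : rint setT (fun y => F (x, y)) by apply: rint_dom (rintZ (a x) _ ib) _.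
have i2 y : rint setT (fun x => F (x, y)).
  by apply: rint_dom (rintZ (b y) _ ia) _ => // x _; rewrite mulrC.
have iF : (mu \x mu)%E.-integrable setT (EFin \o F).
  apply/integrable12ltyP; first exact/measurable_EFinP.
  have ba x : (\int[mu]_y `|(EFin \o F) (x, y)| <= (a x * \int[mu]_y b y)%:E)%E.
    rewrite -RintegralZl // /Rintegral fineK; last first.
      by apply: integrable_fin_num => //; exact: rintZ.
    apply: ge0_le_integral => //.
    - apply: (@measurableT_comp _ _ _ _ _ _ (@abse R)) => //.
      by apply/measurable_EFinP; exact: m1.
    - apply/measurable_EFinP; exact: (rint_meas (rintZ (a x) measurableT ib)).
    - by move=> y _; rewrite lee_fin.
  apply: (@le_lt_trans _ _ (\int[mu]_x (a x * \int[mu]_y b y)%:E)%E).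
    apply: ge0_le_integral => //.
    - by move=> x _; apply: integral_ge0.
    - apply: (@measurable_fun_fubini_tonelli_F _ _ _ _ R mu
        (fun z => `|(EFin \o F) z|%E)) => //.
      by apply: (@measurableT_comp _ _ _ _ _ _ (@abse R)) => //; exact/measurable_EFinP.
    - apply/measurable_EFinP; apply: measurable_funM => //; exact: (rint_meas ia).
  rewrite ltey_eq; apply/orP; left.
  apply: integrable_fin_num => //.
  by apply: rint_eq (rintZ (\int[mu]_y b y) _ ia) => // x _; rewrite mulrC.
rewrite /Rintegral; congr fine.
rewrite [LHS](_ : _ = \int[mu]_x \int[mu]_y (EFin \o F) (x, y))%E; last first.
  by apply: eq_integral => x _; rewrite fineK //; exact: (integrable_fin_num _ (i1 x)).
rewrite [RHS](_ : _ = \int[mu]_y \int[mu]_x (EFin \o F) (x, y))%E; last first.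
  by apply: eq_integral => y _; rewrite fineK //; exact: (integrable_fin_num _ (i2 y)).
exact: Fubini.
Qed.

Lemma cintegral_Fubini (F : R * R -> R[i]) (a b : R -> R) :
  cmeas setT F -> rint setT a -> rint setT b ->
  (forall x y, nc (F (x, y)) <= a x * b y) ->
  cintegral setT (fun x => cintegral setT (fun y => F (x, y))) =
  cintegral setT (fun y => cintegral setT (fun x => F (x, y))).
Proof.
move=> [F1 F2] ia ib Fab; apply: eqc => /=.
  apply: (@Rintegral_Fubini (fun z => complex.Re (F z)) a b) => // x y.
  by rewrite (le_trans (normr_Re_le_nc _)).
apply: (@Rintegral_Fubini (fun z => complex.Im (F z)) a b) => // x y.
by rewrite (le_trans (normr_Im_le_nc _)).
Qed.

End integral_tools.

(** * The fundamental theorem of calculus on unbounded intervals *)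

Section ftc_limits.
Context {R : realType}.
Notation mu := (@lebesgue_measure R).
Implicit Types (D : set R).

Lemma cvg_ext (u v : nat -> R) (l : R) : (forall n, u n = v n) ->
  u @ \oo --> l -> v @ \oo --> l.
Proof. by move=> uv; rewrite (_ : u = v) //; apply/funext. Qed.

Lemma derivative_continuous (f F : R -> R) :
  (forall x : R, is_derive x 1 F (f x)) -> continuous F.
Proof.
by move=> dF x; apply: differentiable_continuous; apply/derivable1_diffP; have [] := dF x.
Qed.

Lemma FTC_segment (f F : R -> R) (a b : R) : a < b -> continuous f ->
  (forall x : R, is_derive x 1 F (f x)) ->
  (\int[mu]_(x in `[a, b]) (f x)%:E)%E = (F b - F a)%:E.
Proof.
move=> ab cf dF; rewrite EFinB; apply: continuous_FTC2 => //.
- exact: continuous_subspaceT.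
- split.
  + by move=> x _; have [] := dF x.
  + by apply: cvg_at_right_filter; exact: (derivative_continuous dF).
  + by apply: cvg_at_left_filter; exact: (derivative_continuous dF).
- by move=> x _; rewrite derive1E; have [_ ->] := dF x.
Qed.

Lemma continuous_rmeas D (f : R -> R) : continuous f -> measurable_fun D f.
Proof. by move=> cf; apply: measurable_funTS; exact: continuous_measurable_fun. Qed.

Lemma Rintegral_exhaustion D (f : R -> R) (a b : nat -> R) : measurable D ->
  (forall n, `[a n, b n] `<=` D) ->
  (forall x, D x -> \forall n \near \oo, a n <= x <= b n) -> rint D f ->
  \int[mu]_(x in `[a n, b n]) f x @[n --> \oo] --> \int[mu]_(x in D) f x.
Proof.
move=> mD abD Dab fi.
pose f_ n := f \_ `[a n, b n].
have [||||_] := @Rintegral_dct _ D f_ f (fun x => `|f x|) mD.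
- move=> n; apply/(measurable_restrict _ _ _).1 => //.
  by apply: measurable_funS (rint_meas fi) => // x [].
- move=> x Dx; apply: cvg_near_cst; near=> n.
  rewrite /f_ patchE mem_set //= in_itv /=; near: n; exact: Dab.
- exact: integrable_norm.
- move=> n x Dx; rewrite /f_ patchE; case: ifP => // _; by rewrite normr0.
apply: cvg_ext => n; rewrite -Rintegral_mkcondr; congr (Rintegral _ _ _).
by rewrite setIidr.
Unshelve. all: by end_near. Qed.

Lemma Rintegral_FTC_lim D (f F : R -> R) (a b : nat -> R) (A B : R) : measurable D ->
  (forall n, a n < b n) -> (forall n, `[a n, b n] `<=` D) ->
  (forall x, D x -> \forall n \near \oo, a n <= x <= b n) ->
  continuous f -> (forall x : R, is_derive x 1 F (f x)) -> rint D f ->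
  F (a n) @[n --> \oo] --> A -> F (b n) @[n --> \oo] --> B ->
  \int[mu]_(x in D) f x = B - A.
Proof.
move=> mD ab abD Dab cf dF fi FA FB.
have h1 := Rintegral_exhaustion mD abD Dab fi.
apply: (cvg_unique _ h1) => //.
apply: cvg_ext (cvgB FB FA) => n.
by rewrite /Rintegral (FTC_segment (ab n) cf dF).
Qed.

(** The endpoints are n + 1 so that the segment is nondegenerate for n = 0 as well, which
    [FTC_segment] demands. *)
Lemma near_natr_segment (x : R) : \forall n \near \oo, - n.+1%:R <= x <= n.+1%:R.
Proof.
near=> n; rewrite -ler_norml.
have : `|x| <= n%:R by near: n; exact: nbhs_infty_ger.
by move=> /le_trans; apply; rewrite ler_nat.
Unshelve. all: by end_near. Qed.

Lemma Rintegral_FTC_T (f F : R -> R) (A B : R) :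
  continuous f -> (forall x : R, is_derive x 1 F (f x)) -> rint setT f ->
  F (- n.+1%:R) @[n --> \oo] --> A -> F n.+1%:R @[n --> \oo] --> B ->
  \int[mu]_x f x = B - A.
Proof.
move=> cf dF fi FA FB.
apply: (@Rintegral_FTC_lim setT f F (fun n => - n.+1%:R) (fun n => n.+1%:R)) => //.
- by move=> n; rewrite gtrN // ltr0n.
- by move=> x _; exact: near_natr_segment.
Qed.

(** For a nonnegative function integrability is read off the primitive: the integrals over growing
    segments tend to the integral over the line, by monotone convergence, and to the finite number B
    - A. *)
Lemma rint_FTC_T (f F : R -> R) (A B : R) :
  continuous f -> (forall x, 0 <= f x) -> (forall x : R, is_derive x 1 F (f x)) ->
  F (- n.+1%:R) @[n --> \oo] --> A -> F n.+1%:R @[n --> \oo] --> B -> rint setT f.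
Proof.
move=> cf f0 dF FA FB; apply/integrableP; split.
  by apply/measurable_EFinP; exact: continuous_rmeas.
pose D n := [set` `[- n.+1%:R, n.+1%:R : R]].
have DT : \bigcup_n D n = setT.
  apply/seteqP; split => // x _.
  have [n _ h] := near_natr_segment x.
  by exists n => //; rewrite /D /= in_itv /= h /=.
have H : (\int[mu]_(x in D n) `|(f x)%:E|)%E @[n --> \oo] --> (\int[mu]_x `|(f x)%:E|)%E.
  rewrite -DT; apply: ge0_nondecreasing_set_cvg_integral => //.
  - move=> m n mn; apply/subsetPset => x; rewrite /D /= !in_itv /= => /andP[h1 h2].
    by rewrite (le_trans _ h1) ?lerN2 ?(le_trans h2) // ler_nat.
  - by move=> n; exact: measurable_itv.
  - move=> n; apply: (@measurableT_comp _ _ _ _ _ _ (@abse R)) => //.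
    by apply/measurable_EFinP; exact: continuous_rmeas.
have E n : (\int[mu]_(x in D n) `|(f x)%:E|)%E = (F n.+1%:R - F (- n.+1%:R))%:E.
  rewrite -(FTC_segment _ cf dF); last by rewrite gtrN // ltr0n.
  by apply: eq_integral => x _; rewrite gee0_abs // lee_fin.
rewrite (_ : (fun n => _) = (fun n => (F n.+1%:R - F (- n.+1%:R))%:E)) in H; last first.
  by apply/funext => n; rewrite E.
have H2 : (F n.+1%:R - F (- n.+1%:R))%:E @[n --> \oo] --> (B - A)%:E.
  by apply: cvg_EFin; [exact: nearW|exact: cvgB].
by rewrite (cvg_unique _ H H2) ?ltry.
Qed.

Lemma is_derive_atan_cauchy (x : R) : is_derive x 1 (@atan R) (1 + x ^+ 2)^-1.
Proof. exact: is_derive1_atan. Qed.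

Lemma continuous_cauchy : continuous (fun x : R => (1 + x ^+ 2)^-1).
Proof.
move=> x; apply: (@cvgV _ _ _ _ (fun x : R => 1 + x ^+ 2)).
  by rewrite gt_eqF // ltr_wpDr // sqr_ge0.
by apply: cvgD; [exact: cvg_cst|exact: exprn_continuous].
Qed.

Lemma cvg_atan_nat : atan (n.+1%:R : R) @[n --> \oo] --> (pi / 2 : R).
Proof.
have h : (n.+1%:R : R) @[n --> \oo] --> +oo.
  apply/cvgryPge => A; near=> n.
  have : A <= n%:R by near: n; exact: nbhs_infty_ger.
  by move=> /le_trans; apply; rewrite ler_nat.
exact: (cvg_comp _ _ h (@cvgy_atan R)).
Unshelve. all: by end_near. Qed.

Lemma cvg_atan_Nnat : atan (- n.+1%:R : R) @[n --> \oo] --> (- (pi / 2) : R).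
Proof.
by apply: cvg_ext (cvgN cvg_atan_nat) => n; rewrite atanN.
Qed.

(** The standard integrable majorant for what follows; its mass pi is also the constant of
    [Cahen_Mellin]. *)
Lemma rint_cauchy : rint setT (fun x : R => (1 + x ^+ 2)^-1).
Proof.
apply: rint_FTC_T continuous_cauchy _ is_derive_atan_cauchy cvg_atan_Nnat cvg_atan_nat.
by move=> x; rewrite invr_ge0 addr_ge0 // sqr_ge0.
Qed.

Lemma Rintegral_cauchy : \int[mu]_x (1 + x ^+ 2)^-1 = pi.
Proof.
rewrite (Rintegral_FTC_T continuous_cauchy is_derive_atan_cauchy rint_cauchy
  cvg_atan_Nnat cvg_atan_nat).
by rewrite opprK -splitr.
Qed.

End ftc_limits.

(** * Change of variables on the line *)

Section substitution.
Context {R : realType}.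
Notation mu := (@lebesgue_measure R).
Implicit Types (D : set R).

Lemma ge0_integral_exhaustion D (f : R -> R) (a b : nat -> R) :
  (forall n, `[a n, b n] `<=` D) -> (forall n, a n.+1 <= a n) -> (forall n, b n <= b n.+1) ->
  (forall x, D x -> \forall n \near \oo, a n <= x <= b n) ->
  measurable_fun D f -> (forall x, D x -> 0 <= f x) ->
  (\int[mu]_(x in `[a n, b n]) (f x)%:E)%E @[n --> \oo] --> (\int[mu]_(x in D) (f x)%:E)%E.
Proof.
move=> abD da ib Dab mf f0.
pose E n := [set` `[a n, b n]].
have ED : \bigcup_n E n = D.
  apply/seteqP; split => [x [n _ /abD //]|x Dx].
  by have [n _ h] := Dab x Dx; exists n => //; rewrite /E /= in_itv /= h /=.
rewrite -[in X in _ --> X]ED; apply: ge0_nondecreasing_set_cvg_integral => //.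
- have ha : {homo a : m n / (m <= n)%N >-> n <= m}.
    by apply: homo_leq => // y x z h1 h2; exact: le_trans h2 h1.
  have hb : {homo b : m n / (m <= n)%N >-> m <= n}.
    by apply: homo_leq => // y x z; exact: le_trans.
  move=> m n mn; apply/subsetPset => x; rewrite /E /= !in_itv /= => /andP[h1 h2].
  by rewrite (le_trans _ h1) ?(le_trans h2) // (ha, hb).
- move=> n; apply/measurable_EFinP; apply: (measurable_funS _ (abD n) mf).
  by rewrite -ED; apply: bigcupT_measurable => k; exact: measurable_itv.
- by move=> n x Enx; rewrite lee_fin f0 // -ED; exists n.
Qed.

(** The positive and negative parts of a continuous G are continuous and nonnegative, and the
    integral is by definition the difference of theirs. Hence a substitution rule obtained for
    nonnegative functions by monotone limits extends to G. *)
Lemma integral_signed_ext D E (Phi w : R -> R) (G : R -> R) :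
  (forall y, D y -> {for y, continuous G}) -> (forall v, 0 <= w v) ->
  (forall H : R -> R, (forall y, D y -> {for y, continuous H}) ->
    (forall y, 0 <= H y) ->
    (\int[mu]_(y in D) (H y)%:E = \int[mu]_(v in E) (H (Phi v) * w v)%:E)%E) ->
  (\int[mu]_(y in D) (G y)%:E = \int[mu]_(v in E) (G (Phi v) * w v)%:E)%E.
Proof.
move=> cG w0 ext; rewrite integralE [RHS]integralE; congr (_ - _)%E.
- transitivity (\int[mu]_(y in D) (Num.max (G y) 0)%:E)%E.
    by apply: eq_integral => y _; rewrite funeposE EFin_max.
  rewrite ext.
  + by apply: eq_integral => v _; rewrite funeposE -EFin_max maxr_pMl // mul0r.
  + move=> y Dy; apply: continuous_max; first exact: cG.
    exact: cst_continuous.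
  + by move=> y; rewrite le_max lexx orbT.
- transitivity (\int[mu]_(y in D) (Num.max (- G y) 0)%:E)%E.
    by apply: eq_integral => y _; rewrite funenegE EFin_max.
  rewrite ext.
  + by apply: eq_integral => v _; rewrite funenegE -EFinN -EFin_max -mulNr maxr_pMl // mul0r.
  + move=> y Dy; apply: continuous_max; last exact: cst_continuous.
    by apply: continuousN; exact: cG.
  + by move=> y; rewrite le_max lexx orbT.
Qed.

(** For nonnegative functions both sides are monotone limits over corresponding segments, on which
    the substitution rule is known. *)
Lemma integral_subst_increasing D (F F' G : R -> R) : open D ->
  (forall x : R, is_derive x 1 F (F' x)) -> continuous F' -> (forall x, 0 < F' x) ->
  {homo F : x y / x < y} -> (forall x y z, F x <= y <= F z -> D y) ->
  (forall y, D y -> \forall n \near \oo, F (- n.+1%:R) <= y <= F n.+1%:R) ->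
  (forall y, D y -> {for y, continuous G}) ->
  (\int[mu]_(y in D) (G y)%:E = \int[mu]_v (G (F v) * F' v)%:E)%E.
Proof.
move=> oD dF cF' F'0 incF FD DF cG.
apply: integral_signed_ext => // [v|{cG}H cH H0]; first exact: ltW.
have cF := derivative_continuous dF.
have F'E : F^`()%classic = F' by apply/funext => x; rewrite derive1E; have [_ ->] := dF x.
have h1 := @ge0_integral_exhaustion D H (fun n => F (- n.+1%:R)) (fun n => F n.+1%:R).
have h2 := @ge0_integral_exhaustion setT (fun v => H (F v) * F' v) (fun n => - n.+1%:R) (fun n => n.+1%:R).
have DFx x : D (F x) by apply: (FD x _ x); rewrite lexx.
have lF : {homo F : x y / x <= y} by exact: ltW_homo.
apply: (cvg_unique _ (h1 _ _ _ _ _ _)) => //; rewrite ?/hausdorff_space //=.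
- by move=> n y /=; rewrite in_itv /=; exact: FD.
- by move=> n; apply: lF; rewrite lerN2 ler_nat.
- by move=> n; apply: lF; rewrite ler_nat.
- by apply: open_continuous_measurable_fun => // y; rewrite inE => /cH.
rewrite (_ : (fun n => _) = (fun n => \int[mu]_(x in `[(- n.+1%:R)%R, n.+1%:R%R]) (H (F x) * F' x)%:E)%E).
  apply: h2 => //.
  - by move=> n; rewrite lerN2 ler_nat.
  - by move=> n; rewrite ler_nat.
  - by move=> x _; exact: near_natr_segment.
  - apply: continuous_rmeas => x; apply: continuousM; last exact: cF'.
    by apply: continuous_comp; [exact: cF|exact: cH].
  - by move=> x _; rewrite mulr_ge0 // ltW.
apply/funext => n; rewrite integration_by_substitution_increasing ?F'E //.
- by have := ler0n R n.+1; lra.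
- by move=> x y _ _; exact: incF.
- by apply/cvg_ex; eexists; apply: cvg_at_right_filter; exact: cF'.
- by apply/cvg_ex; eexists; apply: cvg_at_left_filter; exact: cF'.
- split.
  + by move=> x _; have [] := dF x.
  + by apply: cvg_at_right_filter; exact: cF.
  + by apply: cvg_at_left_filter; exact: cF.
- apply: continuous_in_subspaceT => y; rewrite inE /= in_itv /= => yF.
  by apply: cH; exact: FD yF.
Qed.

Definition ccont (D : set R) (f : R -> R[i]) := forall y, D y ->
  {for y, continuous (fun u => complex.Re (f u))} /\
  {for y, continuous (fun u => complex.Im (f u))}.

Lemma cintegral_subst_increasing D (F F' : R -> R) (f : R -> R[i]) : open D ->
  (forall x : R, is_derive x 1 F (F' x)) -> continuous F' -> (forall x, 0 < F' x) ->
  {homo F : x y / x < y} -> (forall x y z, F x <= y <= F z -> D y) ->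
  (forall y, D y -> \forall n \near \oo, F (- n.+1%:R) <= y <= F n.+1%:R) ->
  ccont D f ->
  cintegral D f = cintegral setT (fun v => f (F v) * (F' v)%:C).
Proof.
move=> oD dF cF' F'0 incF FD DF cf; apply: eqc => /=; rewrite /Rintegral; congr fine.
  rewrite (integral_subst_increasing oD dF cF' F'0) //; last by move=> y /cf[].
  by apply: eq_integral => v _; rewrite ReM /= mulr0 subr0.
rewrite (integral_subst_increasing oD dF cF' F'0) //; last by move=> y /cf[].
by apply: eq_integral => v _; rewrite ImM /= mulr0 add0r.
Qed.

Lemma cintegral_subst_affine (a b : R) (f : R -> R[i]) : 0 < a -> ccont setT f ->
  cintegral setT f = cintegral setT (fun v => f (b + a * v) * a%:C).
Proof.
move=> a0 cf; apply: (@cintegral_subst_increasing setT (fun v => b + a * v) (fun=> a)) => //.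
- exact: openT.
- move=> x; apply: is_derive_eq; rewrite /GRing.scale /=; ring.
- by move=> x; exact: cst_continuous.
- by move=> x y xy; rewrite ltrD2l ltr_pM2l.
- move=> y _; have := near_natr_segment ((y - b) / a); apply: filterS => n.
  by rewrite ler_pdivlMr // ler_pdivrMr // => /andP[h1 h2]; apply/andP; split; lra.
Qed.

Lemma cintegral_subst_expR (f : R -> R[i]) : ccont `]0, +oo[ f ->
  cintegral `]0, +oo[ f = cintegral setT (fun v => f (expR v) * (expR v)%:C).
Proof.
move=> cf; apply: (@cintegral_subst_increasing _ expR expR) => //.
- by move=> x; exact: continuous_expR.
- by move=> x; exact: expR_gt0.
- by move=> x y; rewrite ltr_expR.
- by move=> x y z /andP[h _]; rewrite /= in_itv /= andbT (lt_le_trans _ h) // expR_gt0.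
- move=> y; rewrite /= in_itv /= andbT => y0; have := near_natr_segment (ln y).
  apply: filterS => n /andP[h1 h2].
  have yE : y = expR (ln y) by rewrite lnK ?posrE.
  by rewrite yE !ler_expR h1.
Qed.

Lemma Rintegral_reflection (G : R -> R) : continuous G ->
  (\int[mu]_y (G y)%:E = \int[mu]_v (G (- v))%:E)%E.
Proof.
move=> cG; transitivity (\int[mu]_v (G (- v) * 1)%:E)%E; last first.
  by apply: eq_integral => v _; rewrite mulr1.
apply: (@integral_signed_ext setT setT -%R (fun=> 1)) => // [y _|H cH H0]; first exact: cG.
have cH' : continuous H by move=> y; exact: cH.
have h (K : R -> R) : continuous K -> (forall y, 0 <= K y) ->
    (\int[mu]_(x in `[(- n.+1%:R)%R, n.+1%:R%R]) (K x)%:E)%E @[n --> \oo] --> (\int[mu]_x (K x)%:E)%E.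
  move=> cK K0; apply: ge0_integral_exhaustion => //.
  - by move=> n; rewrite lerN2 ler_nat.
  - by move=> n; rewrite ler_nat.
  - by move=> x _; exact: near_natr_segment.
  - exact: continuous_rmeas.
apply: (cvg_unique _ (h H cH' H0)); first exact: ereal_hausdorff.
rewrite (_ : (fun n => _) = (fun n => \int[mu]_(x in `[(- n.+1%:R)%R, n.+1%:R%R]) (H (- x) * 1)%:E)%E).
  apply: h => [x|x]; rewrite ?mulr1 //.
  under eq_fun do rewrite mulr1.
  by apply: continuous_comp; [exact: opp_continuous|exact: cH'].
apply/funext => n.
have := @integration_by_substitution_oppr R H (- n.+1%:R) n.+1%:R.
rewrite opprK => ->.
- by apply: eq_integral => x _; rewrite mulr1.
- by have := ler0n R n.+1; lra.
- exact: continuous_subspaceT.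
Qed.

End substitution.

(** * Uniform complex differentiability *)

(* [f'] is the complex derivative of [f] on [D], with the single constant [K]
   bounding [f], [f'], the Lipschitz quotient and the first order Taylor
   remainder; the latter makes [f'] Lipschitz too. *)
Definition holK (R : realType) (D : set R[i]) (K : R) (f f' : R[i] -> R[i]) :=
  [/\ 0 <= K,
      forall t, D t -> nc (f t) <= K,
      forall t, D t -> nc (f' t) <= K,
      forall t w, D t -> D w -> nc (f w - f t) <= K * nc (w - t) &
      forall t w, D t -> D w -> nc (f w - f t - f' t * (w - t)) <= K * nc (w - t) ^+ 2].

Definition hol (R : realType) (D : set R[i]) (f : R[i] -> R[i]) :=
  exists K f', holK D K f f'.

Section holomorphy.
Context {R : realType}.
Implicit Types (D : set R[i]) (K L : R) (f g : R[i] -> R[i]).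

Lemma holK_le D K L f f' : K <= L -> holK D K f f' -> holK D L f f'.
Proof.
move=> KL [K0 h1 h2 h3 h4]; split.
- exact: le_trans KL.
- by move=> t /h1 /le_trans; exact.
- by move=> t /h2 /le_trans; exact.
- by move=> t w Dt Dw; rewrite (le_trans (h3 _ _ Dt Dw)) // ler_wpM2r ?nc_ge0.
- by move=> t w Dt Dw; rewrite (le_trans (h4 _ _ Dt Dw)) // ler_wpM2r ?sqr_ge0.
Qed.

Lemma holK_sub D E K f f' : D `<=` E -> holK E K f f' -> holK D K f f'.
Proof.
move=> DE [K0 h1 h2 h3 h4]; split => //.
- by move=> t /DE /h1.
- by move=> t /DE /h2.
- by move=> t w /DE Dt /DE Dw; exact: h3.
- by move=> t w /DE Dt /DE Dw; exact: h4.
Qed.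

Lemma holK_eq D K f g f' g' : {in D, f =1 g} -> {in D, f' =1 g'} ->
  holK D K f f' -> holK D K g g'.
Proof.
move=> fg fg' [K0 h1 h2 h3 h4]; split => //.
- by move=> t Dt; rewrite -fg ?inE //; exact: h1.
- by move=> t Dt; rewrite -fg' ?inE //; exact: h2.
- by move=> t w Dt Dw; rewrite -!fg ?inE //; exact: h3.
- by move=> t w Dt Dw; rewrite -!fg -?fg' ?inE //; exact: h4.
Qed.

Lemma holK_cst D (z : R[i]) : holK D (nc z) (fun=> z) (fun=> 0).
Proof.
split=> [|//|t Dt|t w Dt Dw|t w Dt Dw].
- exact: nc_ge0.
- by rewrite nc0 nc_ge0.
- by rewrite subrr nc0 mulr_ge0 ?nc_ge0.
- by rewrite subrr mul0r subr0 nc0 mulr_ge0 ?sqr_ge0 ?nc_ge0.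
Qed.

Lemma holK_id D K : 1 <= K -> (forall t, D t -> nc t <= K) -> holK D K id (fun=> 1).
Proof.
move=> K1 hK; split => //.
- exact: le_trans K1.
- by move=> t _; rewrite nc1.
- by move=> t w _ _; rewrite ler_peMl ?nc_ge0.
- move=> t w _ _; rewrite mul1r subrr nc0 mulr_ge0 ?sqr_ge0 //; exact: le_trans K1.
Qed.

Lemma holKD D K L f g f' g' : holK D K f f' -> holK D L g g' ->
  holK D (K + L) (fun t => f t + g t) (fun t => f' t + g' t).
Proof.
move=> [K0 f1 f2 f3 f4] [L0 g1 g2 g3 g4]; split.
- exact: addr_ge0.
- by move=> t Dt; rewrite (le_trans (ncD _ _)) // lerD ?f1 ?g1.
- by move=> t Dt; rewrite (le_trans (ncD _ _)) // lerD ?f2 ?g2.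
- move=> t w Dt Dw; have -> : f w + g w - (f t + g t) = (f w - f t) + (g w - g t) by ring.
  by rewrite (le_trans (ncD _ _)) // mulrDl lerD ?f3 ?g3.
- move=> t w Dt Dw.
  have -> : f w + g w - (f t + g t) - (f' t + g' t) * (w - t) =
    (f w - f t - f' t * (w - t)) + (g w - g t - g' t * (w - t)) by ring.
  by rewrite (le_trans (ncD _ _)) // mulrDl lerD ?f4 ?g4.
Qed.

(** The 3 counts the terms in the Taylor remainder of a product: the remainder of each factor, and a
    product of two increments. *)
Lemma holKM D K L f g f' g' : holK D K f f' -> holK D L g g' ->
  holK D (3 * (K * L)) (fun t => f t * g t) (fun t => f' t * g t + f t * g' t).
Proof.
move=> [K0 f1 f2 f3 f4] [L0 g1 g2 g3 g4].
have KL := mulr_ge0 K0 L0.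
split.
- by rewrite mulr_ge0.
- move=> t Dt; rewrite Normc.normcM.
  have : nc (f t) * nc (g t) <= K * L by rewrite ler_pM ?nc_ge0 ?f1 ?g1.
  lra.
- move=> t Dt; rewrite (le_trans (ncD _ _)) // !Normc.normcM.
  have h1 : nc (f' t) * nc (g t) <= K * L by rewrite ler_pM ?nc_ge0 ?f2 ?g1.
  have h2 : nc (f t) * nc (g' t) <= K * L by rewrite ler_pM ?nc_ge0 ?f1 ?g2.
  lra.
- move=> t w Dt Dw.
  have -> : f w * g w - f t * g t = (f w - f t) * g w + f t * (g w - g t) by ring.
  rewrite (le_trans (ncD _ _)) // !Normc.normcM.
  have h1 : nc (f w - f t) * nc (g w) <= (K * nc (w - t)) * L.
    by rewrite ler_pM ?nc_ge0 ?f3 ?g1.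
  have h2 : nc (f t) * nc (g w - g t) <= K * (L * nc (w - t)).
    by rewrite ler_pM ?nc_ge0 ?f1 ?g3.
  have := mulr_ge0 KL (nc_ge0 (w - t)); lra.
- move=> t w Dt Dw.
  have -> : f w * g w - f t * g t - (f' t * g t + f t * g' t) * (w - t) =
    (f w - f t - f' t * (w - t)) * g w + f t * (g w - g t - g' t * (w - t))
    + f' t * (w - t) * (g w - g t) by ring.
  rewrite (le_trans (ncD _ _)) //.
  have h0 := ncD ((f w - f t - f' t * (w - t)) * g w) (f t * (g w - g t - g' t * (w - t))).
  rewrite !Normc.normcM in h0 *.
  have h1 : nc (f w - f t - f' t * (w - t)) * nc (g w) <= (K * nc (w - t) ^+ 2) * L.
    by rewrite ler_pM ?nc_ge0 ?f4 ?g1.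
  have h2 : nc (f t) * nc (g w - g t - g' t * (w - t)) <= K * (L * nc (w - t) ^+ 2).
    by rewrite ler_pM ?nc_ge0 ?f1 ?g4.
  have h3 : nc (f' t) * nc (w - t) * nc (g w - g t) <= K * nc (w - t) * (L * nc (w - t)).
    by rewrite ler_pM ?mulr_ge0 ?nc_ge0 ?g3 // ler_wpM2r ?nc_ge0 ?f2.
  lra.
Qed.

Lemma holK_inv D K e f f' : 1 <= K -> 0 < e -> (forall t, D t -> e <= nc (f t)) ->
  holK D K f f' ->
  holK D (K / e + K / e ^+ 2 + e^-1 + K ^+ 2 / e ^+ 3 + K / e ^+ 2)
    (fun t => (f t)^-1) (fun t => - f' t / f t ^+ 2).
Proof.
move=> K1 e0 fe [K0 f1 f2 f3 f4].
have f0 t : D t -> f t != 0.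
  by move=> /fe ef; rewrite -nc_gt0 (lt_le_trans e0).
have Vle t : D t -> (nc (f t))^-1 <= e^-1.
  by move=> Dt; rewrite lef_pV2 ?posrE ?fe // nc_gt0 f0.
have V0 t : 0 <= (nc (f t))^-1 by rewrite invr_ge0 nc_ge0.
have e1 : 0 <= e^-1 by rewrite invr_ge0 ltW.
have a1 : 0 <= K / e by rewrite mulr_ge0.
have a2 : 0 <= K / e ^+ 2 by rewrite mulr_ge0 // invr_ge0 sqr_ge0.
have a3 : 0 <= K ^+ 2 / e ^+ 3 by rewrite mulr_ge0 ?sqr_ge0 // invr_ge0 exprn_ge0 // ltW.
have lip t w : D t -> D w -> nc ((f w)^-1 - (f t)^-1) <= K / e ^+ 2 * nc (w - t).
  move=> Dt Dw.
  have -> : (f w)^-1 - (f t)^-1 = - (f w - f t) * (f w)^-1 * (f t)^-1.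
    by field; rewrite !f0.
  rewrite !Normc.normcM ncN !Normc.normcV.
  have -> : K / e ^+ 2 * nc (w - t) = (K * nc (w - t)) * e^-1 * e^-1 by field; rewrite gt_eqF.
  rewrite ler_pM ?mulr_ge0 ?nc_ge0 ?Vle //.
  by rewrite ler_pM ?nc_ge0 ?Vle ?f3.
split.
- by rewrite !addr_ge0.
- move=> t Dt; rewrite Normc.normcV.
  by have := Vle t Dt; lra.
- move=> t Dt; rewrite Normc.normcM ncN Normc.normcV ncX.
  have : nc (f' t) / nc (f t) ^+ 2 <= K / e ^+ 2.
    rewrite ler_pM ?nc_ge0 ?f2 ?invr_ge0 ?sqr_ge0 //.
    by rewrite -!exprVn lerXn2r ?nnegrE ?Vle.
  lra.
- move=> t w Dt Dw; rewrite (le_trans (lip _ _ Dt Dw)) // ler_wpM2r ?nc_ge0 //; lra.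
- move=> t w Dt Dw.
  have -> : (f w)^-1 - (f t)^-1 - - f' t / f t ^+ 2 * (w - t) =
    - (f w - f t - f' t * (w - t)) * (f t)^-1 * (f t)^-1
    + (f w - f t) * (- ((f w)^-1 - (f t)^-1)) * (f t)^-1.
    by field; rewrite !f0.
  rewrite (le_trans (ncD _ _)) // !Normc.normcM !ncN !Normc.normcV.
  have h1 : nc (f w - f t - f' t * (w - t)) / nc (f t) / nc (f t) <=
      (K * nc (w - t) ^+ 2) * e^-1 * e^-1.
    by rewrite !ler_pM ?mulr_ge0 ?nc_ge0 ?Vle ?f4.
  have h2 : nc (f w - f t) * nc ((f w)^-1 - (f t)^-1) / nc (f t) <=
      (K * nc (w - t)) * (K / e ^+ 2 * nc (w - t)) * e^-1.
    by rewrite !ler_pM ?mulr_ge0 ?nc_ge0 ?Vle ?f3 ?lip.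
  have := mulr_ge0 a1 (sqr_ge0 (nc (w - t))).
  have := mulr_ge0 a2 (sqr_ge0 (nc (w - t))).
  have := mulr_ge0 e1 (sqr_ge0 (nc (w - t))).
  have e3 : (K * nc (w - t)) * (K / e ^+ 2 * nc (w - t)) * e^-1 =
    K ^+ 2 / e ^+ 3 * nc (w - t) ^+ 2 by field; rewrite gt_eqF.
  have e4 : (K * nc (w - t) ^+ 2) * e^-1 * e^-1 = K / e ^+ 2 * nc (w - t) ^+ 2.
    by field; rewrite gt_eqF.
  rewrite e3 in h2; rewrite e4 in h1; lra.
Qed.

(** Adding the Taylor expansion at t, evaluated at w, to the one at w, evaluated at t, cancels the
    values of f. *)
Lemma holK_deriv_lip D K f f' t w : holK D K f f' -> D t -> D w ->
  nc (f' w - f' t) <= 2 * K * nc (w - t).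
Proof.
move=> [K0 f1 f2 f3 f4] Dt Dw.
have [->|wt] := eqVneq w t.
  by rewrite !subrr nc0 mulr0.
have n0 : 0 < nc (w - t) by rewrite nc_gt0 subr_eq0.
rewrite -(ler_pM2r n0) -Normc.normcM.
have -> : (f' w - f' t) * (w - t) =
  (f w - f t - f' t * (w - t)) + (f t - f w - f' w * (t - w)) by ring.
rewrite (le_trans (ncD _ _)) //.
have h1 := f4 _ _ Dt Dw; have h2 := f4 _ _ Dw Dt.
rewrite (ncBC t w) in h2; lra.
Qed.

Lemma hol_sub D E f : D `<=` E -> hol E f -> hol D f.
Proof. by move=> DE [K [f' h]]; exists K, f'; exact: holK_sub DE h. Qed.

Lemma hol_eq D f g : (forall t, D t -> f t = g t) -> hol D f -> hol D g.
Proof.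
move=> fg [K [f' h]]; exists K, f'; apply: holK_eq h => // t.
by rewrite inE => /fg.
Qed.

Lemma hol_cst D z : hol D (fun=> z).
Proof. by exists (nc z), (fun=> 0); exact: holK_cst. Qed.

Lemma hol_id D K : (forall t, D t -> nc t <= K) -> hol D id.
Proof.
move=> h; exists (Num.max 1 K), (fun=> 1); apply: holK_id => [|t /h hK].
  by rewrite le_max lexx.
by rewrite le_max hK orbT.
Qed.

Lemma holD D f g : hol D f -> hol D g -> hol D (fun t => f t + g t).
Proof. by move=> [K [f' hf]] [L [g' hg]]; do 2 eexists; exact: holKD hf hg. Qed.

Lemma holM D f g : hol D f -> hol D g -> hol D (fun t => f t * g t).
Proof. by move=> [K [f' hf]] [L [g' hg]]; do 2 eexists; exact: holKM hf hg. Qed.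

Lemma hol_inv D e f : 0 < e -> (forall t, D t -> e <= nc (f t)) -> hol D f ->
  hol D (fun t => (f t)^-1).
Proof.
move=> e0 fe [K [f' hf]]; do 2 eexists.
apply: (@holK_inv D (Num.max 1 K) e f f') => //.
  by rewrite le_max lexx.
by apply: holK_le hf; rewrite le_max lexx orbT.
Qed.

Lemma hol_sum D (I : Type) (r : seq I) (F : I -> R[i] -> R[i]) :
  (forall i, hol D (F i)) -> hol D (fun t => \sum_(i <- r) F i t).
Proof.
move=> h; elim: r => [|i r IH].
  by under eq_fun do rewrite big_nil; exact: hol_cst.
by under eq_fun do rewrite big_cons; exact: holD.
Qed.

Lemma hol_prod D (I : Type) (r : seq I) (F : I -> R[i] -> R[i]) :
  (forall i, hol D (F i)) -> hol D (fun t => \prod_(i <- r) F i t).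
Proof.
move=> h; elim: r => [|i r IH].
  by under eq_fun do rewrite big_nil; exact: hol_cst.
by under eq_fun do rewrite big_cons; exact: holM.
Qed.

Lemma holK_shift D E K f f' (a : R[i]) : (forall t, D t -> E (t + a)) ->
  holK E K f f' -> holK D K (fun t => f (t + a)) (fun t => f' (t + a)).
Proof.
move=> DE [K0 h1 h2 h3 h4]; split => //.
- by move=> t /DE /h1.
- by move=> t /DE /h2.
- move=> t w /DE Dt /DE Dw; have := h3 _ _ Dt Dw.
  by rewrite (_ : w + a - (t + a) = w - t) //; ring.
- move=> t w /DE Dt /DE Dw; have := h4 _ _ Dt Dw.
  by rewrite (_ : w + a - (t + a) = w - t) //; ring.
Qed.

Lemma hol_shift D E f (a : R[i]) : (forall t, D t -> E (t + a)) ->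
  hol E f -> hol D (fun t => f (t + a)).
Proof. by move=> DE [K [f' h]]; exists K, (fun t => f' (t + a)); exact: holK_shift h. Qed.

Lemma ccvg_cst (z : R[i]) : ccvg (fun=> z) z.
Proof. by split; exact: cvg_cst. Qed.

Lemma ccvgD (u v : nat -> R[i]) a b : ccvg u a -> ccvg v b ->
  ccvg (fun n => u n + v n) (a + b).
Proof.
move=> [u1 u2] [v1 v2]; split.
  by rewrite ReD; under eq_fun do rewrite ReD; exact: cvgD.
by rewrite ImD; under eq_fun do rewrite ImD; exact: cvgD.
Qed.

Lemma ccvgM (u v : nat -> R[i]) a b : ccvg u a -> ccvg v b ->
  ccvg (fun n => u n * v n) (a * b).
Proof.
move=> [u1 u2] [v1 v2]; split.
  by rewrite ReM; under eq_fun do rewrite ReM; apply: cvgB; exact: cvgM.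
by rewrite ImM; under eq_fun do rewrite ImM; apply: cvgD; exact: cvgM.
Qed.

Lemma ccvgB (u v : nat -> R[i]) a b : ccvg u a -> ccvg v b ->
  ccvg (fun n => u n - v n) (a - b).
Proof.
move=> hu hv; rewrite -mulN1r; under eq_fun do rewrite -[- v _]mulN1r.
by apply: ccvgD => //; apply: ccvgM => //; exact: ccvg_cst.
Qed.

Lemma ccvg_ext (u v : nat -> R[i]) z : (forall n, u n = v n) -> ccvg u z -> ccvg v z.
Proof. by move=> uv; rewrite (_ : u = v) //; apply/funext. Qed.

Lemma ccvg_nc_le (u : nat -> R[i]) z (C : R) : ccvg u z ->
  (forall n, nc (u n) <= C) -> nc z <= C.
Proof.
move=> [u1 u2] uC.
have h : nc (u n) @[n --> \oo] --> nc z.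
  rewrite ncE; under eq_fun do rewrite ncE.
  apply: (@cvg_comp _ _ _ (fun n => complex.Re (u n) ^+ 2 + complex.Im (u n) ^+ 2)); last first.
    exact: sqrt_continuous.
  by apply: cvgD; rewrite expr2; under eq_fun do rewrite expr2; exact: cvgM.
by apply: (ler_cvg_to h (cvg_cst C)); near=> n; exact: uC.
Unshelve. all: by end_near. Qed.

(** Each clause of [holK] bounds an expression linear in (f, f') by the constant times a number c
    independent of f, so the clauses add up term by term and pass to the limit. *)
Lemma holK_series D (F F' : nat -> R[i] -> R[i]) (K : nat -> R) (S : R) (f f' : R[i] -> R[i]) :
  (forall j, holK D (K j) (F j) (F' j)) ->
  (forall n, \sum_(j < n) K j <= S) ->
  (forall t, D t -> ccvg (fun n => \sum_(j < n) F j t) (f t)) ->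
  (forall t, D t -> ccvg (fun n => \sum_(j < n) F' j t) (f' t)) ->
  holK D S f f'.
Proof.
move=> hF KS cf cf'.
have le (G : nat -> R[i]) (c : R) z : 0 <= c -> (forall j, nc (G j) <= K j * c) ->
    ccvg (fun n => \sum_(j < n) G j) z -> nc z <= S * c.
  move=> c0 GK cz; apply: (ccvg_nc_le cz) => n.
  rewrite (le_trans (nc_sum _ _ _)) // (@le_trans _ _ (\sum_(j < n) (K j * c))) //.
    by apply: ler_sum.
  by rewrite -mulr_suml ler_wpM2r.
split.
- by have := KS 0%N; rewrite big_ord0.
- move=> t Dt; rewrite -[S]mulr1; apply: (le (F ^~ t) _ _ ler01 _ (cf t Dt)) => j.
  by rewrite mulr1; have [_ h _ _ _] := hF j; exact: h.
- move=> t Dt; rewrite -[S]mulr1; apply: (le (F' ^~ t) _ _ ler01 _ (cf' t Dt)) => j.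
  by rewrite mulr1; have [_ _ h _ _] := hF j; exact: h.
- move=> t w Dt Dw; apply: (le (fun j => F j w - F j t)); first exact: nc_ge0.
    by move=> j; have [_ _ _ h _] := hF j; exact: h.
  by apply: ccvg_ext (ccvgB (cf w Dw) (cf t Dt)) => n; rewrite -sumrB.
- move=> t w Dt Dw.
  apply: (le (fun j => F j w - F j t - F' j t * (w - t))); first exact: sqr_ge0.
    by move=> j; have [_ _ _ _ h] := hF j; exact: h.
  apply: ccvg_ext (ccvgB (ccvgB (cf w Dw) (cf t Dt)) (ccvgM (cf' t Dt) (ccvg_cst (w - t)))) => n.
  by rewrite mulr_suml -!sumrB.
Qed.

(** The linearity of the clauses used for series also allows integration over a parameter;
    differentiation under the integral sign comes with it. The 2 is that of [nc_cintegral_le]. *)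
Lemma holK_integral D (G G' : R -> R[i] -> R[i]) (K : R -> R) :
  (forall u, holK D (K u) (G u) (G' u)) -> rint setT K ->
  (forall t, D t -> cmeas setT (G ^~ t)) -> (forall t, D t -> cmeas setT (G' ^~ t)) ->
  holK D (2 * \int[@lebesgue_measure R]_u K u)
    (fun t => cintegral setT (G ^~ t)) (fun t => cintegral setT (G' ^~ t)).
Proof.
move=> hG iK mG mG'.
have le (H : R -> R[i]) (c : R) : 0 <= c -> cmeas setT H -> (forall u, nc (H u) <= K u * c) ->
    nc (cintegral setT H) <= 2 * (\int[@lebesgue_measure R]_u K u) * c.
  move=> c0 mH HK; have icK : rint setT (fun u => K u * c).
    by apply: rint_eq (rintZ c _ iK) => // u _; rewrite mulrC.
  rewrite (le_trans (nc_cintegral_le _ mH icK _)) //.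
  by rewrite RintegralZr // mulrA.
have iG t : D t -> cint setT (G ^~ t).
  by move=> Dt; apply: cint_dom (mG t Dt) iK _ => // u _; have [_ h _ _ _] := hG u; exact: h.
have iG' t : D t -> cint setT (G' ^~ t).
  by move=> Dt; apply: cint_dom (mG' t Dt) iK _ => // u _; have [_ _ h _ _] := hG u; exact: h.
split.
- by rewrite mulr_ge0 // Rintegral_ge0 // => u _; have [] := hG u.
- move=> t Dt; rewrite -[leRHS]mulr1; apply: le => // [|u]; first exact: mG.
  by rewrite mulr1; have [_ h _ _ _] := hG u; exact: h.
- move=> t Dt; rewrite -[leRHS]mulr1; apply: le => // [|u]; first exact: mG'.
  by rewrite mulr1; have [_ _ h _ _] := hG u; exact: h.
- move=> t w Dt Dw; rewrite -cintegralB //; try exact: iG.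
  apply: le; [exact: nc_ge0|by apply: cmeasB; exact: mG|move=> u].
  by have [_ _ _ h _] := hG u; exact: h.
- move=> t w Dt Dw; rewrite -cintegralB //; try exact: iG.
  rewrite -cintegralZr //; last exact: iG'.
  have i1 : cint setT (fun u => G u w - G u t) by apply: cintB => //; exact: iG.
  have i2 : cint setT (fun u => G' u t * (w - t)).
    by apply: cint_eq (cintZ (w - t) _ (iG' t Dt)) => // u _; rewrite mulrC.
  rewrite -cintegralB //.
  apply: le; [exact: sqr_ge0|by apply/cint_meas/cintB|move=> u].
  by have [_ _ _ _ h] := hG u; exact: h.
Qed.

End holomorphy.

(** * Gamma on the right half-plane *)

Section complex_continuity.
Context {R : realType}.
Implicit Types (D : set R) (f g : R -> R[i]).

Lemma for_continuous_ext (h k : R -> R) (y : R) : (forall u, h u = k u) ->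
  {for y, continuous h} -> {for y, continuous k}.
Proof. by move=> hk; rewrite (_ : k = h) //; apply/funext => u; rewrite hk. Qed.

Lemma ccont_cst D z : ccont D (fun=> z).
Proof. by move=> y _; split; exact: cst_continuous. Qed.

Lemma ccontD D f g : ccont D f -> ccont D g -> ccont D (fun u => f u + g u).
Proof.
move=> cf cg y Dy; have [f1 f2] := cf y Dy; have [g1 g2] := cg y Dy; split.
  by apply: (for_continuous_ext _ (continuousD f1 g1)) => u; rewrite ReD.
by apply: (for_continuous_ext _ (continuousD f2 g2)) => u; rewrite ImD.
Qed.

Lemma ccontM D f g : ccont D f -> ccont D g -> ccont D (fun u => f u * g u).
Proof.
move=> cf cg y Dy; have [f1 f2] := cf y Dy; have [g1 g2] := cg y Dy; split.
  apply: (for_continuous_ext _ (continuousB (continuousM f1 g1) (continuousM f2 g2))) => u.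
  by rewrite ReM.
apply: (for_continuous_ext _ (continuousD (continuousM f1 g2) (continuousM f2 g1))) => u.
by rewrite ImM.
Qed.

Lemma ccontB D f g : ccont D f -> ccont D g -> ccont D (fun u => f u - g u).
Proof.
move=> cf cg; under eq_fun do rewrite -[- g _]mulN1r.
exact: (@ccontD D f (fun u => -1 * g u) cf (@ccontM D (fun=> -1) g (@ccont_cst D (-1)) cg)).
Qed.

Lemma ccont_real D (h : R -> R) : (forall y, D y -> {for y, continuous h}) ->
  ccont D (fun u => (h u)%:C).
Proof. by move=> ch y Dy; split; [exact: ch|exact: cst_continuous]. Qed.

Lemma ccont_cexp D f : ccont D f -> ccont D (fun u => cexp (f u)).
Proof.
move=> cf y Dy; have [f1 f2] := cf y Dy.
have ce : {for y, continuous (fun u => expR (complex.Re (f u)))}.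
  by apply: continuous_comp => //; exact: continuous_expR.
have cc : {for y, continuous (fun u => cos (complex.Im (f u)))}.
  by apply: continuous_comp => //; exact: continuous_cos.
have cs : {for y, continuous (fun u => sin (complex.Im (f u)))}.
  by apply: continuous_comp => //; exact: continuous_sin.
split.
  by apply: (for_continuous_ext _ (continuousM ce cc)) => u; rewrite Re_cexp.
by apply: (for_continuous_ext _ (continuousM ce cs)) => u; rewrite Im_cexp.
Qed.

Lemma ccont_cmeas D f : ccont setT f -> cmeas D f.
Proof.
move=> cf; split; apply: continuous_rmeas => y.
  by have [] := cf y I.
by have [] := cf y I.
Qed.

Definition is_cderive (F f : R -> R[i]) := forall x : R,
  is_derive x 1 (fun u => complex.Re (F u)) (complex.Re (f x)) /\
  is_derive x 1 (fun u => complex.Im (F u)) (complex.Im (f x)).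

Lemma is_cderive_cexp (phi phi' : R -> R[i]) : is_cderive phi phi' ->
  is_cderive (fun u => cexp (phi u)) (fun u => phi' u * cexp (phi u)).
Proof.
move=> h x; have [h1 h2] := h x; split.
  under eq_fun do rewrite Re_cexp.
  apply: is_derive_eq; rewrite ReM Re_cexp Im_cexp /GRing.scale /=; ring.
under eq_fun do rewrite Im_cexp.
apply: is_derive_eq; rewrite ImM Re_cexp Im_cexp /GRing.scale /=; ring.
Qed.

Lemma is_cderiveZ (z : R[i]) (F f : R -> R[i]) : is_cderive F f ->
  is_cderive (fun u => z * F u) (fun u => z * f u).
Proof.
move=> h x; have [h1 h2] := h x; split.
  under eq_fun do rewrite ReM.
  apply: is_derive_eq; rewrite ReM /GRing.scale /=; ring.
under eq_fun do rewrite ImM.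
apply: is_derive_eq; rewrite ImM /GRing.scale /=; ring.
Qed.

Lemma cintegral_FTC_T (f F : R -> R[i]) (A B : R[i]) :
  ccont setT f -> is_cderive F f -> cint setT f ->
  ccvg (fun n => F (- n.+1%:R)) A -> ccvg (fun n => F n.+1%:R) B ->
  cintegral setT f = B - A.
Proof.
move=> cf dF [f1 f2] [A1 A2] [B1 B2]; apply: eqc.
  rewrite ReD ReN.
  apply: (@Rintegral_FTC_T _ _ (fun u => complex.Re (F u))) => //.
    by move=> y; have [] := cf y I.
  by move=> x; have [] := dF x.
rewrite ImD ImN.
apply: (@Rintegral_FTC_T _ _ (fun u => complex.Im (F u))) => //.
  by move=> y; have [] := cf y I.
by move=> x; have [] := dF x.
Qed.

Lemma ccvg_nc (z_ : nat -> R[i]) z (e : nat -> R) : e @ \oo --> 0 ->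
  (forall n, nc (z_ n - z) <= e n) -> ccvg z_ z.
Proof.
move=> e0 ze.
have h (u : nat -> R) l : (forall n, `|u n - l| <= e n) -> u @ \oo --> l.
  move=> ue; apply/subr_cvg0; apply: norm_cvg0.
  apply: (@squeeze_cvgr _ _ _ _ (fun=> 0) e) => //; last exact: cvg_cst.
  by near=> n; rewrite normr_ge0 ue.
split; apply: h => n; rewrite (le_trans _ (ze n)) //.
  by rewrite -ReN -ReD normr_Re_le_nc.
by rewrite -ImN -ImD normr_Im_le_nc.
Unshelve. all: by end_near. Qed.

Lemma cvg_harmonic0 (C : R) : (C / n.+1%:R) @[n --> \oo] --> 0.
Proof.
rewrite -(mulr0 C); apply: cvgM; first exact: cvg_cst.
exact: cvg_harmonic.
Qed.

End complex_continuity.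

(** * Bounds for the Gamma integrand in the logarithmic variable *)

Section exponential_bounds.
Context {R : realType}.
Implicit Types (a b : R).

(** From (1 + x^2)^2 <= 2 + 2 x^4 and e^(b x) >= (b x)^4 / 4!, with 48 = 2 * 4!. *)
Lemma expRN_sqr_bound b (v : R) : 0 < b ->
  expR (- (b * `|v|)) * (1 + v ^+ 2) ^+ 2 <= 2 + 48 / b ^+ 4.
Proof.
move=> b0; have vE : v ^+ 2 = `|v| ^+ 2 by rewrite real_normK ?num_real.
rewrite vE; set x := `|v|; have x0 : 0 <= x by exact: normr_ge0.
have bx0 : 0 <= b * x by rewrite mulr_ge0 // ltW.
have h := expR_ge1Dxn 3 bx0.
have b4 : 0 < b ^+ 4 by rewrite exprn_gt0.
rewrite expRN mulrC ler_pdivrMr ?expR_gt0 //.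
apply: (@le_trans _ _ (2 + 2 * x ^+ 4)).
  have := sqr_ge0 (1 - x ^+ 2); lra.
have e : (b * x) ^+ 4 / 4`!%:R = b ^+ 4 * x ^+ 4 / 24 by rewrite exprMn.
rewrite e in h.
have h1 : 0 <= b ^+ 4 * x ^+ 4 / 24 by rewrite divr_ge0 // mulr_ge0 ?exprn_ge0 // ltW.
have h2 : 2 * x ^+ 4 <= 48 / b ^+ 4 * expR (b * x).
  have -> : 2 * x ^+ 4 = 48 / b ^+ 4 * (b ^+ 4 * x ^+ 4 / 24) by field; rewrite gt_eqF.
  by rewrite ler_wpM2l ?divr_ge0 ?(ltW b4) //; lra.
by rewrite [leRHS]mulrDl lerD // -[leLHS]mulr1 ler_wpM2l //; lra.
Qed.

(** On the left the decay is that of e^(a v). On the right e^v >= 1 + v^2 / 2, and completing the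
    square in (a + 1) v - v^2 / 2 leaves decay at rate 1. *)
Lemma expR_gumbel_bound a (v : R) : 0 < a ->
  expR (a * v - expR v) <= expR ((a + 1) ^+ 2) * expR (- (Num.min a 1 * `|v|)).
Proof.
move=> a0; rewrite -expRD ler_expR.
have [v0|v0] := leP 0 v.
- rewrite (ger0_norm v0).
  have h := expR_ge1Dxn 1 v0.
  have e : v ^+ 2 / 2`!%:R = v ^+ 2 / 2 by [].
  rewrite e in h.
  have m1 : Num.min a 1 <= 1 by rewrite ge_min lexx orbT.
  have : Num.min a 1 * v <= v by rewrite -[leRHS]mul1r ler_wpM2r.
  have := sqr_ge0 (v - (a + 1)); have := sqr_ge0 (a + 1); lra.
- rewrite (ler0_norm (ltW v0)).
  have m1 : Num.min a 1 <= a by rewrite ge_min lexx.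
  have : a * v <= Num.min a 1 * v by rewrite ler_wnM2r // ltW.
  have := expR_gt0 v; have := sqr_ge0 (a + 1); lra.
Qed.

Lemma rint_expR_cauchy (h : R -> R) (C : R) : measurable_fun setT h ->
  (forall v : R, `|h v| <= C * (1 + v ^+ 2)^-1) -> rint setT h.
Proof.
by move=> mh hC; apply: (rint_dom _ mh (rintZ C _ rint_cauchy)).
Qed.

Lemma expR_gumbel_sqr_bound a : 0 < a -> exists2 C : R, 0 <= C &
  forall v : R, expR (a * v - expR v) * (1 + v ^+ 2) <= C * (1 + v ^+ 2)^-1.
Proof.
move=> a0; have m0 : 0 < Num.min a 1 by rewrite lt_min a0 ltr01.
exists (expR ((a + 1) ^+ 2) * (2 + 48 / (Num.min a 1) ^+ 4)).
  by rewrite mulr_ge0 ?expR_ge0 // addr_ge0 // divr_ge0 // exprn_ge0 // ltW.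
move=> v; have v0 : 0 < 1 + v ^+ 2 by rewrite ltr_wpDr // sqr_ge0.
rewrite ler_pdivlMr // -mulrA -expr2.
apply: (@le_trans _ _ (expR ((a + 1) ^+ 2) * expR (- (Num.min a 1 * `|v|)) * (1 + v ^+ 2) ^+ 2)).
  by rewrite ler_wpM2r ?sqr_ge0 // expR_gumbel_bound.
by rewrite -mulrA ler_wpM2l ?expR_ge0 // expRN_sqr_bound.
Qed.

Lemma continuous_gumbel a : continuous (fun v : R => expR (a * v - expR v)).
Proof.
move=> v; apply: continuous_comp; last exact: continuous_expR.
apply: continuousB; last exact: continuous_expR.
by apply: continuousM; [exact: cst_continuous|exact: id].
Qed.

(** The weight 1 + v^2 pays for the v^2 in the second order Taylor remainder of [gumbel] in its
    parameter, see [holK_gumbel]. *)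
Lemma rint_gumbel_sqr a : 0 < a ->
  rint setT (fun v : R => expR (a * v - expR v) * (1 + v ^+ 2)).
Proof.
move=> a0; have [C C0 hC] := expR_gumbel_sqr_bound a0.
apply: rint_expR_cauchy (C) _ _.
  apply: continuous_rmeas => v; apply: (@continuousM _ _ _ _ v); first exact: continuous_gumbel.
  by apply: continuousD; [exact: cst_continuous|exact: exprn_continuous].
by move=> v; rewrite ger0_norm // mulr_ge0 ?expR_ge0 // addr_ge0 // sqr_ge0.
Qed.

Lemma rint_gumbel a : 0 < a -> rint setT (fun v : R => expR (a * v - expR v)).
Proof.
move=> a0; apply: rint_dom (rint_gumbel_sqr a0) _ => //.
  by apply: continuous_rmeas; exact: continuous_gumbel.
move=> v _; rewrite ger0_norm ?expR_ge0 // ler_peMr ?expR_ge0 //.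
by rewrite lerDl sqr_ge0.
Qed.

Lemma gumbel_cvg0 a (s : R) : 0 < a -> (s = 1 \/ s = -1) ->
  expR (a * (s * n.+1%:R) - expR (s * n.+1%:R)) @[n --> \oo] --> (0 : R).
Proof.
move=> a0 hs; have [C C0 hC] := expR_gumbel_sqr_bound a0.
have s2 : s ^+ 2 = 1 by case: hs => ->; ring.
have h n : expR (a * (s * n.+1%:R) - expR (s * n.+1%:R)) <= C / n.+1%:R.
  have := hC (s * n.+1%:R); rewrite exprMn s2 mul1r.
  set E := expR _; have E0 : 0 < E by exact: expR_gt0.
  have n1 : 1 <= n.+1%:R :> R by rewrite ler1n.
  have e : (1 + n.+1%:R ^+ 2)^-1 <= (n.+1%:R : R)^-1.
    rewrite lef_pV2 ?posrE; nra.
  move=> hE; apply: (@le_trans _ _ (C * (1 + n.+1%:R ^+ 2)^-1)); last by rewrite ler_wpM2l.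
  by apply: le_trans hE; rewrite ler_peMr ?ltW //; nra.
apply: (@squeeze_cvgr _ _ _ _ (fun=> 0) (fun n => C / n.+1%:R)).
- by near=> n; rewrite expR_ge0 h.
- exact: cvg_cst.
- exact: cvg_harmonic0.
Unshelve. all: by end_near. Qed.

End exponential_bounds.

(** * The Gamma integral over the whole line *)

Section line_Gamma.
Context {R : realType}.
Implicit Types (s t : R[i]).

(* The Gamma integrand after the substitution [u = exp v]. *)
Definition gumbel s (v : R) : R[i] := cexp (s * v%:C - (expR v)%:C).

Definition line_Gamma s : R[i] := cintegral setT (gumbel s).

Lemma nc_gumbel s v : nc (gumbel s v) = expR (complex.Re s * v - expR v).
Proof. by rewrite /gumbel nc_cexp ReD ReN ReM /= mulr0 subr0. Qed.

Lemma ccont_gumbel s : ccont setT (gumbel s).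
Proof.
apply: ccont_cexp; apply: ccontB.
  apply: ccontM; first exact: ccont_cst.
  by apply: ccont_real => y _; exact: id.
by apply: ccont_real => y _; exact: continuous_expR.
Qed.

Lemma cmeas_gumbel s : cmeas setT (gumbel s).
Proof. exact: ccont_cmeas (ccont_gumbel s). Qed.

Lemma cint_gumbel s : 0 < complex.Re s -> cint setT (gumbel s).
Proof.
move=> s0; apply: cint_dom (cmeas_gumbel s) (rint_gumbel s0) _ => // v _.
by rewrite nc_gumbel.
Qed.

Lemma gumbelS s v : gumbel (s + 1) v = (expR v)%:C * gumbel s v.
Proof. by rewrite /gumbel -cexp_real -cexpD; congr cexp; ring. Qed.

Lemma Gamma_integralE s : Gamma_integral s = line_Gamma s.
Proof.
rewrite /Gamma_integral cintegral_subst_expR.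
  apply: eq_cintegral => v _.
  rewrite /cpow expRK -!cexp_real -!cexpD /gumbel; congr cexp.
  by rewrite rmorphN; ring.
apply: ccontM.
  apply: ccont_cexp; apply: ccontM; first exact: ccont_cst.
  apply: ccont_real => y; rewrite /= in_itv /= andbT => y0.
  exact: continuous_ln.
apply: ccont_real => y _; apply: continuous_comp; last exact: continuous_expR.
exact: opp_continuous.
Qed.

Lemma is_cderive_gumbel s :
  is_cderive (gumbel s) (fun v => (s - (expR v)%:C) * gumbel s v).
Proof.
apply: is_cderive_cexp => x; split.
  have -> : (fun u : R => complex.Re (s * u%:C - (expR u)%:C)) =
      (fun u : R => complex.Re s * u - expR u).
    by apply/funext => u; rewrite ReD ReN ReM /= mulr0 subr0.
  by apply: is_derive_eq; rewrite ReD ReN /GRing.scale /=; ring.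
have -> : (fun u : R => complex.Im (s * u%:C - (expR u)%:C)) =
    (fun u : R => complex.Im s * u).
  by apply/funext => u; rewrite ImD ImN ImM /= mulr0 add0r oppr0 addr0.
by apply: is_derive_eq; rewrite ImD ImN /GRing.scale /=; ring.
Qed.

Lemma gumbel_ccvg0 s (e : R) : 0 < complex.Re s -> (e = 1 \/ e = -1) ->
  ccvg (fun n => gumbel s (e * n.+1%:R)) 0.
Proof.
move=> s0 he; apply: ccvg_nc (gumbel_cvg0 s0 he) _ => n.
by rewrite subr0 nc_gumbel.
Qed.

(** The derivative of [gumbel s] is [s * gumbel s v - gumbel (s + 1) v], and its integral is 0
    because [gumbel s] vanishes at both ends of the line. *)
Lemma line_GammaS s : 0 < complex.Re s -> line_Gamma (s + 1) = s * line_Gamma s.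
Proof.
move=> s0.
have s1 : 0 < complex.Re (s + 1) by rewrite ReD ltr_wpDr.
have i0 := cint_gumbel s0; have i1 := cint_gumbel s1.
have dE v : (s - (expR v)%:C) * gumbel s v = s * gumbel s v - gumbel (s + 1) v.
  by rewrite gumbelS mulrBl.
have h : cintegral setT (fun v => (s - (expR v)%:C) * gumbel s v) = 0 - 0.
  apply: (cintegral_FTC_T _ (is_cderive_gumbel s)).
  - apply: ccontM; last exact: ccont_gumbel.
    apply: ccontB; first exact: ccont_cst.
    by apply: ccont_real => y _; exact: continuous_expR.
  - apply: (@cint_eq _ _ (fun v => s * gumbel s v - gumbel (s + 1) v)) => //.
    by apply: cintB => //; exact: cintZ.
  - have := gumbel_ccvg0 s0 (or_intror erefl); apply: ccvg_ext => n.
    by rewrite mulN1r.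
  - have := gumbel_ccvg0 s0 (or_introl erefl); apply: ccvg_ext => n.
    by rewrite mul1r.
move: h; rewrite subrr (eq_cintegral (g := fun v => s * gumbel s v - gumbel (s + 1) v)) //.
rewrite cintegralB //; last exact: cintZ.
by rewrite cintegralZ // => /eqP; rewrite subr_eq0 => /eqP.
Qed.

(** Here [- gumbel 0], that is - exp (- e^v), is a primitive and runs from -1 to 0. *)
Lemma line_Gamma1 : line_Gamma 1 = 1.
Proof.
have E v : gumbel 1 v = (expR v)%:C * gumbel 0 v by rewrite -gumbelS add0r.
have d : is_cderive (fun v => (-1) * gumbel 0 v) (gumbel 1).
  move=> x; have := is_cderiveZ (-1) (is_cderive_gumbel 0) x.
  rewrite (_ : -1 * ((0 - (expR x)%:C) * gumbel 0 x) = gumbel 1 x) // E; ring.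
rewrite /line_Gamma (cintegral_FTC_T (ccont_gumbel 1) d (A := -1) (B := 0)).
- by rewrite sub0r opprK.
- by apply: cint_gumbel => /=; exact: ltr01.
- rewrite -[X in ccvg _ X]mulr1; apply: ccvgM; first exact: ccvg_cst.
  apply: ccvg_nc (@cvg_harmonic0 R 2) _ => n.
  rewrite /gumbel mul0r sub0r -rmorphN cexp_real -rmorphB nc_real.
  set x := expR (- n.+1%:R).
  have x0 : 0 <= x by exact: expR_ge0.
  have hx : x <= (n.+1%:R)^-1.
    rewrite /x expRN lef_pV2 ?posrE ?expR_gt0 // (le_trans _ (expR_ge1Dx _)) //.
    by rewrite lerDr.
  have := normr_expRB1_le (- x); rewrite normrN (ger0_norm x0).
  have : expR (- x) <= 1 by rewrite -expR0 ler_expR oppr_le0.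
  move=> e1 h; apply: (le_trans h); apply: (@le_trans _ _ (x * 2)).
    by rewrite ler_wpM2l //; lra.
  by rewrite mulrC ler_wpM2l.
- rewrite -[X in ccvg _ X](mulr0 (-1)); apply: ccvgM; first exact: ccvg_cst.
  apply: ccvg_nc (@cvg_harmonic0 R 1) _ => n.
  rewrite /gumbel mul0r !sub0r subr0 -rmorphN cexp_real nc_real ger0_norm ?expR_ge0 //.
  rewrite expRN mul1r lef_pV2 ?posrE ?expR_gt0 //.
  have := expR_ge1Dx (expR (n.+1%:R : R)); have := expR_ge1Dx (n.+1%:R : R).
  lra.
Qed.

Lemma line_Gamma_nat n : line_Gamma (n.+1%:R) = (n`!%:R : R[i]).
Proof.
elim: n => [|n IH]; first exact: line_Gamma1.
rewrite -[n.+2%:R]natr1 line_GammaS ?IH ?Re_nat ?ltr0n //.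
by rewrite factS natrM.
Qed.

Lemma line_Gamma_shift s n : 0 < complex.Re s ->
  line_Gamma (s + n%:R) = pochhammer s n * line_Gamma s.
Proof.
move=> s0; elim: n => [|n IH].
  by rewrite addr0 /pochhammer big_ord0 mul1r.
rewrite -natr1 addrA line_GammaS; last by rewrite ReD Re_nat ltr_wpDr.
by rewrite IH /pochhammer big_ord_recr /=; ring.
Qed.

Lemma nc_line_Gamma_le s : 0 < complex.Re s ->
  nc (line_Gamma s) <= 2 * complex.Re (line_Gamma (complex.Re s)%:C).
Proof.
move=> s0; rewrite (le_trans (nc_cintegral_le _ (cmeas_gumbel s) (rint_gumbel s0) _)) //.
  by move=> v _; rewrite nc_gumbel.
rewrite ler_pM2l // le_eqVlt; apply/orP; left; apply/eqP.
apply: eq_Rintegral => v _.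
by rewrite /gumbel -rmorphM -rmorphB cexp_real.
Qed.

Lemma expR_strip_le (a b x v : R) : a <= x <= b ->
  expR (x * v - expR v) <= expR (a * v - expR v) + expR (b * v - expR v).
Proof.
move=> /andP[ax xb]; have [v0|v0] := leP 0 v.
  by rewrite ler_wpDl ?expR_ge0 // ler_expR lerD2r ler_wpM2r.
by rewrite ler_wpDr ?expR_ge0 // ler_expR lerD2r ler_wnM2r // ltW.
Qed.

Lemma holK_gumbel (a b v : R) :
  holK [set t | a <= complex.Re t <= b]
    (8 * ((expR (a * v - expR v) + expR (b * v - expR v)) * (1 + v ^+ 2)))
    (fun t => gumbel t v) (fun t => v%:C * gumbel t v).
Proof.
set E := expR (a * v - _) + _.
have E0 : 0 <= E by rewrite addr_ge0 ?expR_ge0.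
have nv t : a <= complex.Re t <= b -> nc (gumbel t v) <= E.
  by move=> h; rewrite nc_gumbel expR_strip_le.
have v1 : `|v| <= 1 + v ^+ 2.
  rewrite -[in leRHS]real_normK ?num_real //.
  have := sqr_ge0 (`|v| - 1); have := sqr_ge0 (`|v|); lra.
have v2 := sqr_ge0 v.
have Ev := mulr_ge0 E0 v2.
have wE t w : gumbel w v = gumbel t v * cexp ((w - t) * v%:C).
  by rewrite /gumbel -cexpD; congr cexp; ring.
(* The factor 1 + e^(Re ((w - t) v)) turns the modulus of [gumbel t v] into the sum of the moduli at
   t and at w, hence the bound 2 E over the whole strip, however far apart t and w are. *)
have nvw t w (c : R) : a <= complex.Re t <= b -> a <= complex.Re w <= b -> 0 <= c ->
    nc (gumbel t v) * (c * (1 + expR (complex.Re ((w - t) * v%:C)))) <= c * (2 * E).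
  move=> ht hw c0.
  have -> : nc (gumbel t v) * (c * (1 + expR (complex.Re ((w - t) * v%:C)))) =
     c * (nc (gumbel t v) + nc (gumbel w v)).
    by rewrite (wE t w) (Normc.normcM (gumbel t v)) nc_cexp; ring.
  rewrite ler_wpM2l // mulr2n mulrDl mul1r lerD //; exact: nv.
split.
- by rewrite !mulr_ge0 // addr_ge0.
- by move=> t /nv h; lra.
- move=> t /nv h; rewrite Normc.normcM nc_real.
  have : `|v| * nc (gumbel t v) <= (1 + v ^+ 2) * E by rewrite ler_pM ?nc_ge0.
  lra.
- move=> t w ht hw.
  have -> : gumbel w v - gumbel t v = gumbel t v * (cexp ((w - t) * v%:C) - 1).
    by rewrite (wE t w) mulrBr mulr1.
  rewrite Normc.normcM.
  have := nc_cexpB1_le ((w - t) * v%:C).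
  rewrite [X in 3 * X]Normc.normcM nc_real => h.
  apply: (le_trans (ler_wpM2l (nc_ge0 _) h)).
  have c0 : 0 <= 3 * (nc (w - t) * `|v|) by rewrite !mulr_ge0 ?nc_ge0.
  apply: (le_trans (nvw t w _ ht hw c0)).
  have h2 : 2 * `|v| <= 1 + v ^+ 2.
    rewrite -[in leRHS]real_normK ?num_real //; have := sqr_ge0 (`|v| - 1); lra.
  have := ler_wpM2l (mulr_ge0 (nc_ge0 (w - t)) E0) h2.
  have := mulr_ge0 (nc_ge0 (w - t)) Ev; have := mulr_ge0 (nc_ge0 (w - t)) E0; lra.
- move=> t w ht hw.
  have -> : gumbel w v - gumbel t v - v%:C * gumbel t v * (w - t) =
     gumbel t v * (cexp ((w - t) * v%:C) - 1 - (w - t) * v%:C).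
    by rewrite (wE t w); ring.
  rewrite Normc.normcM.
  have := nc_cexpB1B_le ((w - t) * v%:C).
  rewrite [X in 4 * X ^+ 2]Normc.normcM nc_real exprMn real_normK ?num_real // => h.
  apply: (le_trans (ler_wpM2l (nc_ge0 _) h)).
  have c0 : 0 <= 4 * (nc (w - t) ^+ 2 * v ^+ 2) by rewrite mulr_ge0 // mulr_ge0 // sqr_ge0.
  apply: (le_trans (nvw t w _ ht hw c0)).
  have := mulr_ge0 (sqr_ge0 (nc (w - t))) E0; lra.
Qed.

Lemma hol_line_Gamma (a b : R) : 0 < a -> a <= b ->
  hol [set t | a <= complex.Re t <= b] line_Gamma.
Proof.
move=> a0 ab; have b0 := lt_le_trans a0 ab.
do 2 eexists; apply: (holK_integral (holK_gumbel a b)).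
- apply: (rint_eq _ _ (rintZ 8 _ (rintD _ (rint_gumbel_sqr a0) (rint_gumbel_sqr b0)))) => //.
  by move=> v _; rewrite -mulrDl.
- by move=> t _; exact: cmeas_gumbel.
- move=> t _; apply: cmeasM; last exact: cmeas_gumbel.
  by apply: cmeas_real; exact: measurable_id.
Qed.

End line_Gamma.

(** * A uniform lower bound for the modulus of Gamma *)

Section Gamma_nonvanishing.
Context {R : realType}.
Notation mu := (@lebesgue_measure R).
Implicit Types (s t : R[i]).

(** Up to the mass n!, the law of the logarithm of a Gamma variable of shape n + 1; under it w = e^v
    / (n + 1) has mean 1. *)
Definition gamma_density (n : nat) (v : R) : R := expR (n.+1%:R * v - expR v).

Lemma Rintegral_gamma_density n : \int[mu]_v gamma_density n v = n`!%:R.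
Proof.
have := congr1 (@complex.Re R) (line_Gamma_nat n); rewrite Re_nat => <-.
apply: eq_Rintegral => v _.
by rewrite -(rmorph_nat (real_complex R)) /gumbel -rmorphM -rmorphB cexp_real.
Qed.

Lemma rint_gamma_density n : rint setT (gamma_density n).
Proof. by apply: rint_gumbel; rewrite ltr0n. Qed.

Lemma gamma_densityX n i v :
  gamma_density n v * (expR v / n.+1%:R) ^+ i = (n.+1%:R ^+ i)^-1 * gamma_density (n + i) v.
Proof.
rewrite expr_div_n -expRM_natl mulrA [RHS]mulrC; congr (_ / _).
rewrite /gamma_density -expRD; congr expR.
by rewrite -addSn natrD; ring.
Qed.

Lemma gamma_density_polyE n (q : {poly R}) v :
  gamma_density n v * q.[expR v / n.+1%:R] =
  \sum_(i < size q) (q`_i / n.+1%:R ^+ i) * gamma_density (n + i) v.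
Proof.
rewrite horner_coef mulr_sumr; apply: eq_bigr => i _.
by rewrite mulrCA gamma_densityX mulrA.
Qed.

Lemma rint_sum (I : Type) (r : seq I) (F : I -> R -> R) :
  (forall i, rint setT (F i)) -> rint setT (fun u => \sum_(i <- r) F i u).
Proof.
move=> h; elim: r => [|i r IH].
  by under eq_fun do rewrite big_nil; exact: rint0.
by under eq_fun do rewrite big_cons; exact: rintD.
Qed.

Lemma Rintegral_sum (I : Type) (r : seq I) (F : I -> R -> R) :
  (forall i, rint setT (F i)) ->
  \int[mu]_u (\sum_(i <- r) F i u) = \sum_(i <- r) \int[mu]_u F i u.
Proof.
move=> h; elim: r => [|i r IH].
  by under eq_Rintegral do rewrite big_nil; rewrite big_nil /Rintegral integral0.
under eq_Rintegral do rewrite big_cons.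
rewrite RintegralD ?IH ?big_cons //; first exact: h.
exact: (rint_sum r h).
Qed.

Lemma rint_gamma_density_poly n (q : {poly R}) :
  rint setT (fun v => gamma_density n v * q.[expR v / n.+1%:R]).
Proof.
under eq_fun do rewrite gamma_density_polyE.
by apply: rint_sum => i; apply: rintZ => //; exact: rint_gamma_density.
Qed.

Lemma cvg_gamma_moment i :
  ((n + i)`!%:R / (n.+1%:R ^+ i * n`!%:R)) @[n --> \oo] --> (1 : R).
Proof.
have f0 n : (n`!%:R : R) != 0 by rewrite pnatr_eq0 -lt0n fact_gt0.
have n0 n : (n.+1%:R : R) != 0 by rewrite pnatr_eq0.
elim: i => [|i IH].
  by apply: cvg_ext (cvg_cst (1 : R)) => n; rewrite addn0 expr0 mul1r divff.
have h : (1 + i%:R / n.+1%:R) @[n --> \oo] --> (1 + 0 : R).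
  by apply: cvgD; [exact: cvg_cst|exact: cvg_harmonic0].
rewrite addr0 in h; rewrite -[X in _ --> X]mulr1; apply: cvg_ext (cvgM IH h) => n /=.
rewrite addnS factS natrM exprS -addSn natrD.
by field; rewrite f0 expf_neq0 // addrC natr1 n0.
Qed.

(** Each moment of w = e^v / (n + 1) tends to 1, so the law of w concentrates at 1 when tested
    against polynomials. *)
Lemma cvg_gamma_density_poly (q : {poly R}) :
  ((\int[mu]_v (gamma_density n v * q.[expR v / n.+1%:R])) / n`!%:R) @[n --> \oo]
  --> q.[1].
Proof.
have H : (\sum_(i < size q) q`_i * ((n + i)`!%:R / (n.+1%:R ^+ i * n`!%:R))) @[n --> \oo]
   --> \sum_(i < size q) q`_i * 1.
  elim: (index_enum _) => [|i r IH].
    by rewrite big_nil; apply: cvg_ext (cvg_cst 0) => n; rewrite big_nil.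
  rewrite big_cons; apply: cvg_ext (cvgD (cvgM (cvg_cst _) (cvg_gamma_moment i)) IH) => n.
  by rewrite big_cons.
rewrite horner_coef; under eq_bigr do rewrite expr1n.
apply: cvg_ext H => n.
under eq_Rintegral do rewrite gamma_density_polyE.
rewrite Rintegral_sum => [|i]; last by apply: rintZ => //; exact: rint_gamma_density.
rewrite mulr_suml; apply: eq_bigr => i _.
rewrite RintegralZl //; last exact: rint_gamma_density.
rewrite Rintegral_gamma_density invfM !mulrA; ring.
Qed.

(* With [w = exp x], Young's inequality [|w - 1| <= e + (w - 1)^2 / e] makes the
   bound polynomial in [w]. *)
Lemma nc_cexp_concentration (t : R[i]) (x e C : R) (p : nat) : 0 < e ->
  nc t <= C -> 0 <= complex.Re t <= p%:R ->
  expR x * nc (cexp (t * x%:C) - 1) <=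
  (3 * C) * (e + (expR x - 1) ^+ 2 / e) * (1 + expR x) * (2 + expR x ^+ p).
Proof.
move=> e0 tC /andP[t0 tp].
set w := expR x; have w0 : 0 < w by exact: expR_gt0.
have C0 : 0 <= C by exact: le_trans (nc_ge0 t) tC.
have hx : w * `|x| <= (1 + w) * `|w - 1|.
  have h1 := expRB1_le x; have h2 := expR_ge1Dx x; rewrite -/w in h1 h2.
  have [x0|x0] := leP 0 x.
    rewrite (ger0_norm x0) ger0_norm; last lra.
    rewrite ler_pM // ?(ltW w0) //; lra.
  have w1 : w <= 1 by rewrite /w -expR0 ler_expR ltW.
  rewrite (ler0_norm (ltW x0)) ler0_norm; last lra.
  nra.
have hw : `|w - 1| <= e + (w - 1) ^+ 2 / e.
  have -> : (w - 1) ^+ 2 = `|w - 1| ^+ 2 by rewrite real_normK ?num_real.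
  set z := `|w - 1|; have z0 : 0 <= z by exact: normr_ge0.
  rewrite -(ler_pM2r e0) mulrDl -mulrA mulVf ?gt_eqF // mulr1.
  have := sqr_ge0 (z - e); have := mulr_ge0 z0 (ltW e0); lra.
have hp : expR (complex.Re (t * x%:C)) <= 1 + w ^+ p.
  rewrite ReM /= mulr0 subr0.
  have [x0|x0] := leP 0 x.
    by rewrite ler_wpDl // -expRM_natl ler_expR ler_wpM2r.
  rewrite ler_wpDr ?exprn_ge0 ?(ltW w0) // -expR0 ler_expR nmulr_lle0 //.
have := nc_cexpB1_le (t * x%:C); rewrite [X in 3 * X]Normc.normcM nc_real => h.
apply: (le_trans (ler_wpM2l (ltW w0) h)).
set E := expR (complex.Re (t * x%:C)) in hp h *.
have E0 : 0 <= E by exact: expR_ge0.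
have -> : w * (3 * (nc t * `|x|) * (1 + E)) = (3 * nc t) * ((w * `|x|) * (1 + E)) by ring.
have -> : 3 * C * (e + (w - 1) ^+ 2 / e) * (1 + w) * (2 + w ^+ p) =
  (3 * C) * (((1 + w) * (e + (w - 1) ^+ 2 / e)) * (2 + w ^+ p)) by ring.
have wx0 : 0 <= w * `|x| by rewrite mulr_ge0 // ltW.
apply: ler_pM; [by rewrite mulr_ge0 ?nc_ge0|by rewrite mulr_ge0 ?addr_ge0|by rewrite ler_wpM2l|].
apply: ler_pM => //; [by rewrite addr_ge0| |lra].
by rewrite (le_trans hx) // ler_wpM2l // addr_ge0 // ltW.
Qed.

(** The normalised value (n + 1)^(- (t + 1)) Gamma (t + n + 2) is an integral against
    [gamma_density n] that differs from n! by at most n! / 2 once n is large: the difference of the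
    integrands is dominated by a polynomial in w which is small at w = 1. The polynomial depends
    only on C and p, so one n serves all t. *)
Lemma line_Gamma_lower_right (p : nat) (C : R) :
  exists (n : nat) (d : R), 0 < d /\
  forall t : R[i], nc t <= C -> 0 <= complex.Re t <= p%:R ->
    d <= nc (line_Gamma (t + n%:R)).
Proof.
wlog C0 : C / 0 < C.
  move=> h; have [|n [d [d0 H]]] := h (Num.max 1 C); first by rewrite lt_max ltr01.
  by exists n, d; split => // t tC; apply: H; rewrite le_max tC orbT.
(* At w = 1 the polynomial [q] equals 3 C e * 2 * 3 = 1 / 8. For large n its mean is below 1 / 4,
   and the factor 2 of [nc_cintegral_le] brings the error to 1 / 2. *)
pose e : R := (48 * (3 * C))^-1.
have e0 : 0 < e by rewrite invr_gt0 !mulr_gt0.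
pose q : {poly R} := (3 * C)%:P * (e%:P + (e^-1)%:P * ('X - 1) ^+ 2) * (1 + 'X) * (2%:P + 'X^p).
have qE w : q.[w] = (3 * C) * (e + (w - 1) ^+ 2 / e) * (1 + w) * (2 + w ^+ p).
  rewrite /q !(hornerE, hornerXn) /=; ring.
have q1 : q.[1] = 1 / 8.
  by rewrite qE subrr expr0n /= mul0r addr0 expr1n /e; field; rewrite gt_eqF.
have [n hn] : exists n, (\int[mu]_v (gamma_density n v * q.[expR v / n.+1%:R])) / n`!%:R < 1 / 4.
  have := @cvg_gamma_density_poly q; rewrite q1 => H.
  have H2 : \forall n \near \oo, (\int[mu]_v (gamma_density n v * q.[expR v / n.+1%:R])) / n`!%:R < 1 / 4.
    by apply: (cvgr_lt _ H); lra.
  by have [n _ h] := H2; exists n; apply: h => /=.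
have f0 : 0 < n`!%:R :> R by rewrite ltr0n fact_gt0.
have n0 : 0 < n.+1%:R :> R by rewrite ltr0n.
rewrite ltr_pdivrMr // in hn.
exists n.+2, (n`!%:R / 2); split; first by rewrite divr_gt0.
move=> t tC /andP[t0 tp].
pose L : R := ln n.+1%:R.
have LE v : expR v / n.+1%:R = expR (v - L) by rewrite expRD expRN lnK ?posrE.
pose c : R[i] := cexp (- ((t + 1) * L%:C)).
have i1 : cint setT (gumbel (t + n.+2%:R)).
  by apply: cint_gumbel; rewrite ReD Re_nat ltr_wpDl.
have i2 : cint setT (gumbel (n.+2%:R : R[i])).
  by apply: cint_gumbel; rewrite Re_nat.
(* With w = e^v / (n + 1), this is the density times w (w^t - 1). The extra factor w, due to n + 2
   in place of n + 1, compensates the growth of ln w at w = 0. *)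
pose D v := c * gumbel (t + n.+2%:R) v - (n.+1%:R^-1)%:C * gumbel n.+2%:R v.
have DE v : nc (D v) <= gamma_density n v * q.[expR v / n.+1%:R].
  rewrite LE qE.
  have -> : D v = (gamma_density n v)%:C * ((expR (v - L))%:C * (cexp (t * (v - L)%:C) - 1)).
    have e1 : (n.+1%:R^-1)%:C = cexp (- L%:C) :> R[i].
      by rewrite cexpN cexp_real lnK ?posrE // fmorphV.
    rewrite /D /c e1 /gamma_density /gumbel -!cexp_real mulrBr mulr1 mulrBr -!cexpD.
    rewrite !(rmorphB, rmorphM) /= !rmorph_nat -!natr1 ?cexp_real.
    by congr (cexp _ - cexp _); ring.
  rewrite !Normc.normcM !nc_real !ger0_norm ?expR_ge0 // ler_wpM2l ?expR_ge0 //.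
  by apply: nc_cexp_concentration => //; rewrite t0.
have ID : cintegral setT D = c * line_Gamma (t + n.+2%:R) - n`!%:R.
  rewrite cintegralB; [|by []|exact: cintZ|exact: cintZ].
  rewrite !cintegralZ // -/(line_Gamma _) -/(line_Gamma _) line_Gamma_nat factS natrM.
  by congr (_ - _); rewrite fmorphV rmorph_nat mulrA mulVf ?mul1r.
have mD : cmeas setT D.
  by apply: cint_meas; apply: cintB => //; exact: cintZ.
have := nc_cintegral_le (@measurableT _ _) mD (rint_gamma_density_poly n q) (fun v _ => DE v).
rewrite ID => h.
have h2 : n`!%:R <= nc (c * line_Gamma (t + n.+2%:R) - n`!%:R) + nc (c * line_Gamma (t + n.+2%:R)).
  have := ncB (c * line_Gamma (t + n.+2%:R)) (c * line_Gamma (t + n.+2%:R) - n`!%:R).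
  by rewrite subKr nc_nat addrC.
have c1 : nc c <= 1.
  rewrite nc_cexp -expR0 ler_expR ReN ReM /= mulr0 subr0 oppr_le0 mulr_ge0 //.
    by rewrite ReD addr_ge0.
  by rewrite ln_ge0 // ler1n.
rewrite Normc.normcM in h2.
have := ler_wpM2r (nc_ge0 (line_Gamma (t + n.+2%:R))) c1.
lra.
Qed.

End Gamma_nonvanishing.

(** * Finite hypergeometric sums *)

Section pochhammer_symbol.
Context {A : pzRingType}.
Implicit Types b : A.

Lemma pochhammer0 b : pochhammer b 0 = 1.
Proof. by rewrite /pochhammer big_ord0. Qed.

Lemma pochhammerS b n : pochhammer b n.+1 = pochhammer b n * (b + n%:R).
Proof. by rewrite /pochhammer big_ord_recr. Qed.

Lemma pochhammerSl b n : pochhammer b n.+1 = b * pochhammer (b + 1) n.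
Proof.
rewrite /pochhammer big_ord_recl /= addr0; congr (_ * _).
by apply: eq_bigr => i _; rewrite /bump /= natrD addrA.
Qed.

Lemma pochhammerD b m n : pochhammer b (m + n) = pochhammer b m * pochhammer (b + m%:R) n.
Proof.
elim: n => [|n IH]; first by rewrite addn0 pochhammer0 mulr1.
by rewrite addnS !pochhammerS IH natrD mulrA addrA.
Qed.

End pochhammer_symbol.

Section finite_sums.
Context {F : numFieldType}.
Implicit Types (a b c s q : F).

(** This is Gamma s / Gamma (s - n), see [Gamma_falling]. *)
Definition falling s (n : nat) : F := \prod_(i < n) (s - i%:R - 1).

Lemma falling0 s : falling s 0 = 1.
Proof. by rewrite /falling big_ord0. Qed.

Lemma fallingS s n : falling s n.+1 = falling s n * (s - n%:R - 1).
Proof. by rewrite /falling big_ord_recr. Qed.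

Lemma pochhammer_falling s n : pochhammer (1 - s) n = (-1) ^+ n * falling s n.
Proof.
elim: n => [|n IH]; first by rewrite pochhammer0 falling0 mul1r.
by rewrite pochhammerS fallingS IH exprS; ring.
Qed.

(** Pascal's rule splits the sum for p + 1 into two sums for p, with parameters (b, c) and (b + 1, c
    + 1); both have the same difference c - b. *)
Lemma chu_vandermonde p b c :
  \sum_(i < p.+1) (-1) ^+ i * 'C(p, i)%:R * pochhammer b i * pochhammer (c + i%:R) (p - i)
  = pochhammer (c - b) p.
Proof.
elim: p b c => [|p IH] b c.
  by rewrite big_ord_recl big_ord0 /= bin0 !pochhammer0; ring.
pose G i := (-1) ^+ i * 'C(p, i)%:R * pochhammer b i * pochhammer (c + i%:R) (p.+1 - i).
pose H i := (-1) ^+ i * 'C(p, i)%:R * pochhammer b i.+1 * pochhammer (c + i.+1%:R) (p - i).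
have e1 : \sum_(i < p.+1) G i = (c + p%:R) * pochhammer (c - b) p.
  rewrite -IH mulr_sumr; apply: eq_bigr => i _; rewrite /G.
  have ip : (i <= p)%N by rewrite -ltnS.
  rewrite subSn // pochhammerS -addrA -natrD subnKC //; ring.
have e2 : \sum_(i < p.+1) H i = b * pochhammer (c - b) p.
  have -> : c - b = (c + 1) - (b + 1) by ring.
  rewrite -IH mulr_sumr; apply: eq_bigr => i _; rewrite /H pochhammerSl.
  rewrite (_ : c + 1 + i%:R = c + i.+1%:R); first ring.
  by rewrite -natr1; ring.
rewrite pochhammerS.
have -> : pochhammer (c - b) p * (c - b + p%:R) =
    (c + p%:R) * pochhammer (c - b) p - b * pochhammer (c - b) p by ring.
rewrite -e1 -e2.
rewrite big_ord_recl [in RHS]big_ord_recl /= -/(G 0%N).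
rewrite (_ : \sum_(i < p.+1) H i = \sum_(i < p) H i + H p); last by rewrite big_ord_recr.
rewrite big_ord_recr /= /bump /= !add1n.
have -> : (-1) ^+ p.+1 * 'C(p.+1, p.+1)%:R * pochhammer b p.+1 * pochhammer (c + p.+1%:R) (p.+1 - p.+1)
   = - H p.
  by rewrite /H !binn !subnn exprS; ring.
have -> : (-1) ^+ 0 * 'C(p.+1, 0)%:R * pochhammer b 0 * pochhammer (c + 0%:R) (p.+1 - 0) = G 0%N.
  by rewrite /G !bin0.
have -> : \sum_(i < p) (-1) ^+ (1 + i) * 'C(p.+1, 1 + i)%:R * pochhammer b (1 + i) *
    pochhammer (c + (1 + i)%:R) (p.+1 - (1 + i)) = \sum_(i < p) (G i.+1 - H i).
  apply: eq_bigr => i _; rewrite !add1n /G /H binS natrD subSS exprS; ring.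
by rewrite sumrB /=; under [in RHS]eq_bigr do rewrite /bump /= add1n; ring.
Qed.

Lemma pochhammerN_nat n l : pochhammer (- n%:R : F) l = (-1) ^+ l * (n ^_ l)%:R.
Proof.
elim: l => [|l IH]; first by rewrite pochhammer0 ffactn0 mul1r.
rewrite pochhammerS IH ffactnSr natrM exprS.
have [ln|nl] := leqP l n; first by rewrite natrB //; ring.
by rewrite ffact_small //; ring.
Qed.

Lemma pochhammer_nat (m n : nat) : pochhammer (m.+1%:R : F) n * m`!%:R = (m + n)`!%:R.
Proof.
elim: n => [|n IH]; first by rewrite pochhammer0 addn0 mul1r.
rewrite pochhammerS mulrAC IH addnS factS natrM mulrC; congr (_ * _).
by rewrite -natrD addSn.
Qed.

Lemma fact_neq0 n : n`!%:R != 0 :> F.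
Proof. by rewrite pnatr_eq0 -lt0n fact_gt0. Qed.

(** Expanding (1 - q)^l and collecting q^k leaves, in i = l - k, a Chu-Vandermonde sum with
    difference of parameters 1 - s, whose value is [falling s (n - k)] up to sign. *)
Lemma euler_transformation n s q (nu : nat) :
  \sum_(l < n.+1) (1 - q) ^+ l * (pochhammer (- n%:R) l / ((nu + l)`!%:R * l`!%:R))
     * pochhammer (s + nu%:R) l * (nu + n)`!%:R =
  \sum_(k < n.+1) q ^+ k * (-1) ^+ (k + n) * 'C(n, k)%:R * pochhammer (s + nu%:R) k
     * falling s (n - k).
Proof.
pose A l := (-1) ^+ l * 'C(n, l)%:R * pochhammer ((nu + l).+1%:R : F) (n - l)
  * pochhammer (s + nu%:R) l.
transitivity (\sum_(l < n.+1) \sum_(k < n.+1) 'C(l, k)%:R * (- q) ^+ k * A l).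
  apply: eq_bigr => l _; rewrite -mulr_suml.
  have ln : (l <= n)%N by rewrite -ltnS.
  have -> : (1 - q) ^+ l = \sum_(k < n.+1) 'C(l, k)%:R * (- q) ^+ k.
    rewrite exprDn (big_ord_widen n.+1 (fun k => 1 ^+ (l - k) * (- q) ^+ k *+ 'C(l, k))) //.
    rewrite [LHS]big_mkcond /=; apply: eq_bigr => k _; case: ltnP => lk.
      by rewrite expr1n mul1r mulr_natl.
    by rewrite bin_small // mul0r.
  rewrite -!mulrA; congr (_ * _).
  rewrite /A pochhammerN_nat -bin_ffact natrM.
  have -> : (nu + n)`!%:R = pochhammer ((nu + l).+1%:R : F) (n - l) * (nu + l)`!%:R.
    by rewrite pochhammer_nat -addnA subnKC.
  field; by rewrite !fact_neq0.
rewrite exchange_big /=; apply: eq_bigr => k _.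
have kn : (k <= n)%N by rewrite -ltnS.
have -> : \sum_(l < n.+1) 'C(l, k)%:R * (- q) ^+ k * A l =
    (- q) ^+ k * \sum_(l < n.+1) 'C(l, k)%:R * A l.
  by rewrite mulr_sumr; apply: eq_bigr => l _; ring.
have -> : \sum_(l < n.+1) 'C(l, k)%:R * A l =
    \sum_(i < (n - k).+1) 'C(k + i, k)%:R * A (k + i)%N.
  rewrite -(big_mkord xpredT (fun l => 'C(l, k)%:R * A l)).
  rewrite (big_cat_nat _ (n := k)) //=; last exact: leqW.
  rewrite big_nat_cond big1 ?add0r; last first.
    by move=> l; rewrite andbT => /andP[_ lk]; rewrite bin_small // mul0r.
  rewrite -[X in \sum_(X <= _ < _) _]add0n big_addn subSn // big_mkord.
  by apply: eq_bigr => i _; rewrite addnC.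
have -> : \sum_(i < (n - k).+1) 'C(k + i, k)%:R * A (k + i)%N =
    (-1) ^+ k * 'C(n, k)%:R * pochhammer (s + nu%:R) k *
    \sum_(i < (n - k).+1) (-1) ^+ i * 'C(n - k, i)%:R *
      pochhammer (s + nu%:R + k%:R) i * pochhammer ((nu + k).+1%:R + i%:R) (n - k - i).
  rewrite mulr_sumr; apply: eq_bigr => i _; rewrite /A.
  have ik : (i <= n - k)%N by rewrite -ltnS.
  have e : 'C(n, k + i)%:R * 'C(k + i, k)%:R = 'C(n, k)%:R * 'C(n - k, i)%:R :> F.
    have kin : (k + i <= n)%N by rewrite -leq_subRL.
    apply: (mulIf (fact_neq0 k)); apply: (mulIf (fact_neq0 i)).
    apply: (mulIf (fact_neq0 (n - k - i))).
    have e1 := congr1 (fun m => m%:R : F) (bin_fact kin).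
    have e2 := congr1 (fun m => m%:R : F) (bin_fact (leq_addr i k)).
    have e3 := congr1 (fun m => m%:R : F) (bin_fact kn).
    have e4 := congr1 (fun m => m%:R : F) (bin_fact ik).
    rewrite /= in e1 e2 e3 e4; rewrite !natrM in e1 e2 e3 e4.
    rewrite addKn in e2; rewrite subnDA in e1.
    transitivity (n`!%:R : F); last by rewrite -e3 -e4; ring.
    by rewrite -e1 -e2; ring.
  have -> : (nu + k).+1%:R + i%:R = (nu + (k + i)).+1%:R :> F.
    by rewrite -natrD addSn addnA.
  rewrite subnDA pochhammerD exprD.
  transitivity ('C(n, k + i)%:R * 'C(k + i, k)%:R * ((-1) ^+ k * (-1) ^+ i *
    pochhammer ((nu + (k + i)).+1%:R) (n - k - i) *
    (pochhammer (s + nu%:R) k * pochhammer (s + nu%:R + k%:R) i))); first ring.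
  by rewrite e; ring.
rewrite chu_vandermonde.
have -> : (nu + k).+1%:R - (s + nu%:R + k%:R) = 1 - s.
  by rewrite -natr1 natrD; ring.
rewrite pochhammer_falling.
have -> : (-1) ^+ (k + n) = (-1) ^+ (n - k) :> F.
  by rewrite -signr_odd -[RHS]signr_odd oddD oddB // addbC.
have e : (-1) ^+ k * (-1) ^+ k = 1 :> F by rewrite -expr2 sqrr_sign.
by rewrite [(- q) ^+ k]exprNn -[RHS]mul1r -[X in _ = X * _]e; ring.
Qed.

(** The rational part, in s, of the sum over m at the pole t = a: the product is Gamma (s - a + k) /
    Gamma (s - a + m - 1). *)
Definition kernel_sum s a (k N : nat) :=
  \sum_(m < k.+1) (-1) ^+ m * 'C(N, m)%:R * falling s (N - m) /
     \prod_(m <= j < k.+1) (s - a + j%:R - 1).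

(** With the coefficient N - a the two sums combine telescopically in m. This removes the
    denominators, which neither sum does alone for general a. *)
Lemma kernel_sumS s a k N : (forall j, (j <= k)%N -> s - a + j%:R - 1 != 0) ->
  kernel_sum s a k N.+1 + (N%:R - a) * kernel_sum s a k N =
  (-1) ^+ k * 'C(N, k)%:R * falling s (N - k).
Proof.
move=> h.
pose D m := \prod_(m <= j < k.+1) (s - a + j%:R - 1).
have D0 m : D m != 0.
  rewrite /D big_seq; elim/big_ind: _ => [|x y x0 y0|j]; first exact: oner_neq0.
    by rewrite mulf_neq0.
  by rewrite mem_index_iota => /andP[_ jk]; apply: h.
have DS m : (m <= k)%N -> D m = (s - a + m%:R - 1) * D m.+1.
  by move=> mk; rewrite /D big_nat_recl //; congr (_ * _); rewrite big_add1.
pose T m := (-1) ^+ m * 'C(N, m)%:R * falling s (N - m) / D m.+1.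
(* The sum over m <= j collapses to the single term [T j], whose denominator starts at index j + 1;
   for j = k the denominator is an empty product. *)
have main j : (j <= k)%N ->
    \sum_(m < j.+1) ((-1) ^+ m * 'C(N.+1, m)%:R * falling s (N.+1 - m) / D m
     + (N%:R - a) * ((-1) ^+ m * 'C(N, m)%:R * falling s (N - m) / D m)) = T j.
  elim: j => [|j IH] jk.
    rewrite big_ord_recl big_ord0 /= addr0 !bin0 !subn0 fallingS /T bin0 subn0 DS //.
    have := D0 1%N; have := h 0%N isT; rewrite addr0 => h0 h1.
    field; by rewrite h1 h0.
  rewrite big_ord_recr /= IH ?(ltnW jk) // /T binS natrD subSS.
  rewrite (DS j.+1) //.
  have zE : s - a + j.+1%:R - 1 = s - a + j%:R by rewrite -natr1; ring.
  have := h j.+1 jk; rewrite zE => hj; have d := D0 j.+2.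
  have [jN|jN] := leqP j.+1 N.
    have -> : falling s (N - j) = falling s (N - j.+1) * (s - N%:R + j%:R).
      by rewrite -(subnSK jN) fallingS natrB // -natr1; congr (_ * _); ring.
    rewrite exprS; field; by rewrite d hj.
  rewrite [in 'C(N, j.+1)]bin_small // exprS.
  field; by rewrite d hj.
rewrite /kernel_sum mulr_sumr -big_split /= (main k (leqnn k)) /T.
by rewrite /D big_geq // invr1 mulr1.
Qed.

(** Iterating [kernel_sumS] from N = a; the signed factorial on the left is the normalisation that
    turns the recurrence into a plain sum. *)
Lemma kernel_sum_closed s (a k N : nat) :
  (forall j, (j <= k)%N -> s - a%:R + j%:R - 1 != 0) -> (a < N)%N ->
  (-1) ^+ (N - 1 - a) / (N - 1 - a)`!%:R * kernel_sum s a%:R k N =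
  (-1) ^+ a * \sum_(a <= n < N) (-1) ^+ (k + n) / (n - a)`!%:R * 'C(n, k)%:R * falling s (n - k).
Proof.
move=> h aN; rewrite -(subnKC aN); move: (N - a.+1)%N => d {N aN}.
elim: d => [|d IH].
  rewrite addn0 subSS subn0 subnn big_nat1 subnn fact0 invr1 expr0 !mul1r mulr1.
  (* For N = a the coefficient N - a vanishes, so the recurrence itself gives its initial value, a
     polynomial in s. *)
  have := kernel_sumS a h; rewrite subrr mul0r addr0 => ->.
  have e : (-1) ^+ a * (-1) ^+ a = 1 :> F by rewrite -expr2 sqrr_sign.
  by rewrite exprD -[LHS]mul1r -[X in X * _ = _]e; ring.
have e1 : (a.+1 + d - 1 - a = d)%N by rewrite addSn subn1 addKn.
have e2 : (a.+1 + d.+1 - 1 - a = d.+1)%N by rewrite addSn subn1 addKn.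
rewrite e1 in IH; rewrite e2 addnS big_nat_recr ?leq_addr //=; last by rewrite ltnW // ltnS leq_addr.
rewrite mulrDr -IH.
have := kernel_sumS (a.+1 + d)%N h.
have -> : (a.+1 + d)%:R - a%:R = d.+1%:R :> F by rewrite addSnnS natrD; ring.
move=> hk; have -> : kernel_sum s a%:R k (a.+1 + d).+1 =
  (-1) ^+ k * 'C(a.+1 + d, k)%:R * falling s (a.+1 + d - k) - d.+1%:R * kernel_sum s a%:R k (a.+1 + d).
  by rewrite -hk; ring.
have -> : (a.+1 + d - a = d.+1)%N by rewrite addSnnS addKn.
have es : (-1) ^+ a * (-1) ^+ (k + (a.+1 + d)) = (-1) ^+ k * (-1) ^+ d.+1 :> F.
  rewrite -!exprD -signr_odd -[RHS]signr_odd !oddD /= ?oddD.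
  by case: (odd a); case: (odd k); case: (odd d).
rewrite factS natrM !mulrA es exprS.
have := fact_neq0 d; have : d.+1%:R != 0 :> F by rewrite pnatr_eq0.
move=> h1 h2; move: (d.+1%:R) h1 (d`!%:R) h2 => u u0 v v0; field; by rewrite u0 v0.
Qed.

End finite_sums.

(** * Entire continuation of 1 / Gamma and of the Bessel series *)

Section complex_series.
Context {R : realType}.

Lemma real_series_cvg (a M : nat -> R) (S : R) : (forall j, `|a j| <= M j) ->
  (forall n, \sum_(j < n) M j <= S) ->
  (\sum_(j < n) a j) @[n --> \oo] --> limn (series a).
Proof.
move=> aM MS; have M0 j : 0 <= M j by rewrite (le_trans _ (aM j)).
have cM : cvgn (series M).
  apply: nondecreasing_is_cvgn; first by apply: nondecreasing_series => n _ _.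
  by exists S => _ [n _ <-]; rewrite /series /= big_mkord.
have ca : cvgn (series a).
  apply: normed_cvg; apply: series_le_cvg cM => // n; exact: normr_ge0.
by apply: cvg_ext ca => n; rewrite /series /= big_mkord.
Qed.

Lemma ccvg_cseries (a : nat -> R[i]) (M : nat -> R) (S : R) :
  (forall j, nc (a j) <= M j) -> (forall n, \sum_(j < n) M j <= S) ->
  ccvg (fun n => \sum_(j < n) a j) (cseries a).
Proof.
move=> aM MS; split => /=.
  apply: cvg_ext (@real_series_cvg (fun j => complex.Re (a j)) M S _ MS) => [n|j].
    by rewrite Re_sum.
  exact: le_trans (normr_Re_le_nc _) (aM j).
apply: cvg_ext (@real_series_cvg (fun j => complex.Im (a j)) M S _ MS) => [n|j].
  by rewrite Im_sum.
exact: le_trans (normr_Im_le_nc _) (aM j).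
Qed.

Lemma ccvg_cseries_eq (a : nat -> R[i]) z : ccvg (fun n => \sum_(j < n) a j) z ->
  cseries a = z.
Proof.
move=> [h1 h2]; apply: eqc => /=; apply/cvg_lim => //.
  by apply: cvg_ext h1 => n; rewrite Re_sum /series /= big_mkord.
by apply: cvg_ext h2 => n; rewrite Im_sum /series /= big_mkord.
Qed.

Lemma holK_cseries D (F F' : nat -> R[i] -> R[i]) (K : nat -> R) (S : R) :
  (forall j, holK D (K j) (F j) (F' j)) -> (forall n, \sum_(j < n) K j <= S) ->
  holK D S (fun t => cseries (F ^~ t)) (fun t => cseries (F' ^~ t)).
Proof.
move=> hF KS; apply: (holK_series hF KS) => t Dt; apply: ccvg_cseries KS => j.
  by have [_ h _ _ _] := hF j; exact: h.
by have [_ _ h _ _] := hF j; exact: h.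
Qed.

Lemma sum_exp_coeff_le (x : R) (m n : nat) : 0 <= x ->
  \sum_(j < n) x ^+ (m + j) / (m + j)`!%:R <= expR x.
Proof.
move=> x0; have e0 j : 0 <= exp_coeff x j.
  by rewrite /exp_coeff /= divr_ge0 ?exprn_ge0.
apply: (@le_trans _ _ (series (exp_coeff x) (m + n)%N)); last first.
  apply: nondecreasing_cvgn_le; last exact: is_cvg_series_exp_coeff.
  by apply: nondecreasing_series => k _ _.
rewrite /series /= big_mkord big_split_ord /= ler_wpDl ?sumr_ge0 //.
Qed.

End complex_series.

(** * The reciprocal of Gamma on the whole plane *)

Section reciprocal_Gamma.
Context {R : realType}.
Implicit Types (s t : R[i]).

Lemma line_Gamma_neq0 s : 0 < complex.Re s -> line_Gamma s != 0.
Proof.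
move=> s0; have [p hp] : exists p, complex.Re s <= p%:R.
  by have := near_natr_segment (complex.Re s) => -[n _ /(_ n (leqnn n)) /andP[_ h]]; exists n.+1.
have [n [d [d0 H]]] := line_Gamma_lower_right p (nc s).
have := H s (lexx _); rewrite hp (ltW s0) line_Gamma_shift // Normc.normcM => /(_ isT) h.
apply/eqP => z; move: h; rewrite z nc0 mulr0 => h.
by have := lt_le_trans d0 h; rewrite ltxx.
Qed.

Lemma pochhammer_Re_neq0 s n : 0 < complex.Re s -> pochhammer s n != 0.
Proof.
move=> s0; apply/prodf_neq0 => i _; apply/eqP => h.
have : complex.Re (s + i%:R) = 0 by rewrite h.
rewrite ReD Re_nat => h2; have : 0 < complex.Re s + i%:R by rewrite ltr_wpDr.
by rewrite h2 ltxx.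
Qed.

(** The continuation to the left does not depend on the number of shifts. *)
Lemma line_Gamma_quotient s m j : 0 < complex.Re s + m%:R ->
  line_Gamma (s + (m + j)%:R) / pochhammer s (m + j) = line_Gamma (s + m%:R) / pochhammer s m.
Proof.
move=> h; have h' : 0 < complex.Re (s + m%:R) by rewrite ReD Re_nat.
rewrite natrD addrA (line_Gamma_shift _ h') pochhammerD.
(* At a pole both quotients are 0, division by 0 giving 0. *)
have [->|p0] := eqVneq (pochhammer s m) 0; first by rewrite mul0r invr0 !mulr0.
by field; rewrite p0 pochhammer_Re_neq0.
Qed.

Lemma GammaE s n : 0 < complex.Re s + n%:R ->
  Gamma s = line_Gamma (s + n%:R) / pochhammer s n.
Proof.
move=> hn; rewrite /Gamma; case: ifPn => [s0|].
  rewrite Gamma_integralE line_Gamma_shift // mulrC mulKf //.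
  exact: pochhammer_Re_neq0.
rewrite -leNgt => s0; rewrite Gamma_integralE.
set m := `|_|%N.+1.
have hm : 0 < complex.Re s + m%:R.
  have f0 : Num.floor (complex.Re s) <= 0 by rewrite -(@floor0 R) le_floor.
  have mE : m%:R = - (Num.floor (complex.Re s))%:~R + 1 :> R.
    by rewrite /m -natr1 natr_absz ler0_norm // mulrNz.
  by rewrite mE; have := floor_le (complex.Re s); lra.
have [mn|/ltnW nm] := leqP m n.
  by rewrite -(subnKC mn) line_Gamma_quotient.
by rewrite -(subnKC nm) line_Gamma_quotient.
Qed.

Lemma exists_shift s : exists n, 0 < complex.Re s + n%:R.
Proof.
have := near_natr_segment (complex.Re s) => -[n _ /(_ n (leqnn n)) /andP[h _]].
exists n.+2; rewrite -[n.+2%:R]natr1; lra.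
Qed.

Definition rGamma s : R[i] := (Gamma s)^-1.

Lemma rGammaE s n : 0 < complex.Re s + n%:R ->
  rGamma s = pochhammer s n / line_Gamma (s + n%:R).
Proof. by move=> h; rewrite /rGamma (GammaE h) invf_div. Qed.

(** The zeros of the reciprocal make the functional equation valid at 0, -1, -2, ... too, both sides
    being 0 there. *)
Lemma rGammaS s : rGamma s = s * rGamma (s + 1).
Proof.
have [n hn] := exists_shift s.
have h1 : 0 < complex.Re (s + 1) + n%:R by rewrite ReD /=; lra.
have h2 : 0 < complex.Re s + n.+1%:R by rewrite -natr1; lra.
rewrite (rGammaE h1) (rGammaE h2) pochhammerSl -addrA -natr1 [1 + n%:R]addrC.
by rewrite mulrA.
Qed.

Lemma rGamma_shift s n : rGamma s = pochhammer s n * rGamma (s + n%:R).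
Proof.
elim: n => [|n IH]; first by rewrite pochhammer0 mul1r addr0.
by rewrite IH pochhammerS -mulrA; congr (_ * _); rewrite -natr1 addrA; exact: rGammaS.
Qed.

Lemma Gamma_neq0 s : 0 < complex.Re s -> Gamma s != 0.
Proof.
by move=> s0; rewrite /Gamma s0 Gamma_integralE line_Gamma_neq0.
Qed.

Lemma GammaV s : Gamma s = (rGamma s)^-1.
Proof. by rewrite /rGamma invrK. Qed.

Lemma rGamma_nat n : rGamma n.+1%:R = (n`!%:R)^-1.
Proof.
by rewrite /rGamma /Gamma Re_nat ltr0n Gamma_integralE line_Gamma_nat.
Qed.

Lemma rGamma_neq0 s : (forall n, s + n%:R != 0) -> rGamma s != 0.
Proof.
move=> h; have [n hn] := exists_shift s; rewrite (rGammaE hn).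
rewrite mulf_neq0 ?invr_eq0 ?line_Gamma_neq0 ?ReD ?Re_nat //.
exact/prodf_neq0.
Qed.

Definition disk (B : R) : set R[i] := [set t | nc t <= B].

Lemma hol_disk_id B : hol (disk B) id.
Proof. by apply: hol_id => t; exact. Qed.

Lemma hol_pochhammer B n (a : R[i]) : hol (disk B) (fun t => pochhammer (t + a) n).
Proof.
rewrite /pochhammer; apply: hol_prod => i.
by do 2 (apply: holD; last exact: hol_cst); exact: hol_disk_id.
Qed.

Lemma exists_nat_ge (B : R) : exists n, B <= n%:R.
Proof.
have := near_natr_segment B => -[n _ /(_ n (leqnn n)) /andP[_ h]].
by exists n.+1.
Qed.

(** One shift by m + n moves the whole disk into the region where Gamma is holomorphic and bounded
    below; the Pochhammer factor supplies the zeros. *)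
Lemma hol_rGamma B : hol (disk B) rGamma.
Proof.
have [m Bm0] := exists_nat_ge (Num.max B 0 + 1).
have m1 : 1 <= m%:R :> R by apply: le_trans Bm0; rewrite lerDr le_max lexx orbT.
have Bm : B + 1 <= m%:R by apply: le_trans Bm0; rewrite lerD2r le_max lexx.
have [n [d [d0 H]]] := line_Gamma_lower_right (m + m) (B + m%:R).
have ht t : disk B t -> 1 <= complex.Re (t + m%:R) <= (m + m)%:R /\ nc (t + m%:R) <= B + m%:R.
  move=> tB; have := normr_Re_le_nc t; rewrite ler_norml => /andP[h1 h2]; have h3 : nc t <= B by [].
  rewrite ReD Re_nat natrD; split; first by apply/andP; split; lra.
  by rewrite (le_trans (ncD _ _)) // nc_nat lerD2r.
apply: (@hol_eq _ _ (fun t => pochhammer (t + 0) (m + n) * (line_Gamma (t + (m + n)%:R))^-1)).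
  move=> t /ht[/andP[h1 h2] h3]; rewrite addr0 -(rGammaE (n := (m + n)%N)) //.
  by move: h1; rewrite ReD Re_nat natrD; have := ler0n R n; lra.
apply: holM; first exact: hol_pochhammer.
apply: (hol_inv d0).
  move=> t /ht[/andP[h1 h2] h3]; rewrite natrD addrA; apply: H => //.
  by rewrite h2 andbT; lra.
apply: (@hol_shift _ _ [set t | 1 <= complex.Re t <= (m + m)%:R + n%:R]); last first.
  by apply: hol_line_Gamma => //; rewrite natrD; have := ler0n R n; lra.
move=> t /ht[/andP[h1 h2] h3] /=; rewrite natrD addrA ReD Re_nat.
by rewrite lerD2r h2 andbT; have := ler0n R n; lra.
Qed.

End reciprocal_Gamma.

(** * The Bessel series as an entire function of its order *)

Section reciprocal.
Context {R : realType}.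

(** The constant dominates 1 / e, 1 / e^2 and 1 / e^3 and depends on a only through the distance e.
    This gives uniformity when a runs along a vertical line of poles. *)
Lemma holK_recip (D : set R[i]) (e : R) (a : R[i]) : 0 < e ->
  (forall t, D t -> e <= nc (t - a)) ->
  holK D ((1 + e^-1) ^+ 3) (fun t => (t - a)^-1) (fun t => - (t - a) ^- 2).
Proof.
move=> e0 De; set E := e^-1; have E0 : 0 < E by rewrite invr_gt0.
have ta t : D t -> t - a != 0.
  by move=> /De h; rewrite -nc_gt0 (lt_le_trans e0).
have V t : D t -> (nc (t - a))^-1 <= E.
  by move=> Dt; rewrite lef_pV2 ?posrE ?De // nc_gt0 ta.
have V0 t : 0 <= (nc (t - a))^-1 by rewrite invr_ge0 nc_ge0.
have K1 : E <= (1 + E) ^+ 3 by nra.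
have K2 : E * E <= (1 + E) ^+ 3 by nra.
have K3 : E * E * E <= (1 + E) ^+ 3 by nra.
split.
- by rewrite exprn_ge0 // addr_ge0 // ltW.
- by move=> t Dt; rewrite Normc.normcV (le_trans (V t Dt)).
- move=> t Dt; rewrite ncN Normc.normcV ncX -exprVn expr2 (le_trans _ K2) //.
  by rewrite ler_pM ?V.
- move=> t w Dt Dw.
  have -> : (w - a)^-1 - (t - a)^-1 = - (w - t) * ((w - a)^-1 * (t - a)^-1).
    by field; rewrite !ta.
  rewrite !Normc.normcM ncN !Normc.normcV mulrC ler_wpM2r ?nc_ge0 // (le_trans _ K2) //.
  by rewrite ler_pM ?V.
- move=> t w Dt Dw.
  have -> : (w - a)^-1 - (t - a)^-1 - - (t - a) ^- 2 * (w - t) =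
     (w - t) ^+ 2 * ((w - a)^-1 * (t - a)^-1 * (t - a)^-1) by field; rewrite !ta.
  rewrite (Normc.normcM ((w - t) ^+ 2)) ncX !Normc.normcM !Normc.normcV mulrC ler_wpM2r ?sqr_ge0 // (le_trans _ K3) //.
  by rewrite !ler_pM ?mulr_ge0 ?V.
Qed.

(* [x^-t 0F1(t + 1 | x) / Gamma (t + 1)] continued to all [t], i.e. a Bessel
   function [I_t] up to elementary factors. *)
Definition bessel_term (z : R[i]) (t : R[i]) (j : nat) : R[i] :=
  z ^+ j / j`!%:R * rGamma (t + 1 + j%:R).

Definition bessel_series (z t : R[i]) : R[i] := cseries (bessel_term z t).

(** Here 24 = 3 * 8, with 3 from [holKM] and 8 = (1 + 1)^3 from [holK_recip] at distance 1. The
    geometric growth is absorbed by the factorials in the series for [bessel_series]. *)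
Lemma holK_pochhammerV (D : set R[i]) n : (forall t, D t -> 1 <= complex.Re t) ->
  exists g', holK D (24 ^+ n) (fun t => (pochhammer t n)^-1) g'.
Proof.
move=> D1; elim: n => [|n [g' IH]].
  exists (fun=> 0); have h := @holK_cst _ D 1; rewrite nc1 in h.
  by apply: holK_eq h => // t _; rewrite pochhammer0 invr1.
have h1 t : D t -> 1 <= nc (t - - n%:R).
  move=> /D1 h; rewrite opprK (le_trans _ (normr_Re_le_nc _)) // ReD Re_nat.
  by rewrite (le_trans _ (ler_norm _)) // ler_wpDr.
have h2 := holKM IH (holK_recip ltr01 h1).
eexists; apply: holK_le (holK_eq _ _ h2).
- have -> : (1 + 1^-1 : R) ^+ 3 = 8 by rewrite invr1; ring.
  rewrite exprS; lra.
- by move=> t _; rewrite pochhammerS invfM opprK.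
- by move=> t _.
Qed.

Lemma ccvg_shift n (u : nat -> R[i]) z : ccvg (fun k => u (k + n)%N) z -> ccvg u z.
Proof. by move=> [h1 h2]; split; rewrite -(cvg_shiftn n). Qed.

Lemma bessel_termE (z t : R[i]) n i :
  bessel_term z t (n + i) * pochhammer (t + 1 + n%:R) i =
  rGamma (t + 1 + n%:R) * (z ^+ (n + i) / (n + i)`!%:R).
Proof.
by rewrite /bessel_term natrD (addrA (t + 1)) [in RHS](rGamma_shift _ i); ring.
Qed.

(** After n terms the argument of 1 / Gamma has real part at least 1. Once rGamma (t + 1 + n) is
    factored out, the tail has inverse Pochhammer symbols of modulus at most 1 and is dominated by
    an exponential series. *)
Lemma bessel_tail_spec (z : R[i]) (n : nat) (t : R[i]) : 1 <= complex.Re t + 1 + n%:R ->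
  ccvg (fun k => \sum_(j < k) bessel_term z t j) (bessel_series z t) /\
  bessel_series z t = \sum_(j < n) bessel_term z t j + rGamma (t + 1 + n%:R) *
    cseries (fun i => z ^+ (n + i) / (n + i)`!%:R * (pochhammer (t + 1 + n%:R) i)^-1).
Proof.
move=> tn; set w := t + 1 + n%:R.
have w1 : 1 <= complex.Re w by rewrite /w !ReD Re_nat.
pose c i : R[i] := z ^+ (n + i) / (n + i)`!%:R.
pose D := [set t : R[i] | 1 <= complex.Re t].
have p1 i : nc ((pochhammer w i)^-1) <= 1.
  rewrite Normc.normcV invf_le1; last first.
    by rewrite nc_gt0 pochhammer_Re_neq0 // (lt_le_trans ltr01).
  rewrite nc_prod; elim/big_ind: _ => // [x y x1 y1|i0 _]; first exact: mulr_ege1.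
  rewrite (le_trans _ (normr_Re_le_nc _)) // (le_trans _ (ler_norm _)) // ReD Re_nat.
  by rewrite ler_wpDr.
have nc_c i : nc (c i) = nc z ^+ (n + i) / (n + i)`!%:R.
  by rewrite Normc.normcM ncX Normc.normcV nc_nat.
have cT : ccvg (fun k => \sum_(i < k) c i * (pochhammer w i)^-1)
    (cseries (fun i => c i * (pochhammer w i)^-1)).
  apply: (@ccvg_cseries _ _ (fun i => nc z ^+ (n + i) / (n + i)`!%:R) (expR (nc z))).
    by move=> j; rewrite Normc.normcM -nc_c ler_piMr ?nc_ge0.
  by move=> k; exact: sum_exp_coeff_le (nc_ge0 z).
have H : ccvg (fun k => \sum_(j < k) bessel_term z t j)
    (\sum_(j < n) bessel_term z t j + rGamma w * cseries (fun i => c i * (pochhammer w i)^-1)).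
  apply: (@ccvg_shift n).
  apply: ccvg_ext (ccvgD (ccvg_cst _) (ccvgM (ccvg_cst _) cT)) => k /=.
  rewrite addnC big_split_ord /=; congr (_ + _); rewrite mulr_sumr.
  apply: eq_bigr => i _.
  have p0 : pochhammer w i != 0 by rewrite pochhammer_Re_neq0 // (lt_le_trans ltr01).
  by apply: (mulIf p0); rewrite bessel_termE mulrA mulrVK // unitfE.
by have e := ccvg_cseries_eq H; rewrite /bessel_series e; split.
Qed.

Lemma hol_bessel_series (z : R[i]) B : hol (disk B) (bessel_series z).
Proof.
have [n hn] := exists_nat_ge B.
have dn t : disk B t -> 1 <= complex.Re t + 1 + n%:R.
  move=> tB; have := normr_Re_le_nc t; rewrite ler_norml => /andP[h1 h2].
  have h3 : nc t <= B by []; lra.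
pose E := [set t : R[i] | 1 <= complex.Re t].
have dE t : disk B t -> E (t + (1 + n%:R)).
  by move=> /dn; rewrite /E /= !ReD Re_nat addrA.
have shiftB (a : R[i]) f : (forall B', hol (disk B') f) -> hol (disk B) (fun t => f (t + a)).
  move=> hf; apply: (hol_shift _ (hf (B + nc a))) => t tB.
  by rewrite /disk /= (le_trans (ncD _ _)) // lerD2r.
apply: (@hol_eq _ _ (fun t => \sum_(j < n) bessel_term z t j + rGamma (t + (1 + n%:R)) *
    cseries (fun i => z ^+ (n + i) / (n + i)`!%:R * (pochhammer (t + (1 + n%:R)) i)^-1))).
  by move=> t /dn h; rewrite (bessel_tail_spec z h).2 addrA.
apply: holD.
  apply: hol_sum => j; apply: holM; first exact: hol_cst.
  under eq_fun do rewrite -addrA.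
  by apply: shiftB => B'; exact: hol_rGamma.
apply: holM; first by apply: shiftB => B'; exact: hol_rGamma.
have /choice [g' hg'] : forall i, exists g', holK E (24 ^+ i) (fun t => (pochhammer t i)^-1) g'.
  by move=> i; exact: holK_pochhammerV.
pose c i : R[i] := z ^+ (n + i) / (n + i)`!%:R.
have hF i : holK (disk B) (3 * (nc (c i) * 24 ^+ i))
    (fun t => c i * (pochhammer (t + (1 + n%:R)) i)^-1) _ :=
  holKM (holK_cst _ _) (holK_shift dE (hg' i)).
do 2 eexists; apply: (holK_cseries hF (S := 3 * expR (24 * nc z))) => k.
rewrite -mulr_sumr ler_wpM2l //.
apply: le_trans (@sum_exp_coeff_le _ (24 * nc z) n k _); last by rewrite mulr_ge0 ?nc_ge0.
apply: ler_sum => i _; rewrite Normc.normcM ncX Normc.normcV nc_nat exprMn.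
have -> : 24 ^+ (n + i) * nc z ^+ (n + i) / (n + i)`!%:R =
  24 ^+ (n + i) * (nc z ^+ (n + i) / (n + i)`!%:R) by ring.
rewrite mulrC ler_wpM2r ?divr_ge0 ?exprn_ge0 ?nc_ge0 //.
by rewrite ler_weXn2l ?leq_addl // ler1n.
Qed.

(** One factor 1 / Gamma (t + 1) cancels the poles of the 0F1 in its parameter. At the excluded t
    the left side is 0 by convention, unlike the entire function on the right in general. *)
Lemma hyp0F1E (z t : R[i]) : (forall n, t + 1 + n%:R != 0) ->
  hyp0F1 (t + 1) z * rGamma (t + 1) = bessel_series z t.
Proof.
move=> h; have r0 := rGamma_neq0 h.
have [n hn] := exists_nat_ge (- complex.Re t).
have hn' : 1 <= complex.Re t + 1 + n%:R by lra.
have [cb _] := bessel_tail_spec z hn'.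
rewrite /hyp0F1 (ccvg_cseries_eq (z := bessel_series z t * (rGamma (t + 1))^-1)).
  by rewrite mulfVK.
apply: ccvg_ext (ccvgM cb (ccvg_cst _)) => k; rewrite mulr_suml; apply: eq_bigr => j _.
have p0 : pochhammer (t + 1) j != 0 by exact/prodf_neq0.
have r1 : rGamma (t + 1 + j%:R) != 0.
  by apply: rGamma_neq0 => m; rewrite -addrA -natrD h.
rewrite (rGamma_shift (t + 1) j) /bessel_term.
by field; rewrite p0 r1 pnatr_eq0 -lt0n fact_gt0.
Qed.

End reciprocal.

Local Arguments Normc.normc : simpl never.
Local Arguments cexp : simpl never.
Local Arguments cintegral : simpl never.

(** * Mellin-Barnes integrals *)

Section vertical_lines.
Context {R : realType}.
Notation mu := (@lebesgue_measure R).
Implicit Types (c w : R).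

Lemma lip_continuous (h : R -> R) (K : R) : (forall x y, `|h x - h y| <= K * `|x - y|) ->
  continuous h.
Proof.
move=> hK x; apply/subr_cvg0; apply: norm_cvg0.
apply: (@squeeze_cvgr _ _ _ _ (fun=> 0) (fun y : R => K * `|y - x|)).
- by near=> y; rewrite normr_ge0 hK.
- exact: cvg_cst.
- rewrite -[X in _ --> X](mulr0 K); apply: cvgM; first exact: cvg_cst.
  have h0 : (`|y - x| @[y --> x] --> `|x - x|)%classic.
    by apply: cvg_norm; apply: cvgB; [exact: cvg_id|exact: cvg_cst].
  by rewrite subrr normr0 in h0.
Unshelve. all: by end_near. Qed.

Lemma lip_ccont (f : R -> R[i]) (K : R) :
  (forall x y, nc (f x - f y) <= K * `|x - y|) -> ccont setT f.
Proof.
move=> fK x _; split.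
  apply: (@lip_continuous _ K) => y z; rewrite (le_trans _ (fK y z)) //.
  by rewrite -ReN -ReD normr_Re_le_nc.
apply: (@lip_continuous _ K) => y z; rewrite (le_trans _ (fK y z)) //.
by rewrite -ImN -ImD normr_Im_le_nc.
Qed.

Lemma nc_vertical c (x y : R) : nc ((c +i* x) - (c +i* y)) = `|x - y|.
Proof.
by rewrite ncE ReD ImD ReN ImN /= subrr expr0n /= add0r sqrtr_sqr.
Qed.

Lemma cmeas_vertical (f : R[i] -> R[i]) c : hol [set t | c <= complex.Re t <= c] f ->
  cmeas setT (fun eta : R => f (c +i* eta)).
Proof.
move=> [K [f' [_ _ _ h _]]]; apply/ccont_cmeas/(@lip_ccont _ K) => x y.
by rewrite -(nc_vertical c); apply: h; rewrite /= lexx.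
Qed.

Lemma cmeas_line_Gamma c : 0 < c -> cmeas setT (fun eta : R => line_Gamma (c +i* eta)).
Proof. by move=> c0; apply: cmeas_vertical; exact: hol_line_Gamma. Qed.

Definition rapid (f : R -> R[i]) := forall p, exists2 C : R, 0 <= C &
  forall eta, nc (f eta) * (1 + eta ^+ 2) ^+ p <= C.

Definition poly_growth (f : R -> R[i]) := exists (p : nat) (C : R), 0 <= C /\
  forall eta, nc (f eta) <= C * (1 + eta ^+ 2) ^+ p.

Lemma poly_growth_cst z : poly_growth (fun=> z).
Proof.
by exists 0%N, (nc z); split => [|eta]; [exact: nc_ge0|rewrite expr0 mulr1].
Qed.

Lemma poly_growthM f g : poly_growth f -> poly_growth g ->
  poly_growth (fun eta => f eta * g eta).
Proof.
move=> [p [C [C0 hC]]] [q [D [D0 hD]]]; exists (p + q)%N, (C * D); split.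
  exact: mulr_ge0.
move=> eta; rewrite Normc.normcM exprD.
have -> : C * D * ((1 + eta ^+ 2) ^+ p * (1 + eta ^+ 2) ^+ q) =
  (C * (1 + eta ^+ 2) ^+ p) * (D * (1 + eta ^+ 2) ^+ q) by ring.
by rewrite ler_pM ?nc_ge0.
Qed.

Lemma poly_growth_bounded (f : R -> R[i]) (C : R) : (forall eta, nc (f eta) <= C) ->
  poly_growth f.
Proof.
move=> h; exists 0%N, C; split; first exact: le_trans (nc_ge0 _) (h 0).
by move=> eta; rewrite expr0 mulr1.
Qed.

Lemma poly_growth_vertical c (a : R[i]) : poly_growth (fun eta => (c +i* eta) - a).
Proof.
exists 1%N, (1 + nc (c%:C - a)); split; first by rewrite addr_ge0 ?nc_ge0.
move=> eta; rewrite expr1.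
have -> : (c +i* eta) - a = (c%:C - a) + (0 +i* 1) * eta%:C.
  by apply: eqc; rewrite !(ReD, ImD, ReM, ImM) /=; ring.
rewrite (le_trans (ncD _ _)) // Normc.normcM nc_i nc_real mul1r.
have := nc_ge0 (c%:C - a); have := sqr_ge0 (`|eta| - 1); rewrite sqrrB real_normK ?num_real //.
have := sqr_ge0 eta; nra.
Qed.

Lemma poly_growth_prod (I : Type) (r : seq I) (F : I -> R -> R[i]) :
  (forall i, poly_growth (F i)) -> poly_growth (fun eta => \prod_(i <- r) F i eta).
Proof.
move=> h; elim: r => [|i r IH].
  by under eq_fun do rewrite big_nil; exact: poly_growth_cst.
by under eq_fun do rewrite big_cons; exact: poly_growthM.
Qed.

Lemma rapidM f g : rapid f -> poly_growth g -> rapid (fun eta => f eta * g eta).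
Proof.
move=> rf [q [D [D0 hD]]] p; have [C C0 hC] := rf (p + q)%N.
exists (C * D); first exact: mulr_ge0.
move=> eta; rewrite Normc.normcM.
have e0 : 0 <= (1 + eta ^+ 2) ^+ p by rewrite exprn_ge0 // addr_ge0 ?sqr_ge0.
apply: (@le_trans _ _ (nc (f eta) * (D * (1 + eta ^+ 2) ^+ q) * (1 + eta ^+ 2) ^+ p)).
  by rewrite ler_wpM2r // ler_wpM2l ?nc_ge0.
have -> : nc (f eta) * (D * (1 + eta ^+ 2) ^+ q) * (1 + eta ^+ 2) ^+ p =
  (nc (f eta) * (1 + eta ^+ 2) ^+ (p + q)) * D by rewrite exprD; ring.
by rewrite ler_wpM2r.
Qed.

Lemma rapid_cauchy f : rapid f -> exists2 C : R, 0 <= C &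
  forall eta, nc (f eta) <= C * (1 + eta ^+ 2)^-1.
Proof.
move=> /(_ 1%N) [C C0 h]; exists C => // eta.
by rewrite ler_pdivlMr ?ltr_wpDr ?sqr_ge0 // -[X in _ * X]expr1.
Qed.

Lemma rapid_cint f : cmeas setT f -> rapid f -> cint setT f.
Proof.
move=> mf /rapid_cauchy [C C0 h].
apply: (cint_dom _ mf (rintZ C _ rint_cauchy)) => // u _; exact: h.
Qed.

(** Applying the functional equation 2 p times divides a function that is bounded on vertical lines
    by a Pochhammer symbol of modulus at least |s|^(2 p) = (c^2 + eta^2)^p. *)
Lemma rapid_line_Gamma c : 0 < c -> rapid (fun eta => line_Gamma (c +i* eta)).
Proof.
move=> c0 p; set G := 2 * complex.Re (line_Gamma (c + (p + p)%:R)%:C).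
exists (G * (1 + (c ^+ 2)^-1) ^+ p).
  rewrite mulr_ge0 ?exprn_ge0 ?addr_ge0 ?invr_ge0 ?sqr_ge0 //.
  apply: le_trans (nc_ge0 (line_Gamma (c + (p + p)%:R)%:C)) _.
  by apply: nc_line_Gamma_le => /=; rewrite ltr_wpDr.
move=> eta; set s : R[i] := c +i* eta.
have s0 : 0 < complex.Re s by [].
have hG : nc (line_Gamma (s + (p + p)%:R)) <= G.
  have := @nc_line_Gamma_le _ (s + (p + p)%:R).
  by rewrite ReD Re_nat /= => -> //; rewrite ltr_wpDr.
rewrite line_Gamma_shift // Normc.normcM in hG.
have hp : (c ^+ 2 + eta ^+ 2) ^+ p <= nc (pochhammer s (p + p)).
  have -> : (c ^+ 2 + eta ^+ 2) ^+ p = \prod_(i < p + p) nc s.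
    by rewrite prodr_const card_ord addnn -mul2n exprM nc_sqr.
  rewrite nc_prod; apply: ler_prod => i _; rewrite nc_ge0 andTb.
  rewrite -(@ler_pXn2r _ 2) ?nnegrE ?nc_ge0 // !nc_sqr ReD ImD Re_nat Im_nat addr0 /=.
  by rewrite lerD2r lerXn2r ?nnegrE ?addr_ge0 ?(ltW c0) // lerDl.
have c2 : 0 < c ^+ 2 by rewrite exprn_gt0.
have hq : (1 + eta ^+ 2) ^+ p <= (1 + (c ^+ 2)^-1) ^+ p * nc (pochhammer s (p + p)).
  apply: (@le_trans _ _ ((1 + (c ^+ 2)^-1) ^+ p * (c ^+ 2 + eta ^+ 2) ^+ p)); last first.
    by rewrite ler_wpM2l // exprn_ge0 // addr_ge0 // invr_ge0 ltW.
  rewrite -exprMn lerXn2r ?nnegrE ?mulr_ge0 ?addr_ge0 ?invr_ge0 ?sqr_ge0 //.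
  rewrite mulrDl mul1r mulrDr mulVf ?gt_eqF //.
  have : 0 <= (c ^+ 2)^-1 * eta ^+ 2 by rewrite mulr_ge0 ?invr_ge0 ?sqr_ge0.
  lra.
apply: (le_trans (ler_wpM2l (nc_ge0 _) hq)).
rewrite mulrCA mulrC ler_wpM2r ?exprn_ge0 ?addr_ge0 ?invr_ge0 ?sqr_ge0 //.
by rewrite mulrC.
Qed.

End vertical_lines.

(** * The inverse Mellin transform of Gamma *)

Section Cahen_Mellin.
Context {R : realType}.
Notation mu := (@lebesgue_measure R).
Implicit Types (c w : R).

Lemma cintegral_FTC_lim (D : set R) (f F : R -> R[i]) (a b : nat -> R) (A B : R[i]) :
  measurable D ->
  (forall n, a n < b n) -> (forall n, `[a n, b n] `<=` D) ->
  (forall x, D x -> \forall n \near \oo, a n <= x <= b n) ->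
  ccont setT f -> is_cderive F f -> cint D f ->
  ccvg (fun n => F (a n)) A -> ccvg (fun n => F (b n)) B ->
  cintegral D f = B - A.
Proof.
move=> mD ab abD Dab cf dF [f1 f2] [A1 A2] [B1 B2]; apply: eqc.
  rewrite ReD ReN.
  apply: (@Rintegral_FTC_lim _ D _ (fun u => complex.Re (F u)) a b) => //.
    by move=> y; have [] := cf y I.
  by move=> x; have [] := dF x.
rewrite ImD ImN.
apply: (@Rintegral_FTC_lim _ D _ (fun u => complex.Im (F u)) a b) => //.
  by move=> y; have [] := cf y I.
by move=> x; have [] := dF x.
Qed.

Lemma cintegral_real (D : set R) (h : R -> R) :
  cintegral D (fun u => (h u)%:C) = (\int[mu]_(u in D) h u)%:C.
Proof. by apply: eqc => //=; rewrite /Rintegral integral0. Qed.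

Lemma is_cderive_cexpl (l : R[i]) : is_cderive (fun u : R => cexp (l * u%:C))
  (fun u => l * cexp (l * u%:C)).
Proof.
apply: is_cderive_cexp => x; split.
  have -> : (fun u : R => complex.Re (l * u%:C)) = (fun u => complex.Re l * u).
    by apply/funext => u; rewrite ReM /= mulr0 subr0.
  by apply: is_derive_eq; rewrite /GRing.scale /=; ring.
have -> : (fun u : R => complex.Im (l * u%:C)) = (fun u => complex.Im l * u).
  by apply/funext => u; rewrite ImM /= mulr0 add0r.
by apply: is_derive_eq; rewrite /GRing.scale /=; ring.
Qed.

Lemma ccont_cexpl (l : R[i]) : ccont setT (fun u : R => cexp (l * u%:C)).
Proof.
apply: ccont_cexp; apply: ccontM; first exact: ccont_cst.
by apply: ccont_real => y _; exact: id.
Qed.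

Lemma expRN_cauchy_bound (e : R) : 0 < e -> exists2 C : R, 0 <= C &
  forall v : R, expR (- (e * `|v|)) <= C * (1 + v ^+ 2)^-1.
Proof.
move=> e0; exists (2 + 48 / e ^+ 4).
  by rewrite addr_ge0 // divr_ge0 // exprn_ge0 // ltW.
move=> v; have v0 : 1 <= 1 + v ^+ 2 by rewrite lerDl sqr_ge0.
have v1 : 0 < 1 + v ^+ 2 by rewrite (lt_le_trans ltr01).
rewrite ler_pdivlMr // (le_trans _ (expRN_sqr_bound v e0)) //.
by rewrite ler_wpM2l ?expR_ge0 // expr2 ler_peMr // ltW.
Qed.

Lemma continuous_expRN_abs (e : R) : continuous (fun v : R => expR (- (e * `|v|))).
Proof.
move=> v; apply: continuous_comp; last exact: continuous_expR.
apply: (@continuousN _ _ _ (fun v => e * `|v|)).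
by apply: continuousM; [exact: cst_continuous|exact: norm_continuous].
Qed.

Lemma rint_expRN_abs (e : R) : 0 < e -> rint setT (fun v : R => expR (- (e * `|v|))).
Proof.
move=> e0; have [C C0 h] := expRN_cauchy_bound e0.
apply: (@rint_expR_cauchy _ _ C).
  by apply: continuous_rmeas; exact: continuous_expRN_abs.
by move=> v; rewrite ger0_norm ?expR_ge0.
Qed.

Lemma cexpl_ccvg0 (l : R[i]) (s : R) : complex.Re l * s < 0 ->
  ccvg (fun n => cexp (l * (s * n.+1%:R)%:C)) 0.
Proof.
move=> ls; apply: ccvg_nc (@cvg_harmonic0 R ((- (complex.Re l * s))^-1)) _ => n.
rewrite subr0 nc_cexp ReM /= mulr0 subr0 mulrA.
set a := complex.Re l * s in ls *; rewrite -invfM -[a * _]opprK -mulNr expRN.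
have a0 : 0 < - a by lra.
rewrite lef_pV2 ?posrE ?expR_gt0 ?mulr_gt0 // ?ltr0n //.
by have := expR_ge1Dx (- a * n.+1%:R); lra.
Qed.

Lemma Poisson_transform (e x : R) : 0 < e ->
  cint setT (fun eta : R => (expR (- (e * `|eta|)))%:C * cexp ((0 +i* x) * eta%:C)) /\
  cintegral setT (fun eta : R => (expR (- (e * `|eta|)))%:C * cexp ((0 +i* x) * eta%:C)) =
  (2 * e / (e ^+ 2 + x ^+ 2))%:C.
Proof.
move=> e0; set f := (fun eta : R => _).
have cf : cint setT f.
  apply: (cint_dom _ _ (rint_expRN_abs e0)) => //.
    apply: ccont_cmeas; apply: ccontM; last exact: ccont_cexpl.
    by apply: ccont_real => y _; exact: continuous_expRN_abs.
  move=> u _; rewrite Normc.normcM nc_cexp nc_real ReM /= mul0r mulr0 subrr expR0 mulr1.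
  by rewrite ger0_norm ?expR_ge0.
split => //.
(* On each half-line the integrand is a pure exponential e^(l u), with l = l1 for u >= 0 and l = l2
   for u <= 0; the result is 1 / l2 - 1 / l1. *)
pose l1 : R[i] := (- e) +i* x; pose l2 : R[i] := e +i* x.
have l10 : l1 != 0 by apply/eqP => /(congr1 (@complex.Re R)) /= h; move: e0; rewrite -oppr_lt0 h ltxx.
have l20 : l2 != 0 by apply/eqP => /(congr1 (@complex.Re R)) /= h; move: e0; rewrite h ltxx.
have m1 : measurable (`[0, +oo[%classic : set R) by exact: measurable_itv.
have m2 : measurable (`]-oo, 0[%classic : set R) by exact: measurable_itv.
have m3 : measurable (`]-oo, 0]%classic : set R) by exact: measurable_itv.
have f1 u : `[0, +oo[%classic u -> f u = cexp (l1 * u%:C).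
  rewrite /= in_itv /= andbT => u0; rewrite /f ger0_norm // -cexp_real -cexpD.
  by congr cexp; apply: eqc; rewrite !(ReD, ImD, ReM, ImM) /=; ring.
have f2 u : `]-oo, 0]%classic u -> f u = cexp (l2 * u%:C).
  rewrite /= in_itv /= => u0; rewrite /f ler0_norm // -cexp_real -cexpD.
  by congr cexp; apply: eqc; rewrite !(ReD, ImD, ReM, ImM) /=; ring.
have dF (l : R[i]) : l != 0 -> is_cderive (fun u : R => l^-1 * cexp (l * u%:C)) (fun u => cexp (l * u%:C)).
  move=> l0 u; have := is_cderiveZ l^-1 (is_cderive_cexpl l) u.
  by rewrite mulrA mulVf // mul1r.
have I1 : cintegral `[0, +oo[ f = - l1^-1.
  rewrite (eq_cintegral f1).
  rewrite -sub0r; apply: (@cintegral_FTC_lim _ _ (fun u => l1^-1 * cexp (l1 * u%:C)) (fun=> 0)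
    (fun n => n.+1%:R)).
  - exact: measurable_itv.
  - by move=> n; rewrite ltr0n.
  - by move=> n x0 /=; rewrite !in_itv /= andbT => /andP[].
  - move=> x0 /=; rewrite in_itv /= andbT => x00; have := near_natr_segment x0.
    by apply: filterS => n /andP[_ ->]; rewrite x00.
  - exact: ccont_cexpl.
  - exact: dF.
  - by apply: cint_eq (cint_sub _ _ _ cf).
  - by apply: ccvg_ext (ccvg_cst _) => n; rewrite mulr0 cexp0 mulr1.
  - rewrite -[X in ccvg _ X](mulr0 l1^-1); apply: ccvgM; first exact: ccvg_cst.
    have h : complex.Re l1 * 1 < 0 by rewrite /= mulr1; lra.
    by apply: ccvg_ext (cexpl_ccvg0 h) => n; rewrite mul1r.
have I2 : cintegral `]-oo, 0] f = l2^-1.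
  rewrite (eq_cintegral f2).
  rewrite (@cintegral_FTC_lim _ _ (fun u => l2^-1 * cexp (l2 * u%:C)) (fun n => - n.+1%:R) (fun=> 0)
    0 l2^-1) ?subr0 //.
  - by move=> n x0 /=; rewrite !in_itv /= => /andP[].
  - move=> x0 /=; rewrite in_itv /= => x00; have := near_natr_segment x0.
    by apply: filterS => n /andP[-> _]; rewrite x00.
  - exact: ccont_cexpl.
  - exact: dF.
  - by apply: cint_eq (cint_sub _ _ _ cf).
  - rewrite -[X in ccvg _ X](mulr0 l2^-1); apply: ccvgM; first exact: ccvg_cst.
    have h : complex.Re l2 * -1 < 0 by rewrite /= mulrN1; lra.
    by apply: ccvg_ext (cexpl_ccvg0 h) => n; rewrite mulN1r.
  - by apply: ccvg_ext (ccvg_cst _) => n; rewrite mulr0 cexp0 mulr1.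
have split_int (h : R -> R) : rint setT h ->
    \int[mu]_u h u = \int[mu]_(u in `[0, +oo[) h u + \int[mu]_(u in `]-oo, 0]) h u.
  move=> ih; have TE : [set: R] = `[0, +oo[%classic `|` `]-oo, 0[%classic.
    by apply/seteqP; split => // u _ /=; rewrite !in_itv /= andbT; have [|] := leP 0 u; [left|right].
  rewrite {1}TE Rintegral_setU // ?Rintegral_itv_bndo_bndc //.
  - exact: (rint_sub m2 measurableT (@subsetT _ _) ih).
  - by rewrite -TE.
  - apply/disj_setPS => u [/=]; rewrite !in_itv /= andbT => h1 h2.
    by move: (le_lt_trans h1 h2); rewrite ltxx.
have -> : cintegral setT f = cintegral `[0, +oo[ f + cintegral `]-oo, 0] f.
  apply: eqc; first by rewrite ReD; apply: split_int; exact: cf.1.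
  by rewrite ImD; apply: split_int; exact: cf.2.
rewrite I1 I2.
have ex : e ^+ 2 + x ^+ 2 != 0 by rewrite gt_eqF // ltr_pwDl ?sqr_ge0 ?exprn_gt0.
by apply: eqc; rewrite !(ReD, ImD, ReN, ImN, ReV, ImV, nc_sqr) /= ?sqrrN; field.
Qed.

(** The bound is uniform in x, so it dominates the integrand of [Cahen_Mellin_damped] for all e at
    once. *)
Lemma gumbel_shift_bound (c w x : R) : 0 < c ->
  expR (c * x - expR (w + x)) <= expR (- (c * w)) * expR ((c + 1) ^+ 2).
Proof.
move=> c0; have := @expR_gumbel_bound R c (w + x) c0.
have -> : c * x - expR (w + x) = - (c * w) + (c * (w + x) - expR (w + x)) by ring.
rewrite [expR (- (c * w) + _)]expRD => h; rewrite ler_wpM2l ?expR_ge0 // (le_trans h) //.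
rewrite ler_piMr ?expR_ge0 // -[leRHS]expR0 ler_expR oppr_le0 mulr_ge0 //.
by rewrite le_min ler01 (ltW c0).
Qed.

(* Damping with [exp (- e |eta|)], whose Fourier transform is the Poisson kernel,
   makes Fubini applicable; then [e] tends to [0]. *)
Lemma Cahen_Mellin_damped (c w e : R) : 0 < c -> 0 < e ->
  cintegral setT (fun eta : R => line_Gamma (c +i* eta) * cexp (- ((c +i* eta) * w%:C))
     * (expR (- (e * `|eta|)))%:C) =
  cintegral setT (fun r : R =>
    (expR (c * (e * r) - expR (w + e * r)) * (2 * (1 + r ^+ 2)^-1))%:C).
Proof.
move=> c0 e0.
pose F (z : R * R) : R[i] := gumbel (c +i* z.1) z.2 * cexp (- ((c +i* z.1) * w%:C))
     * (expR (- (e * `|z.1|)))%:C.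
have Re_c (eta : R) : complex.Re (- ((c +i* eta) * w%:C)) = - (c * w).
  by rewrite ReN ReM /= mulr0 subr0.
have mfst : cmeas setT (fun z : R * R => c +i* z.1 : R[i]).
  by split => /=; [exact: measurable_cst|exact: measurable_fst].
have msnd (h : R -> R) : measurable_fun setT h -> cmeas setT (fun z : R * R => (h z.2)%:C).
  by move=> mh; apply: cmeas_real; apply: measurableT_comp.
have mF : cmeas setT F.
  apply: cmeasM; first apply: cmeasM.
  - apply: cmeas_cexp; apply: cmeasB; last exact: (msnd _ (@measurable_expR R)).
    by apply: cmeasM => //; exact: (msnd _ (@measurable_id _ _ _)).
  - by apply: cmeas_cexp; apply: cmeasN; apply: cmeasM => //; exact: cmeas_cst.
  - apply: cmeas_real; apply: (@measurableT_comp _ _ _ _ _ _ (fun v : R => expR (- (e * `|v|)))) => //.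
    by apply: continuous_rmeas; exact: continuous_expRN_abs.
have FE : cintegral setT (fun eta => cintegral setT (fun v => F (eta, v))) =
    cintegral setT (fun v => cintegral setT (fun eta => F (eta, v))).
  apply: (@cintegral_Fubini _ _ (fun eta => expR (- (c * w)) * expR (- (e * `|eta|)))
     (fun v => expR (c * v - expR v))) => //.
  - by apply: rintZ => //; exact: rint_expRN_abs.
  - exact: rint_gumbel.
  - move=> eta v; rewrite /F (Normc.normcM (_ * _)) (Normc.normcM (gumbel _ _)) nc_gumbel.
    rewrite nc_cexp Re_c nc_real (ger0_norm (expR_ge0 _)) /=.
    by rewrite le_eqVlt; apply/orP; left; apply/eqP; ring.
transitivity (cintegral setT (fun eta => cintegral setT (fun v => F (eta, v)))).
  apply: eq_cintegral => eta _; rewrite /F /= -mulrA.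
  under [RHS]eq_cintegral do rewrite -mulrA.
  by rewrite (cintegralZr _ measurableT (cint_gumbel (s := c +i* eta) c0)).
rewrite FE {FE mF}.
pose G (v : R) : R := expR (c * (v - w) - expR v) * (2 * e / (e ^+ 2 + (v - w) ^+ 2)).
transitivity (cintegral setT (fun v : R => (G v)%:C)).
  apply: eq_cintegral => v _.
  have [i1 I1] := Poisson_transform (v - w) e0.
  transitivity (cintegral setT (fun eta : R => (expR (c * (v - w) - expR v))%:C *
     ((expR (- (e * `|eta|)))%:C * cexp ((0 +i* (v - w)) * eta%:C)))).
    apply: eq_cintegral => eta _; rewrite /F /= /gumbel -cexpD mulrC [RHS]mulrCA.
    congr (_ * _); rewrite -[X in _ = X * _]cexp_real -cexpD; congr cexp.
    by apply: eqc; rewrite !(ReD, ImD, ReN, ImN, ReM, ImM) /=; ring.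
  by rewrite (cintegralZ _ measurableT i1) I1 -rmorphM.
have ew0 v : e ^+ 2 + (v - w) ^+ 2 != 0 by rewrite gt_eqF // ltr_pwDl ?sqr_ge0 ?exprn_gt0.
(* The substitution v = w + e r turns the Poisson kernel of width e into the fixed density 2 / (1 +
   r^2) and moves e into the exponential. *)
rewrite (@cintegral_subst_affine _ e w) //.
  apply: eq_cintegral => r _; rewrite -rmorphM; congr (_%:C); rewrite /G.
  have -> : w + e * r - w = e * r by ring.
  rewrite -!mulrA; congr (_ * _).
  have r0 : 1 + r ^+ 2 != 0 by rewrite gt_eqF // ltr_pwDl ?sqr_ge0.
  have -> : e ^+ 2 + (e * r) ^+ 2 = e ^+ 2 * (1 + r ^+ 2) by ring.
  by field; rewrite r0 gt_eqF.
apply: ccont_real => v _; apply: continuousM.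
  apply: continuous_comp; last exact: continuous_expR.
  apply: continuousB; last exact: continuous_expR.
  apply: continuousM; first exact: cst_continuous.
  by apply: continuousB; [exact: id|exact: cst_continuous].
apply: continuousM; first exact: cst_continuous.
apply: (@cvgV _ _ _ _ (fun v : R => e ^+ 2 + (v - w) ^+ 2)); first exact: ew0.
apply: cvgD; first exact: cvg_cst.
rewrite expr2; under eq_fun do rewrite expr2.
by apply: cvgM; apply: cvgB; [exact: cvg_id|exact: cvg_cst|exact: cvg_id|exact: cvg_cst].
Qed.

Lemma cvg_expR (u : nat -> R) (l : R) : u @ \oo --> l ->
  (expR (u n)) @[n --> \oo] --> expR l.
Proof. by move=> ul; apply: continuous_cvg => //; exact: continuous_expR. Qed.

(** Dominated convergence as e tends to 0 on both sides of [Cahen_Mellin_damped]: the rapid decay of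
    Gamma on the left, the density 2 / (1 + r^2), of mass 2 pi, on the right. *)
Lemma Cahen_Mellin c w : 0 < c ->
  cintegral setT (fun eta : R => line_Gamma (c +i* eta) * cexp (- ((c +i* eta) * w%:C))) =
  (2 * pi * expR (- expR w))%:C.
Proof.
move=> c0.
pose e n : R := 1 / n.+1%:R.
have e0 n : 0 < e n by rewrite divr_gt0.
have ecvg : e @ \oo --> (0 : R) := @cvg_harmonic0 R 1.
pose f (eta : R) := line_Gamma (c +i* eta) * cexp (- ((c +i* eta) * w%:C)).
have mf : cmeas setT f.
  apply: cmeasM; first exact: cmeas_line_Gamma.
  apply: cmeas_cexp; apply: cmeasN; apply: cmeasM; last exact: cmeas_cst.
  by split => /=; [exact: measurable_cst|exact: measurable_id].
have [C C0 hC] := rapid_cauchy (rapid_line_Gamma c0).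
have nf eta : nc (f eta) <= C * expR (- (c * w)) * (1 + eta ^+ 2)^-1.
  rewrite Normc.normcM nc_cexp ReN ReM /= mulr0 subr0 mulrAC.
  by rewrite ler_wpM2r ?expR_ge0.
pose g n (eta : R) := f eta * (expR (- (e n * `|eta|)))%:C.
have mg n : cmeas setT (g n).
  apply: cmeasM => //; apply: cmeas_real; apply: continuous_rmeas.
  exact: continuous_expRN_abs.
have cg eta : setT eta -> ccvg (g ^~ eta) (f eta).
  move=> _; rewrite -[X in ccvg _ X]mulr1; apply: ccvgM; first exact: ccvg_cst.
  split => /=; last exact: cvg_cst.
  rewrite -[X in _ --> X](@expR0 R); apply: cvg_expR.
  by rewrite -oppr0 -(mul0r `|eta|); apply: cvgN; apply: cvgM => //; exact: cvg_cst.
have ng n eta : setT eta -> nc (g n eta) <= C * expR (- (c * w)) * (1 + eta ^+ 2)^-1.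
  move=> _; rewrite Normc.normcM nc_real ger0_norm ?expR_ge0 // (le_trans _ (nf eta)) //.
  rewrite ler_piMr ?nc_ge0 // -[leRHS]expR0 ler_expR oppr_le0 mulr_ge0 // ltW //; exact: e0.
have [_ L1] := cintegral_dct measurableT mg cg (rintZ _ measurableT rint_cauchy) ng.
pose k n (r : R) : R[i] :=
  (expR (c * (e n * r) - expR (w + e n * r)) * (2 * (1 + r ^+ 2)^-1))%:C.
have mk n : cmeas setT (k n).
  apply: cmeas_real; apply: measurable_funM; last first.
    by apply: measurable_funM => //; exact: rint_meas rint_cauchy.
  have me : measurable_fun setT (fun r : R => e n * r) by apply: measurable_funM.
  apply: measurableT_comp => //; apply: measurable_funB; first exact: measurable_funM.
  by apply: measurableT_comp => //; exact: measurable_funD.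
have ck r : setT r -> ccvg (k ^~ r) (expR (- expR w) * (2 * (1 + r ^+ 2)^-1))%:C.
  move=> _; split => /=; last exact: cvg_cst.
  apply: cvgM; last exact: cvg_cst.
  have er : (e n * r) @[n --> \oo] --> (0 : R).
    by rewrite -(mul0r r); apply: cvgM => //; exact: cvg_cst.
  apply: cvg_expR; rewrite -sub0r -{1}(mulr0 c); apply: cvgB; first by apply: cvgM => //; exact: cvg_cst.
  apply: cvg_expR.
  by rewrite -[X in _ --> X]addr0; apply: cvgD => //; exact: cvg_cst.
have nk n r : setT r ->
    nc (k n r) <= expR (- (c * w)) * expR ((c + 1) ^+ 2) * 2 * (1 + r ^+ 2)^-1.
  move=> _; have r0 : 0 <= (1 + r ^+ 2)^-1 by rewrite invr_ge0 addr_ge0 // sqr_ge0.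
  rewrite nc_real ger0_norm ?mulr_ge0 ?expR_ge0 // -mulrA ler_wpM2r ?mulr_ge0 //.
  exact: gumbel_shift_bound.
have [_ L2] := cintegral_dct measurableT mk ck (rintZ _ measurableT rint_cauchy) nk.
have L3 : ccvg (fun n => cintegral setT (fun eta => f eta * (expR (- (e n * `|eta|)))%:C))
    (cintegral setT (fun r : R => (expR (- expR w) * (2 * (1 + r ^+ 2)^-1))%:C)).
  by apply: ccvg_ext L2 => n; rewrite Cahen_Mellin_damped.
rewrite (ccvg_unique L1 L3) cintegral_real; congr (_%:C).
rewrite RintegralZl //; last by apply: rintZ => //; exact: rint_cauchy.
by rewrite RintegralZl ?Rintegral_cauchy //; [rewrite mulrC|exact: rint_cauchy].
Qed.

End Cahen_Mellin.

(** * Mellin-Barnes integrals and the Bessel functions K *)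

Section bessel_K.
Context {R : realType}.
Implicit Types (c w : R) (k : nat).
Local Notation mu := (@lebesgue_measure R).
Local Arguments nc : simpl never.
Local Arguments cexp : simpl never.

(** [fine] sends both infinities to 0, so positive constants leave real-valued integrals of
    nonnegative functions, finite or not. *)
Lemma fine_pmull (a : R) (z : \bar R) : 0 < a -> a * fine z = fine (a%:E * z).
Proof.
move=> a0; case: z => [r||] //.
  by rewrite mulry gtr0_sg // mul1e /= mulr0.
by rewrite mulrNy gtr0_sg // mul1e /= mulr0.
Qed.

Lemma Rintegral_symmetrize (G : R -> R) : continuous G -> (forall u, 0 <= G u) ->
  \int[mu]_u G u = 2 * \int[mu]_(u in `[0, +oo[) ((G u + G (- u)) / 2).
Proof.
move=> cG G0.
have cN : continuous (fun u => G (- u)).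
  by move=> u; apply: continuous_comp; [exact: continuousN|exact: cG].
pose S u := (G u + G (- u)) / 2.
have cS : continuous S.
  move=> u; apply: (@continuousM _ _ (fun u => G u + G (- u)) (fun=> 2^-1) u).
    by apply: continuousD; [exact: cG|exact: cN].
  exact: cst_continuous.
have S0 u : 0 <= S u by rewrite divr_ge0 // addr_ge0.
have h : (\int[mu]_u (G u)%:E = 2%:E * \int[mu]_(u in `[0%R, +oo[) (S u)%:E)%E.
  have -> : (\int[mu]_u (G u)%:E = \int[mu]_u (S u)%:E)%E.
    transitivity (\int[mu]_u ((G u / 2)%:E + (G (- u) / 2)%:E))%E; last first.
      by apply: eq_integral => u _; rewrite -EFinD -mulrDl.
    have m2 (H : R -> R) : continuous H -> measurable_fun setT (fun u => (H u / 2)%:E).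
      move=> cH; apply/measurable_EFinP; apply: continuous_rmeas => u.
      by apply: (@continuousM _ _ H (fun=> 2^-1) u); [exact: cH|exact: cst_continuous].
    rewrite ge0_integralD //.
    - have c2 : continuous (fun u => G u / 2).
        by move=> u; apply: (@continuousM _ _ G (fun=> 2^-1) u); [exact: cG|exact: cst_continuous].
      rewrite -(Rintegral_reflection c2) -ge0_integralD //.
      + by apply: eq_integral => u _; rewrite -EFinD; congr EFin; field.
      + by move=> u _; rewrite lee_fin divr_ge0.
      + exact: m2.
      + by move=> u _; rewrite lee_fin divr_ge0.
      + exact: m2.
    - by move=> u _; rewrite lee_fin divr_ge0.
    - exact: m2.
    - by move=> u _; rewrite lee_fin divr_ge0.
    - by apply: (m2 (fun u => G (- u))).
  rewrite ge0_symfun_integralT //.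
    by rewrite set_itvcy.
  by move=> u; rewrite /S /= opprK addrC.
by rewrite /Rintegral h fine_pmull.
Qed.

Lemma ge0_RintegralZ D (a : R) (f : R -> R) : measurable D -> continuous f ->
  (forall u, 0 <= f u) -> 0 < a -> \int[mu]_(u in D) (a * f u) = a * \int[mu]_(u in D) f u.
Proof.
move=> mD cf f0 a0; rewrite /Rintegral fine_pmull // -ge0_integralZl //.
- by apply/measurable_EFinP; apply: measurable_funTS; exact: continuous_rmeas cf.
- by move=> u _; rewrite lee_fin.
- by rewrite lee_fin ltW.
Qed.

(** The shift v = w / 2 + u balances e^v and e^(w - v) into 2 e^(w / 2) cosh u; symmetrising in u
    then replaces e^(k u) by cosh (k u) on the half-line. *)
Lemma besselK_line k w :
  cintegral setT (fun v : R => (expR (k%:R * v - expR v - expR (w - v)))%:C) =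
  (2 * expR (k%:R * (w / 2)) * besselK k (2 * expR (w / 2)))%:C.
Proof.
pose G (u : R) := expR (k%:R * u - expR (w / 2) * (expR u + expR (- u))).
have cG : continuous G.
  move=> u; apply: continuous_comp; last exact: continuous_expR.
  apply: continuousB; first by apply: continuousM; [exact: cst_continuous|exact: id].
  apply: continuousM; first exact: cst_continuous.
  apply: continuousD; first exact: continuous_expR.
  by apply: continuous_comp; [exact: continuousN|exact: continuous_expR].
transitivity (cintegral setT (fun u : R => (expR (k%:R * (w / 2)))%:C * (G u)%:C)).
  rewrite (@cintegral_subst_affine _ 1 (w / 2)) //; last first.
    apply: ccont_real => v _; apply: continuous_comp; last exact: continuous_expR.
    apply: continuousB.
      apply: continuousB; last exact: continuous_expR.
      by apply: continuousM; [exact: cst_continuous|exact: id].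
    apply: continuous_comp; last exact: continuous_expR.
    by apply: continuousB; [exact: cst_continuous|exact: id].
  apply: eq_cintegral => u _; rewrite -!rmorphM mulr1 mul1r -expRD; congr (expR _)%:C.
  have -> : w - (w / 2 + u) = w / 2 - u by field.
  by rewrite !expRD mulrDr; ring.
under eq_cintegral do rewrite -rmorphM.
rewrite cintegral_real; congr (_%:C).
have cE : continuous (fun u => expR (k%:R * (w / 2)) * G u).
  by move=> u; apply: (@continuousM _ _ (fun=> _) G u); [exact: cst_continuous|exact: cG].
rewrite (Rintegral_symmetrize cE) => [|u]; last by rewrite mulr_ge0 ?expR_ge0.
rewrite -mulrA; congr (_ * _); rewrite /besselK.
have E0 : 0 < expR (k%:R * (w / 2)) by exact: expR_gt0.
pose H (u : R) := expR (- (2 * expR (w / 2)) * ((expR u + expR (- u)) / 2)) *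
  ((expR (k%:R * u) + expR (- (k%:R * u))) / 2).
have HE u : expR (k%:R * (w / 2)) * ((G u + G (- u)) / 2) = (expR (k%:R * (w / 2)) * G u +
  expR (k%:R * (w / 2)) * G (- u)) / 2 by ring.
have GH u : (G u + G (- u)) / 2 = H u.
  rewrite /G /H opprK mulrN [expR (- u) + _]addrC !expRD.
  have -> : - (2 * expR (w / 2)) * ((expR u + expR (- u)) / 2) =
    - (expR (w / 2) * (expR u + expR (- u))) by field.
  by ring.
have cH : continuous H.
  have cGN : continuous (fun u => G (- u)).
    by move=> u; apply: continuous_comp; [exact: continuousN|exact: cG].
  move=> u; apply: (for_continuous_ext GH).
  apply: (@continuousM _ _ (fun u => G u + G (- u)) (fun=> 2^-1) u); last exact: cst_continuous.
  by apply: continuousD; [exact: cG|exact: cGN].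
have H0 u : 0 <= H u by rewrite -GH divr_ge0 // addr_ge0 ?expR_ge0.
rewrite -[RHS]ge0_RintegralZ //; apply: eq_Rintegral => u _.
by rewrite -HE GH.
Qed.

(* Here [w = ln z]. *)
Lemma besselK_Mellin_Barnes k c w : 0 < c ->
  cintegral setT (fun eta : R => line_Gamma (c +i* eta) * line_Gamma (c +i* eta + k%:R) *
     cexp (- ((c +i* eta) * w%:C))) =
  (4 * pi * expR (k%:R * (w / 2)) * besselK k (2 * expR (w / 2)))%:C.
Proof.
move=> c0.
(* Only the second Gamma is written as an integral: the first supplies the decay in eta that Fubini
   requires, and its eta-integral is [Cahen_Mellin] at w - v. *)
pose F (z : R * R) : R[i] := line_Gamma (c +i* z.1) * gumbel (c +i* z.1 + k%:R) z.2 *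
  cexp (- ((c +i* z.1) * w%:C)).
have ck : 0 < c + k%:R by rewrite ltr_wpDr.
have Re_ck (eta : R) : complex.Re ((c +i* eta) + k%:R) = c + k%:R by rewrite ReD Re_nat.
have Re_cw (eta : R) : complex.Re (- ((c +i* eta) * w%:C)) = - (c * w).
  by rewrite ReN ReM /= mulr0 subr0.
have mfst : cmeas setT (fun z : R * R => c +i* z.1 : R[i]).
  by split => /=; [exact: measurable_cst|exact: measurable_fst].
have msnd (h : R -> R) : measurable_fun setT h -> cmeas setT (fun z : R * R => (h z.2)%:C).
  by move=> mh; apply: cmeas_real; apply: measurableT_comp.
have mF : cmeas setT F.
  apply: cmeasM; first apply: cmeasM.
  - have [m1 m2] := cmeas_line_Gamma c0; split.
      exact: (measurableT_comp m1 (@measurable_fst _ _ _ _)).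
    exact: (measurableT_comp m2 (@measurable_fst _ _ _ _)).
  - apply: cmeas_cexp; apply: cmeasB; last exact: (msnd _ (@measurable_expR R)).
    apply: cmeasM; last exact: (msnd _ (@measurable_id _ _ _)).
    by apply: cmeasD => //; exact: cmeas_cst.
  - by apply: cmeas_cexp; apply: cmeasN; apply: cmeasM => //; exact: cmeas_cst.
have iG : rint setT (fun eta : R => nc (line_Gamma (c +i* eta))).
  apply: rint_nc => //; apply: rapid_cint; first exact: cmeas_line_Gamma.
  exact: rapid_line_Gamma.
have FE : cintegral setT (fun eta => cintegral setT (fun v => F (eta, v))) =
    cintegral setT (fun v => cintegral setT (fun eta => F (eta, v))).
  apply: (@cintegral_Fubini _ _ (fun eta => expR (- (c * w)) * nc (line_Gamma (c +i* eta)))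
     (fun v => expR ((c + k%:R) * v - expR v))) => //.
  - by apply: rintZ.
  - exact: rint_gumbel.
  - move=> eta v; rewrite /F (Normc.normcM (_ * _)) (Normc.normcM (line_Gamma _)) nc_gumbel.
    rewrite nc_cexp Re_cw Re_ck.
    by rewrite le_eqVlt; apply/orP; left; apply/eqP; rewrite /=; ring.
transitivity (cintegral setT (fun eta => cintegral setT (fun v => F (eta, v)))).
  apply: eq_cintegral => eta _; rewrite /F /= mulrAC.
  under [RHS]eq_cintegral do rewrite mulrAC.
  have ic : cint setT (gumbel (c +i* eta + k%:R)) by apply: cint_gumbel; rewrite Re_ck.
  by rewrite (cintegralZ _ measurableT ic).
rewrite FE {FE mF}.
transitivity (cintegral setT (fun v : R =>
    (2 * pi)%:C * (expR (k%:R * v - expR v - expR (w - v)))%:C)).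
  apply: eq_cintegral => v _.
  have CM := @Cahen_Mellin R c (w - v) c0.
  transitivity (cintegral setT (fun eta : R => (expR (k%:R * v - expR v))%:C *
     (line_Gamma (c +i* eta) * cexp (- ((c +i* eta) * (w - v)%:C))))).
    apply: eq_cintegral => eta _; rewrite /F /= /gumbel -mulrA [RHS]mulrCA.
    congr (_ * _); rewrite -[X in _ = X * _]cexp_real -!cexpD; congr cexp.
    by apply: eqc; rewrite !(ReD, ImD, ReN, ImN, ReM, ImM, Re_nat, Im_nat) /=; ring.
  have ic : cint setT (fun eta : R => line_Gamma (c +i* eta) *
      cexp (- ((c +i* eta) * (w - v)%:C))).
    have rG := rapid_line_Gamma c0.
    apply: rapid_cint.
      apply: cmeasM; first exact: cmeas_line_Gamma.
      apply: cmeas_cexp; apply: cmeasN; apply: cmeasM; last exact: cmeas_cst.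
      by split => /=; [exact: measurable_cst|exact: measurable_id].
    apply: rapidM rG _; apply: (@poly_growth_bounded _ _ (expR (- (c * (w - v))))) => eta.
    by rewrite nc_cexp ReN ReM /= mulr0 subr0.
  by rewrite (cintegralZ _ measurableT ic) CM -!rmorphM [expR (_ - expR (w - v))]expRD; congr (_%:C); ring.
under eq_cintegral do rewrite -rmorphM.
rewrite cintegral_real ge0_RintegralZ //.
- have := besselK_line k w; rewrite cintegral_real => /(congr1 (fun z => complex.Re z)) /= ->.
  by congr (_%:C); ring.
- move=> v; apply: continuous_comp; last exact: continuous_expR.
  apply: continuousB.
    apply: continuousB; last exact: continuous_expR.
    by apply: continuousM; [exact: cst_continuous|exact: id].
  apply: continuous_comp; last exact: continuous_expR.
  by apply: continuousB; [exact: cst_continuous|exact: id].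
- by rewrite mulr_gt0 ?pi_gt0.

Qed.

End bessel_K.

(** * Cauchy's theorem and residues along piecewise C1 contours *)

Section curves.
Context {R : realType}.
Implicit Types (a b L M : R) (g dg f : R -> R[i]).
Local Notation mu := (@lebesgue_measure R).
Local Arguments nc : simpl never.

Lemma mem_seg a b (u : R) : (`[a, b]%classic : set R) u <-> a <= u <= b.
Proof. by rewrite /= in_itv. Qed.

Lemma rint_seg a b M : rint `[a, b] (fun=> M).
Proof.
apply: (@continuous_compact_integrable R (fun=> M)); first exact: segment_compact.
by apply: continuous_subspaceT => x; exact: cst_continuous.
Qed.

Lemma cint_seg a b M f : cmeas `[a, b] f -> (forall u, a <= u <= b -> nc (f u) <= M) ->
  cint `[a, b] f.
Proof. by move=> mf fM; apply: (cint_dom _ mf (rint_seg a b M)) => // u /mem_seg /fM. Qed.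

Lemma nc_cintegral_seg a b M f : a <= b -> cmeas `[a, b] f ->
  (forall u, a <= u <= b -> nc (f u) <= M) -> nc (cintegral `[a, b] f) <= 2 * (M * (b - a)).
Proof.
move=> ab mf fM.
apply: (le_trans (nc_cintegral_le _ mf (rint_seg a b M) _)) => //.
rewrite (@Rintegral_cst _ _ _ mu) //.
have -> : fine (mu `[a, b]) = b - a.
  have := @lebesgue_measure_itv R `[a, b] => ->; rewrite /= lte_fin; case: ifPn => [_ //|].
  rewrite -leNgt => ba; have -> : b = a by apply/eqP; rewrite eq_le ab ba.
  by rewrite subrr.
by [].
Qed.

Lemma cintegral_seg_split a x b f : a <= x -> x <= b -> cint `[a, b] f ->
  cintegral `[a, b] f = cintegral `[a, x] f + cintegral `[x, b] f.
Proof.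
move=> ax xb [f1 f2].
have h (k : R -> R) : rint `[a, b] k ->
    \int[mu]_(u in `[a, b]) k u = \int[mu]_(u in `[a, x]) k u + \int[mu]_(u in `[x, b]) k u.
  move=> ik; apply/eqP; rewrite addrC -subr_eq; apply/eqP.
  rewrite Rintegral_itvB ?bnd_simp // Rintegral_itv_obnd_cbnd //.
  apply: integrableS ik => // u /=; rewrite !in_itv /= => /andP[xu ->].
  by rewrite andbT (le_trans ax) // ltW.
by apply: eqc; rewrite ?ReD ?ImD /=; exact: h.
Qed.

(** The velocity enters through its integrals only, so corners and conventional values of
    derivatives at finitely many parameters do no harm, and pieces can be concatenated. *)
Definition curve a b g dg L :=
  [/\ 0 <= L, cmeas `[a, b] dg, forall u, a <= u <= b -> nc (dg u) <= L &
      forall u v, a <= u -> u <= v -> v <= b -> cintegral `[u, v] dg = g v - g u].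

Lemma cmeas_subseg a b u v f : a <= u -> v <= b -> cmeas `[a, b] f -> cmeas `[u, v] f.
Proof.
move=> au vb [f1 f2]; split; [apply: measurable_funS f1|apply: measurable_funS f2] => //;
  by apply: subset_itv; rewrite bnd_simp.
Qed.

Lemma curve_cat a b c g dg L M : a <= b -> b <= c ->
  curve a b g dg L -> curve b c g dg M -> curve a c g dg (L + M).
Proof.
move=> ab bc [L0 [m1 m2] nL iL] [M0 [k1 k2] nM iM].
have mac : cmeas `[a, c] dg.
  rewrite (@itv_bndbnd_setU _ _ (BLeft a) (BRight b) (BRight c)) ?bnd_simp //.
  by split; apply/measurable_funU => //; split => //; [apply: measurable_funS k1|apply: measurable_funS k2] => //;
    apply: subset_itv; rewrite bnd_simp.
have nLM u : a <= u <= c -> nc (dg u) <= L + M.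
  move=> /andP[au uc]; have [ub|bu] := leP u b.
    by apply: (le_trans (nL u _)); rewrite ?au ?ub // lerDl.
  by apply: (le_trans (nM u _)); rewrite ?uc ?(ltW bu) // lerDr.
split => //; first exact: addr_ge0.
move=> u v au uv vc.
have [vb|bv] := leP v b; first exact: iL.
have [ub|bu] := leP u b; last by apply: iM => //; exact: ltW.
rewrite (@cintegral_seg_split u b) ?(ltW bv) //.
  by rewrite iL // iM ?(ltW bv) //; ring.
apply: (@cint_seg _ _ (L + M)); first exact: cmeas_subseg mac.
by move=> w /andP[uw wv]; rewrite nLM // (le_trans au uw) (le_trans wv vc).
Qed.

Lemma curve_lip a b g dg L u v : curve a b g dg L -> a <= u -> u <= v -> v <= b ->
  nc (g v - g u) <= 2 * L * (v - u).
Proof.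
move=> [L0 m n i] au uv vb; rewrite -i // -mulrA; apply: nc_cintegral_seg => //.
  exact: cmeas_subseg m.
by move=> w /andP[uw wv]; rewrite n // (le_trans au uw) (le_trans wv vb).
Qed.

Lemma curve_dist a b g dg L u v : curve a b g dg L -> a <= u <= b -> a <= v <= b ->
  nc (g v - g u) <= 2 * L * `|v - u|.
Proof.
move=> c /andP[au ub] /andP[av vb]; have [uv|vu] := leP u v.
  by rewrite ger0_norm ?subr_ge0 //; exact: (curve_lip c).
by rewrite ncBC distrC gtr0_norm ?subr_gt0 //; apply: (curve_lip c) => //; exact: ltW.
Qed.

(** Composition with this retraction extends a function on [0, 1] to the line with the same
    Lipschitz constant, where continuity, extreme values and intermediate values apply. *)
Definition clamp (u : R) := Num.max 0 (Num.min 1 u).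

Lemma clampE u : 0 <= u <= 1 -> clamp u = u.
Proof. by move=> /andP[u0 u1]; rewrite /clamp min_r // max_r. Qed.

Lemma clamp_itv u : 0 <= clamp u <= 1.
Proof. by rewrite /clamp le_max lexx ge_max ler01 ge_min lexx. Qed.

Lemma clamp_lip u v : `|clamp u - clamp v| <= `|u - v|.
Proof.
wlog uv : u v / u <= v.
  by move=> h; have [/h //|/ltW /h] := leP u v; rewrite distrC (distrC v).
rewrite distrC (distrC u) (ger0_norm (_ : 0 <= v - u)) ?subr_ge0 // /clamp.
rewrite ler_norml /Num.max /Num.min.
by repeat case: ifPn; rewrite -?leNgt => *; apply/andP; split; lra.
Qed.

Lemma seg_lip_ccont f L : 0 <= L ->
  (forall u v, 0 <= u <= 1 -> 0 <= v <= 1 -> nc (f u - f v) <= L * `|u - v|) ->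
  ccont setT (fun u => f (clamp u)).
Proof.
move=> L0 fL; apply: (@lip_ccont _ _ L) => u v.
by rewrite (le_trans (fL _ _ (clamp_itv u) (clamp_itv v))) // ler_wpM2l // clamp_lip.
Qed.

Lemma seg_lip_cmeas f L : 0 <= L ->
  (forall u v, 0 <= u <= 1 -> 0 <= v <= 1 -> nc (f u - f v) <= L * `|u - v|) ->
  cmeas `[0 : R, 1] f.
Proof.
move=> L0 fL; apply: (@cmeas_eq _ _ _ _ (fun u => f (clamp u))).
  by move=> u; rewrite inE /= in_itv /= => /clampE ->.
exact/ccont_cmeas/(seg_lip_ccont L0 fL).
Qed.

(** Cutting [0, 1] into n + 1 equal pieces bounds the total increment by M / (n + 1). In this form
    constancy follows directly from the quadratic remainder in [holK]. *)
Lemma quadratic_increment_const f M :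
  (forall u v, 0 <= u -> u <= v -> v <= 1 -> nc (f v - f u) <= M * (v - u) ^+ 2) -> f 1 = f 0.
Proof.
move=> fM; apply/eqP; rewrite -subr_eq0 -nc_eq0 eq_le nc_ge0 andbT.
have bound n : nc (f 1 - f 0) <= M / n.+1%:R.
  have n0 : (0 : R) < n.+1%:R by rewrite ltr0n.
  have tel : f 1 - f 0 = \sum_(i < n.+1) (f (i.+1%:R / n.+1%:R) - f (i%:R / n.+1%:R)).
    have := @telescope_sumr _ 0%N n.+1 (fun i => f (i%:R / n.+1%:R)) (leq0n _).
    by rewrite big_mkord mul0r divff // gt_eqF.
  rewrite tel; apply: (le_trans (nc_sum _ _ _)).
  apply: (@le_trans _ _ (\sum_(i < n.+1) M * (n.+1%:R^-1) ^+ 2)).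
    apply: ler_sum => i _.
    have E : (n.+1%:R : R)^-1 = i.+1%:R / n.+1%:R - i%:R / n.+1%:R.
      by rewrite -mulrBl -[i.+1%:R]natr1 addrAC subrr add0r mul1r.
    rewrite [in leRHS]E; apply: fM.
    - by rewrite divr_ge0.
    - by rewrite ler_pM2r ?invr_gt0 // ler_nat.
    - by rewrite ler_pdivrMr // mul1r ler_nat.
  rewrite sumr_const card_ord -mulr_natl le_eqVlt; apply/orP; left; apply/eqP.
  by field; rewrite gt_eqF.
rewrite leNgt; apply/negP => d0.
have M0 : 0 < M.
  by have := lt_le_trans d0 (bound 0%N); rewrite divr1.
have [n hn] : exists n : nat, M / nc (f 1 - f 0) < n.+1%:R.
  exists (Num.trunc (M / nc (f 1 - f 0))).
  exact: truncnS_gt.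
have := bound n; rewrite leNgt ltr_pdivrMr ?ltr0n // mulrC -ltr_pdivrMr // hn //.
Qed.

(** The difference of h along the curve and of its presumed integral has quadratic increments: one
    part is the Taylor remainder of h, the other the variation of h' integrated over a short
    segment. *)
Lemma curve_FTC D K h h' g dg L : holK D K h h' -> curve 0 1 g dg L ->
  (forall u, 0 <= u <= 1 -> D (g u)) ->
  cint `[0 : R, 1] (fun u => h' (g u) * dg u) /\
  cintegral `[0 : R, 1] (fun u => h' (g u) * dg u) = h (g 1) - h (g 0).
Proof.
move=> hh cg gD; have [K0 h1 h2 h3 h4] := hh.
have [L0 m n i] := cg.
have lh' u v : 0 <= u <= 1 -> 0 <= v <= 1 ->
    nc (h' (g u) - h' (g v)) <= 4 * K * L * `|u - v|.
  move=> hu hv; rewrite (le_trans (holK_deriv_lip hh (gD v hv) (gD u hu))) //.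
  have -> : 4 * K * L * `|u - v| = 2 * K * (2 * L * `|u - v|) by ring.
  by rewrite ler_wpM2l ?mulr_ge0 //; exact: curve_dist cg _ _.
have mh' : cmeas `[0 : R, 1] (fun u => h' (g u)).
  by apply: seg_lip_cmeas lh'; rewrite !mulr_ge0.
have mf : cmeas `[0 : R, 1] (fun u => h' (g u) * dg u) by exact: cmeasM.
have nf u : 0 <= u <= 1 -> nc (h' (g u) * dg u) <= K * L.
  by move=> hu; rewrite Normc.normcM ler_pM ?nc_ge0 ?h2 ?n //; exact: gD.
have ci := cint_seg mf nf; split => //.
pose Psi u := h (g u) - cintegral `[0, u] (fun u => h' (g u) * dg u).
have : Psi 1 = Psi 0.
  apply: (@quadratic_increment_const _ (K * (2 * L) ^+ 2 + 8 * K * L * L)) => u v u0 uv v1.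
  have hu : 0 <= u <= 1 by rewrite u0 (le_trans uv v1).
  have hv : 0 <= v <= 1 by rewrite v1 (le_trans u0 uv).
  have ciuv : cint `[0, v] (fun u => h' (g u) * dg u).
    by apply: cint_sub ci => //; apply: subset_itv; rewrite bnd_simp.
  have ciuv' : cint `[u, v] (fun u => h' (g u) * dg u).
    by apply: cint_sub ci => //; apply: subset_itv; rewrite bnd_simp.
  have cid : cint `[u, v] dg.
    apply: (@cint_seg _ _ L); first exact: cmeas_subseg m.
    by move=> w /andP[uw wv]; rewrite n // (le_trans u0 uw) (le_trans wv v1).
  have E : Psi v - Psi u = (h (g v) - h (g u) - h' (g u) * (g v - g u)) -
      cintegral `[u, v] (fun w => (h' (g w) - h' (g u)) * dg w).
    rewrite /Psi (cintegral_seg_split u0 uv ciuv).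
    under [X in _ = _ - X]eq_cintegral do rewrite mulrBl.
    rewrite (cintegralB _ ciuv' (cintZ (h' (g u)) _ cid)) // (cintegralZ _ _ cid) //.
    by rewrite i //; ring.
  rewrite E (le_trans (ncB _ _)) // mulrDl lerD //.
    rewrite (le_trans (h4 _ _ (gD u hu) (gD v hv))) // -mulrA ler_wpM2l // -exprMn.
    by rewrite ler_pXn2r ?nnegrE ?nc_ge0 ?mulr_ge0 ?subr_ge0 //; exact: (curve_lip cg).
  have -> : 8 * K * L * L * (v - u) ^+ 2 = 2 * (4 * K * L * (v - u) * L * (v - u)) by ring.
  apply: nc_cintegral_seg => //.
    apply: cmeasM; last exact: cmeas_subseg m.
    by apply: cmeasB; [exact: cmeas_subseg mh'|exact: cmeas_cst].
  move=> w /andP[uw wv].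
  have hw : 0 <= w <= 1 by rewrite (le_trans u0 uw) (le_trans wv v1).
  rewrite Normc.normcM ler_pM ?nc_ge0 ?n // (le_trans (lh' w u hw hu)) //.
  by rewrite ler_wpM2l ?mulr_ge0 // ger0_norm ?subr_ge0 // lerD2r.
rewrite /Psi => /eqP; rewrite subr_eq => /eqP ->.
rewrite set_itv1 {2}/cintegral !Rintegral_set1 subr0; ring.
Qed.

Definition convex_set (D : set R[i]) :=
  forall z w (r : R), D z -> D w -> 0 <= r <= 1 -> D (z + r%:C * (w - z)).

Definition homothety (p : R[i]) g (r : R) (u : R) := p + r%:C * (g u - p).

Lemma curve_homothety a b g dg L p r : 0 <= r -> curve a b g dg L ->
  curve a b (homothety p g r) (fun u => r%:C * dg u) (r * L).
Proof.
move=> r0 [L0 m n i]; split.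
- exact: mulr_ge0.
- by apply: cmeasM => //; exact: cmeas_cst.
- by move=> u hu; rewrite Normc.normcM nc_real ger0_norm // ler_wpM2l // n.
- move=> u v au uv vb.
  have ci : cint `[u, v] dg.
    apply: (@cint_seg _ _ L); first exact: cmeas_subseg m.
    by move=> w /andP[uw wv]; rewrite n // (le_trans au uw) (le_trans wv vb).
  by rewrite (cintegralZ _ _ ci) // i // /homothety; ring.
Qed.

Lemma curve_cmeas g dg L : curve 0 1 g dg L -> cmeas `[0 : R, 1] g.
Proof.
move=> cg; have [L0 _ _ _] := cg; apply: (@seg_lip_cmeas _ (2 * L)); first by rewrite mulr_ge0.
by move=> u v hu hv; exact: (curve_dist cg).
Qed.

Lemma holK_curve_cmeas D K h h' g dg L : holK D K h h' -> curve 0 1 g dg L ->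
  (forall u, 0 <= u <= 1 -> D (g u)) -> cmeas `[0 : R, 1] (fun u => h (g u)).
Proof.
move=> [K0 h1 h2 h3 h4] cg gD; have [L0 _ _ _] := cg.
apply: (@seg_lip_cmeas _ (K * (2 * L))); first by rewrite !mulr_ge0.
move=> u v hu hv; rewrite (le_trans (h3 _ _ (gD v hv) (gD u hu))) // -mulrA ler_wpM2l //.
exact: (curve_dist cg).
Qed.

Lemma curve_bounded g dg L p : curve 0 1 g dg L ->
  exists B, forall u, 0 <= u <= 1 -> nc (g u - p) <= B.
Proof.
move=> cg; exists (nc (g 0 - p) + 2 * L) => u hu.
have -> : g u - p = (g 0 - p) + (g u - g 0) by ring.
rewrite (le_trans (ncD _ _)) // lerD2l (le_trans (curve_dist cg _ hu)) ?lexx ?ler01 //.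
have [L0 _ _ _] := cg; have /andP[u0 u1] := hu.
by rewrite subr0 ger0_norm // ler_piMr // mulr_ge0.
Qed.

(* Contracting the curve to [p], [r |-> \oint h (p + r (t - p)) / (t - p) dt] has
   derivative [\oint h' (p + r (t - p)) dt = 0], so it is constant. *)
Lemma Cauchy_formula D K h h' g dg L e p : holK D K h h' -> convex_set D -> D p ->
  curve 0 1 g dg L -> (forall u, 0 <= u <= 1 -> D (g u)) -> 0 < e ->
  (forall u, 0 <= u <= 1 -> e <= nc (g u - p)) -> g 0 = g 1 ->
  cintegral `[0 : R, 1] (fun u => h (g u) / (g u - p) * dg u) =
  h p * cintegral `[0 : R, 1] (fun u => (g u - p)^-1 * dg u).
Proof.
move=> hh cD Dp cg gD e0 ge g01; have [K0 h1 h2 h3 h4] := hh.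
have [L0 m n i] := cg; have [B gB] := curve_bounded p cg.
have B0 : 0 <= B by rewrite (le_trans (nc_ge0 _) (gB 0 _)) // lexx ler01.
have gp0 u : 0 <= u <= 1 -> g u - p != 0.
  by move=> /ge geu; rewrite -nc_gt0 (lt_le_trans e0).
have wD r u : 0 <= r <= 1 -> 0 <= u <= 1 -> D (homothety p g r u).
  by move=> hr hu; apply: cD => //; exact: gD.
have cw r : 0 <= r -> curve 0 1 (homothety p g r) (fun u => r%:C * dg u) (r * L).
  by move=> r0; exact: curve_homothety.
have mV : cmeas `[0 : R, 1] (fun u => (g u - p)^-1 * dg u).
  apply: cmeasM => //; apply: cmeasV; apply: cmeasB; first exact: curve_cmeas cg.
  exact: cmeas_cst.
have nV u : 0 <= u <= 1 -> nc ((g u - p)^-1 * dg u) <= e^-1 * L.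
  move=> hu; rewrite Normc.normcM Normc.normcV ler_pM ?invr_ge0 ?nc_ge0 ?n //.
  by rewrite lef_pV2 ?posrE ?ge // (lt_le_trans e0) // ge.
have ciV := cint_seg mV nV.
pose G r u := h (homothety p g r u) / (g u - p) * dg u.
pose H r := cintegral `[0 : R, 1] (G r).
have ciG r : 0 <= r <= 1 -> cint `[0 : R, 1] (G r).
  move=> hr; apply: (@cint_seg _ _ (K * (e^-1 * L))).
    apply: (@cmeas_eq _ _ _ _ (fun u => h (homothety p g r u) * ((g u - p)^-1 * dg u))).
      by move=> u _; rewrite /G mulrA.
    apply: cmeasM => //; apply: holK_curve_cmeas hh (cw r _) _; first by case/andP: hr.
    by move=> u; exact: wD.
  move=> u hu; rewrite /G -mulrA Normc.normcM ler_pM ?nc_ge0 ?nV ?h1 //.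
  exact: wD.
have closed0 r : 0 <= r <= 1 ->
    cint `[0 : R, 1] (fun u => h' (homothety p g r u) * dg u) /\
    cintegral `[0 : R, 1] (fun u => h' (homothety p g r u) * dg u) = 0.
  move=> hr; have /andP[r0 r1] := hr.
  have cid : cint `[0 : R, 1] dg by apply: (@cint_seg _ _ L).
  (* For r = 0 the homothetic curve is the point p and gives no information; the integrand is then
     h' p times the velocity, whose integral is 0 since the curve is closed. *)
  have [rz|rz] := eqVneq r 0.
    have E : (fun u => h' (homothety p g r u) * dg u) = (fun u => h' p * dg u).
      by apply/funext => u; rewrite /homothety rz mul0r addr0.
    rewrite E; split; first exact: cintZ.
    by rewrite (cintegralZ _ _ cid) // i // g01 subrr mulr0.
  have [c1 c2] := curve_FTC hh (cw r r0) (fun u hu => wD r u hr hu).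
  have rC : r%:C != 0 by rewrite -nc_eq0 nc_real normr_eq0.
  have E u : r%:C^-1 * (h' (homothety p g r u) * (r%:C * dg u)) = h' (homothety p g r u) * dg u.
    by rewrite mulrCA mulKf.
  split; first by apply: cint_eq (cintZ (r%:C^-1) _ c1) => // u _; exact: E.
  under eq_cintegral do rewrite -E.
  by rewrite (cintegralZ _ _ c1) // c2 /homothety g01 subrr mulr0.
have -> : h p * cintegral `[0 : R, 1] (fun u => (g u - p)^-1 * dg u) = H 0.
  rewrite -(cintegralZ _ _ ciV) //; apply: eq_cintegral => u _.
  by rewrite /G /homothety mul0r addr0 mulrA.
transitivity (H 1).
  by apply: eq_cintegral => u _; rewrite /G /homothety mul1r [p + _]addrC subrK.
apply: (@quadratic_increment_const _ (2 * (K * B ^+ 2 * (e^-1 * L)))) => u v u0 uv v1.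
have hu : 0 <= u <= 1 by rewrite u0 (le_trans uv v1).
have hv : 0 <= v <= 1 by rewrite v1 (le_trans u0 uv).
have [c1 c2] := closed0 u hu.
(* Subtracting v - u times the vanishing integral of [closed0] turns the increment of h into its
   Taylor remainder, which is quadratic in v - u. *)
have E : H v - H u = cintegral `[0 : R, 1] (fun x => (h (homothety p g v x) -
    h (homothety p g u x) - h' (homothety p g u x) * (homothety p g v x - homothety p g u x)) *
    ((g x - p)^-1 * dg x)).
  transitivity (H v - H u - (v - u)%:C *
      cintegral `[0 : R, 1] (fun x => h' (homothety p g u x) * dg x)).
    by rewrite c2 mulr0 subr0.
  rewrite /H -(cintegralB _ (ciG v hv) (ciG u hu)) //.
  rewrite -(cintegralZ _ _ c1) // -cintegralB //; last 2 first.
  - by apply: cintB => //; exact: ciG.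
  - exact: cintZ.
  apply: eq_cintegral => x /mem_seg hx; rewrite /G /homothety rmorphB /=.
  by field; exact: gp0.
rewrite E.
have -> : 2 * (K * B ^+ 2 * (e^-1 * L)) * (v - u) ^+ 2 =
    2 * (K * (B * (v - u)) ^+ 2 * (e^-1 * L) * (1 - 0)) by ring.
apply: nc_cintegral_seg => //.
  have mh r : 0 <= r <= 1 -> cmeas `[0 : R, 1] (fun x => h (homothety p g r x)).
    move=> hr; apply: holK_curve_cmeas hh (cw r _) _; first by case/andP: hr.
    by move=> x; exact: wD.
  apply: cmeasM => //; apply: cmeasB.
    by apply: cmeasB; exact: mh.
  rewrite /homothety.
  have mw r : cmeas `[0 : R, 1] (fun x => p + r%:C * (g x - p)).
    apply: cmeasD; first exact: cmeas_cst.
    apply: cmeasM; first exact: cmeas_cst.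
    by apply: cmeasB; [exact: curve_cmeas cg|exact: cmeas_cst].
  apply: cmeasM; last exact: cmeasB.
  have lh' x y : 0 <= x <= 1 -> 0 <= y <= 1 ->
      nc (h' (homothety p g u x) - h' (homothety p g u y)) <= 2 * K * (2 * (u * L)) * `|x - y|.
    move=> hx hy; rewrite (le_trans (holK_deriv_lip hh (wD u y hu hy) (wD u x hu hx))) //.
    by rewrite -[leRHS]mulrA ler_wpM2l ?mulr_ge0 //; exact: (curve_dist (cw u u0)).
  by apply: seg_lip_cmeas lh'; rewrite !mulr_ge0.
move=> x hx; rewrite Normc.normcM ler_pM ?nc_ge0 ?nV //.
rewrite (le_trans (h4 _ _ (wD u x hu hx) (wD v x hv hx))) // ler_wpM2l //.
have -> : homothety p g v x - homothety p g u x = (v - u)%:C * (g x - p).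
  by rewrite /homothety rmorphB /=; ring.
rewrite Normc.normcM nc_real ger0_norm ?subr_ge0 // mulrC.
by rewrite ler_pXn2r ?nnegrE ?mulr_ge0 ?nc_ge0 ?subr_ge0 // ler_wpM2r ?subr_ge0 // gB.
Qed.

(* Cauchy's theorem is the formula for [(t - p) h t], whose value at [p] is [0]. *)
Lemma Cauchy_closed D h g dg L e p : hol D h -> convex_set D -> D p ->
  (exists B, forall t, D t -> nc t <= B) ->
  curve 0 1 g dg L -> (forall u, 0 <= u <= 1 -> D (g u)) -> 0 < e ->
  (forall u, 0 <= u <= 1 -> e <= nc (g u - p)) -> g 0 = g 1 ->
  cintegral `[0 : R, 1] (fun u => h (g u) * dg u) = 0.
Proof.
move=> hh cD Dp [B hB] cg gD e0 ge g01.
have [K [k' kk]] : hol D (fun t => h t * (t - p)).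
  by apply: holM => //; apply: holD; [exact: hol_id hB|exact: hol_cst].
have := Cauchy_formula kk cD Dp cg gD e0 ge g01; rewrite subrr mulr0 mul0r => <-.
apply: eq_cintegral => u /mem_seg hu; rewrite mulfK // -nc_gt0 (lt_le_trans e0) //.
exact: ge.
Qed.

Lemma continuous_seg_bounded (f : R -> R) a b : a <= b -> continuous f ->
  exists M, forall u, a <= u <= b -> `|f u| <= M.
Proof.
move=> ab cf; have cn : continuous (fun u => `|f u|).
  by move=> u; apply: continuous_comp; [exact: cf|exact: norm_continuous].
have [v _ hv] := EVT_max ab (continuous_subspaceT cn).
by exists `|f v| => u hu; apply: hv; rewrite in_itv.
Qed.

Lemma C1_is_derive (f : R -> R) : C1 f -> forall x : R, is_derive x 1 f (derive1 f x).
Proof. by move=> [df _] x; split; [exact: df|rewrite derive1E]. Qed.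

Lemma C1_FTC (f : R -> R) a b : C1 f -> a <= b ->
  \int[mu]_(x in `[a, b]) (derive1 f x) = f b - f a.
Proof.
move=> cf; rewrite le_eqVlt => /predU1P[->|ab].
  by rewrite set_itv1 Rintegral_set1 subrr.
by have [_ c] := cf; rewrite /Rintegral (FTC_segment ab c (C1_is_derive cf)).
Qed.

Lemma cderive_near g f a b u : (forall u, a <= u <= b -> g u = f u) -> a < u < b ->
  cderive g u = cderive f u.
Proof.
move=> gf /andP[au ub].
have gfn : \forall v \near u, g v = f v.
  have : \forall v \near u, v \in `]a, b[ by apply: near_in_itvoo; rewrite in_itv /= au ub.
  by apply: filterS => v; rewrite in_itv /= => /andP[av vb]; apply: gf; rewrite !ltW.
rewrite /cderive !derive1E; congr (_ +i* _); apply: near_eq_derive.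
  by apply: filterS gfn => v ->.
by apply: filterS gfn => v ->.
Qed.

Lemma C1_curve g f a b : a < b -> C1 (fun u => complex.Re (f u)) ->
  C1 (fun u => complex.Im (f u)) -> (forall u, a <= u <= b -> g u = f u) ->
  exists L, curve a b g (cderive g) L.
Proof.
move=> ab c1 c2 gf; have [_ k1] := c1; have [_ k2] := c2.
have [M1 hM1] := continuous_seg_bounded (ltW ab) k1; have [M2 hM2] := continuous_seg_bounded (ltW ab) k2.
have M10 : 0 <= M1 by rewrite (le_trans _ (hM1 a _)) // lexx ltW.
have M20 : 0 <= M2 by rewrite (le_trans _ (hM2 a _)) // lexx ltW.
have mf : cmeas setT (cderive f).
  by split; exact: continuous_rmeas.
have cN : countable [set a; b] by exact/finite_set_countable/finite_set2.
have gfN u : a <= u <= b -> ~ [set a; b] u -> cderive f u = cderive g u.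
  move=> /andP[au ub] /not_orP[/eqP ua /eqP ub']; apply/esym/(cderive_near gf).
  by rewrite !lt_neqAle au ub ub' eq_sym ua.
(* At a and b the two-sided derivative of g may be unrelated to that of f, or conventional; its
   modulus is simply added to the bound. *)
exists (M1 + M2 + nc (cderive g a) + nc (cderive g b)); split.
- by rewrite !addr_ge0 // nc_ge0.
- apply: (cmeas_countable_eq _ cN _ (cmeasT_sub _ mf)) => // u /mem_seg; exact: gfN.
- move=> u hu.
  have [->|ua] := eqVneq u a; first by rewrite addrAC lerDr !addr_ge0 // nc_ge0.
  have [->|ub] := eqVneq u b; first by rewrite lerDr !addr_ge0 // nc_ge0.
  rewrite -gfN //; last by move=> [] /eqP; apply/negP.
  rewrite (le_trans (nc_le_ReIm _)) // -addrA ler_wpDr ?addr_ge0 ?nc_ge0 // lerD //=.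
    exact: hM1.
  exact: hM2.
- move=> u v au uv vb; rewrite !gf ?au ?(le_trans uv vb) ?vb ?(le_trans au uv) //.
  transitivity (cintegral `[u, v] (cderive f)).
    apply/esym/(eq_cintegral_countable _ cN _ (cmeasT_sub _ mf)) => // w /mem_seg /andP[uw wv].
    by apply: gfN; rewrite (le_trans au uw) (le_trans wv vb).
  by apply: eqc; rewrite ?ReD ?ImD ?ReN ?ImN /=; exact: C1_FTC.
Qed.

Lemma piecewise_C1_curve g : piecewise_C1 g -> exists L, curve 0 1 g (cderive g) L.
Proof.
move=> [n [t [t0 t1 ht]]].
have n0 : (0 < n)%N.
  case: n t1 {ht} => // t1; have := oner_neq0 R; rewrite -t1 t0 eqxx //.
have piece i : (i < n)%N -> exists L, curve (t i) (t i.+1) g (cderive g) L.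
  by move=> /ht [tt [f [c1 c2 gf]]]; exact: C1_curve c1 c2 gf.
have : forall i, (i < n)%N -> t 0%N <= t i.+1 /\ exists L, curve 0 (t i.+1) g (cderive g) L.
  elim=> [|i IH] hi.
    by split; [have [/ltW] := ht _ hi|rewrite -t0; exact: piece].
  have [ti [L cL]] := IH (ltnW hi); have [M cM] := piece _ hi.
  have [/ltW tt _] := ht _ hi.
  split; first exact: le_trans tt.
  by exists (L + M); apply: curve_cat cL cM => //; rewrite -t0.
move=> /(_ n.-1); rewrite prednK // t1 => h; by have [_] := h (leqnn _).
Qed.

Lemma curve_away g dg L p : curve 0 1 g dg L -> (forall u, 0 <= u <= 1 -> g u <> p) ->
  exists2 e, 0 < e & forall u, 0 <= u <= 1 -> e <= nc (g u - p).
Proof.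
move=> cg gp; have [L0 _ _ _] := cg.
pose d u := nc (g (clamp u) - p).
have cd : continuous d.
  apply: (@lip_continuous _ _ (2 * L)) => u v.
  have tri (z w : R[i]) : nc z - nc w <= nc (z - w).
    by rewrite lerBlDr (le_trans _ (ncD _ _)) // subrK.
  have duv : nc (g (clamp u) - g (clamp v)) <= 2 * L * `|u - v|.
    rewrite (le_trans (curve_dist cg (clamp_itv v) (clamp_itv u))) //.
    by rewrite ler_wpM2l ?mulr_ge0 ?clamp_lip.
  have E : g (clamp u) - p - (g (clamp v) - p) = g (clamp u) - g (clamp v) by ring.
  rewrite ler_norml lerNl opprB; apply/andP; split; apply: le_trans (tri _ _) _.
    by rewrite ncBC E.
  by rewrite E.
have [w] := EVT_min ler01 (continuous_subspaceT cd).
rewrite in_itv /= => hw hm; exists (d w).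
  by rewrite /d nc_gt0 subr_eq0; apply/eqP/gp/clamp_itv.
by move=> u hu; have := hm u; rewrite in_itv /= => /(_ hu); rewrite /d (clampE hu).
Qed.

(** By the intermediate value theorem the real part fills the whole interval, so a vertical line
    that misses the curve also misses the strip between lo and hi. *)
Lemma curve_Re_range g dg L : curve 0 1 g dg L -> exists lo hi,
  (forall u, 0 <= u <= 1 -> lo <= complex.Re (g u) <= hi) /\
  (forall v, lo <= v <= hi -> exists2 u, 0 <= u <= 1 & complex.Re (g u) = v).
Proof.
move=> cg; have [L0 _ _ _] := cg.
pose d u := complex.Re (g (clamp u)).
have cd : continuous d.
  apply: (@lip_continuous _ _ (2 * L)) => u v; rewrite /d -ReN -ReD.
  rewrite (le_trans (normr_Re_le_nc _)) // (le_trans (curve_dist cg (clamp_itv v) (clamp_itv u))) //.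
  by rewrite ler_wpM2l ?mulr_ge0 ?clamp_lip.
have [u0 u0i hmin] := EVT_min ler01 (continuous_subspaceT cd).
have [u1 u1i hmax] := EVT_max ler01 (continuous_subspaceT cd).
exists (d u0), (d u1); split.
  move=> u hu; have hu' : u \in `[0, 1] by rewrite in_itv.
  by have := hmin _ hu'; have := hmax _ hu'; rewrite {1 4}/d clampE // => -> ->.
move=> v hv.
have hv' : Num.min (d u0) (d u1) <= v <= Num.max (d u0) (d u1).
  by case/andP: hv => h1 h2; rewrite ge_min h1 le_max h2 orbT.
have main x y : x <= y -> Num.min (d x) (d y) <= v <= Num.max (d x) (d y) ->
    exists2 u, 0 <= u <= 1 & complex.Re (g u) = v.
  move=> xy hxy; have [w _ dw] := IVT xy (continuous_subspaceT cd) hxy.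
  by exists (clamp w); [exact: clamp_itv|].
have [/main|/ltW /main] := leP u0 u1; first exact.
by rewrite minC maxC; exact.
Qed.

End curves.

(** * Residues along closed contours *)

Section residues.
Context {R : realType}.
Implicit Types (a L lo hi : R) (g dg : R -> R[i]) (h F : R[i] -> R[i]).
Local Notation mu := (@lebesgue_measure R).
Local Arguments nc : simpl never.

(* A divergent difference quotient has derivative [0] by convention. *)
Lemma derive1_neq0_isolated (f : R -> R) (u : R) : derive1 f u != 0 ->
  exists n : nat, forall v, f v = f u -> v != u -> n.+1%:R^-1 <= `|v - u|.
Proof.
rewrite /derive1 => l0.
have cv : cvg ((fun r : R => r^-1 *: (f (r + u) - f u)) @ 0^').
  by apply: contrapT => dv; move: l0; rewrite dvgP // => /eqP.
have [e /= e0 he] : nbhs (0 : R) (fun r => r != 0 -> r^-1 *: (f (r + u) - f u) != 0).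
  exact: (cvgr_neq0 _ cv l0).
exists (Num.trunc e^-1) => v fv vu; rewrite leNgt; apply/negP => vlt.
have := he (v - u); rewrite /ball_ /= sub0r normrN subr_eq0 vu subrK fv subrr scaler0 eqxx.
move=> hr; suff /hr /(_ isT) : `|v - u| < e by [].
by rewrite (lt_trans vlt) // invf_plt ?posrE ?ltr0n // truncnS_gt.
Qed.

(** Two points of the level set with the same isolation index n and the same floor of (n + 1) u
    would be closer than 1 / (n + 1), so this pair of integers determines u. *)
Lemma countable_level_set (f : R -> R) (y : R) :
  countable [set u | f u = y /\ derive1 f u != 0].
Proof.
pose P (u : R) (n : nat) := forall v : R, f v = f u -> v != u -> n.+1%:R^-1 <= `|v - u|.
have ex u : exists n, derive1 f u != 0 -> P u n.
  have [d0|/derive1_neq0_isolated [n hn]] := eqVneq (derive1 f u) 0; last by exists n.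
  by exists 0%N.
pose n u := projT1 (cid (ex u)).
have hn u : derive1 f u != 0 -> P u (n u) := projT2 (cid (ex u)).
apply/countable_injP.
exists (fun u => choice.pickle (n u, Num.floor (u * (n u).+1%:R))) => u v.
rewrite !inE => -[fu du] [fv dv] /(pcan_inj choice.pickleK) [nuv fl].
apply/eqP; rewrite eq_sym; apply/negPn/negP => uv.
have := hn u du v; rewrite fv fu => /(_ erefl uv).
rewrite -nuv in fl; set m := (n u).+1 in fl *.
have m0 : (0 : R) < m%:R by rewrite ltr0n.
rewrite leNgt => /negP; apply.
rewrite -(ltr_pM2r m0) mulVf ?gt_eqF // -[X in _ * X]ger0_norm ?ltW // -normrM mulrBl.
have := floor_le_tmp (u * m%:R); have := floorD1_gt (u * m%:R).
have := floor_le_tmp (v * m%:R); have := floorD1_gt (v * m%:R).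
rewrite -fl ltr_norml !intrD /=; lra.
Qed.

Lemma countable_visits g (p : R[i]) : countable [set u | g u = p /\ cderive g u != 0].
Proof.
apply: (@sub_countable _ _ _ ([set u | complex.Re (g u) = complex.Re p /\
    derive1 (fun v => complex.Re (g v)) u != 0] `|`
  [set u | complex.Im (g u) = complex.Im p /\ derive1 (fun v => complex.Im (g v)) u != 0])).
  apply: subset_card_le => u [<- dg].
  have [h|h] := eqVneq (derive1 (fun v => complex.Re (g v)) u) 0; last by left.
  right; split => //; apply: contraNneq dg => h'.
  by rewrite /cderive h h'.
rewrite -bigcup2E; apply: bigcup_countable => // -[_|[_|n _]] /=; try exact: countable_level_set.
exact: countable0.
Qed.

(** A strip cut at height B: [holK] asks for boundedness, which fails on a full strip already for
    the identity. *)
Definition rect lo hi (B : R) : set R[i] :=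
  [set t | lo <= complex.Re t <= hi /\ `|complex.Im t| <= B].

Lemma convex_rect lo hi B : convex_set (rect lo hi B).
Proof.
move=> z w r [/andP[z1 z2] z3] [/andP[w1 w2] w3] /andP[r0 r1].
have conv (x y b : R) : x <= b -> y <= b -> x + r * (y - x) <= b.
  move=> xb yb; have -> : x + r * (y - x) = (1 - r) * x + r * y by ring.
  have -> : b = (1 - r) * b + r * b by ring.
  by rewrite lerD // ler_wpM2l // subr_ge0.
have ReE : complex.Re (z + r%:C * (w - z)) = complex.Re z + r * (complex.Re w - complex.Re z).
  by rewrite ReD ReM ReD ReN /= mul0r subr0.
have ImE : complex.Im (z + r%:C * (w - z)) = complex.Im z + r * (complex.Im w - complex.Im z).
  by rewrite ImD ImM ImD ImN /= mul0r addr0.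
split; rewrite ?ReE ?ImE.
  rewrite conv // andbT -lerN2 opprD -mulrN opprB.
  have -> : complex.Re z - complex.Re w = - complex.Re w - - complex.Re z by ring.
  by apply: conv; rewrite lerN2.
move: z3 w3; rewrite !ler_norml => /andP[z3 z4] /andP[w3 w4].
rewrite conv // andbT -lerN2 opprD -mulrN opprB opprK.
have -> : complex.Im z - complex.Im w = - complex.Im w - - complex.Im z by ring.
by apply: conv; lra.
Qed.

Lemma rect_bounded lo hi B t : rect lo hi B t -> nc t <= `|lo| + `|hi| + B.
Proof.
move=> [/andP[t1 t2] t3]; rewrite (le_trans (nc_le_ReIm _)) // lerD // ler_norml.
have := ler_norm lo; have := ler_norm (- lo); have := ler_norm hi; have := ler_norm (- hi).
by rewrite !normrN => *; apply/andP; split; lra.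
Qed.

Lemma curve_residue h g dg L lo hi a : curve 0 1 g dg L -> g 0 = g 1 ->
  (forall u, 0 <= u <= 1 -> lo <= complex.Re (g u) <= hi) ->
  (forall B, hol (rect lo hi B) h) ->
  (forall u, 0 <= u <= 1 -> g u <> a%:C) ->
  cint `[0 : R, 1] (fun u => h (g u) / (g u - a%:C) * dg u) /\
  cintegral `[0 : R, 1] (fun u => h (g u) / (g u - a%:C) * dg u) =
  h a%:C * cintegral `[0 : R, 1] (fun u => (g u - a%:C)^-1 * dg u).
Proof.
move=> cg g01 gre hh ga.
have [B0 gB0] := curve_bounded 0 cg; pose B := B0 + 1.
have gB u : 0 <= u <= 1 -> `|complex.Im (g u)| < B.
  move=> /gB0; rewrite subr0 => nB; rewrite (le_lt_trans (normr_Im_le_nc _)) //.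
  by rewrite (le_lt_trans nB) // ltrDl.
have Bpos : 0 <= B by rewrite (le_trans (normr_ge0 (complex.Im (g 0)))) // ltW // gB // lexx ler01.
have gD u : 0 <= u <= 1 -> rect lo hi B (g u) by move=> hu; split; [exact: gre|exact/ltW/gB].
have [e e0 ge] := curve_away cg ga.
have [K [h' hK]] := hh B; have [K0 h1 h2 h3 h4] := hK.
split.
  have [L0 m n i] := cg.
  apply: (@cint_seg _ _ _ (K / e * L)).
    apply: cmeasM => //; apply: cmeasM; first exact: holK_curve_cmeas hK cg gD.
    by apply: cmeasV; apply: cmeasB; [exact: curve_cmeas cg|exact: cmeas_cst].
  move=> u hu; rewrite !Normc.normcM Normc.normcV ler_pM ?mulr_ge0 ?invr_ge0 ?nc_ge0 ?n //.
  apply: ler_pM; rewrite ?invr_ge0 ?nc_ge0 //; first exact/h1/gD.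
  by rewrite lef_pV2 ?posrE ?ge // (lt_le_trans e0) // ge.
(* If a lies outside the strip, 1 / (t - a) is holomorphic on the rectangle and both sides vanish by
   Cauchy's theorem. *)
have [/andP[loa ahi]|nloa] := boolP (lo <= a <= hi).
  apply: (Cauchy_formula hK (@convex_rect lo hi B) _ cg gD e0 ge g01).
  by split; rewrite /= ?loa ?ahi ?normr0.
have lohi : lo <= hi by have /andP[x y] := gre 0 (introT andP (conj (lexx _) ler01)); exact: le_trans y.
(* A corner of the rectangle, to which the curve can be contracted; it is off the curve because B
   exceeds every |Im g|. *)
pose p := lo +i* B.
have pD : rect lo hi B p by split; rewrite /= ?lexx // ger0_norm.
have gp u : 0 <= u <= 1 -> g u <> p.
  by move=> hu gup; have := gB u hu; rewrite gup /= ger0_norm ?ltxx.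
have [d d0 gd] := curve_away cg gp.
have hinv : hol (rect lo hi B) (fun t => (t - a%:C)^-1).
  have [d' d'0 hd'] : exists2 d' : R, 0 < d' & forall t, rect lo hi B t -> d' <= nc (t - a%:C).
    have tri t : `|complex.Re t - a| <= nc (t - a%:C).
      by rewrite (le_trans _ (normr_Re_le_nc _)) // ReD ReN.
    move: nloa; rewrite negb_and -!ltNge => /orP[al|ha].
      exists (lo - a); first by rewrite subr_gt0.
      move=> t [/andP[t1 _] _]; rewrite (le_trans _ (tri t)) // ger0_norm; first by rewrite lerD2r.
      by rewrite subr_ge0 (le_trans _ t1) // ltW.
    exists (a - hi); first by rewrite subr_gt0.
    move=> t [/andP[_ t1] _]; rewrite (le_trans _ (tri t)) // distrC ger0_norm ?lerD2l ?lerN2 //.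
    by rewrite subr_ge0 (le_trans t1) // ltW.
  apply: (hol_inv d'0 hd'); apply: holD; last exact: hol_cst.
  exact: (hol_id (@rect_bounded lo hi B)).
have bD : exists M, forall t, rect lo hi B t -> nc t <= M.
  by exists (`|lo| + `|hi| + B) => t; exact: rect_bounded.
rewrite (Cauchy_closed hinv (@convex_rect lo hi B) pD bD cg gD d0 gd g01) mulr0.
exact: (Cauchy_closed (holM (hh B) hinv) (@convex_rect lo hi B) pD bD cg gD d0 gd g01).
Qed.

Lemma two_pi_i_neq0 : two_pi_i R != 0.
Proof. by rewrite -nc_gt0 /two_pi_i ncE /= expr0n /= add0r sqrtr_sqr normr_gt0 mulf_neq0 // gt_eqF ?pi_gt0. Qed.

(* The values of [f] at the points [exc j] do not matter: the parameters [u] at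
   which a component [g] visits such a point with [g' u != 0] are isolated. *)
Lemma contour_residues (S : contour R) (V : R -> Prop) (f F : R[i] -> R[i]) (N : nat)
    (rho : nat -> R[i]) (exc : nat -> R[i]) :
  (forall t, V (complex.Re t) -> ~ on_contour S t) ->
  (forall lo hi B, (forall v, V v -> ~~ (lo <= v <= hi)) -> hol (rect lo hi B) F) ->
  (forall n : nat, (n < N)%N -> encircles_once S n%:R) ->
  (forall t, on_contour S t -> (forall j, t <> exc j) ->
     f t = \sum_(n < N) rho n * (F t / (t - n%:R))) ->
  contour_integral S f = two_pi_i R * \sum_(n < N) rho n * F n%:R.
Proof.
move=> SV hF enc fE.
have comp i : cintegral `[0 : R, 1] (fun u => f (S i u) * cderive (S i) u) =
    \sum_(n < N) rho n * F n%:R *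
      cintegral `[0 : R, 1] (fun u => (S i u - n%:R)^-1 * cderive (S i) u).
  have [L cg] := piecewise_C1_curve (contour_piecewise_C1 (c := S) i).
  have g01 := contour_closed (c := S) i.
  have onS u : 0 <= u <= 1 -> on_contour S (S i u) by move=> hu; exists i, u.
  have [lo [hi [h1 h2]]] := curve_Re_range cg.
  have Flh B : hol (rect lo hi B) F.
    apply: hF => v Vv; apply/negP => /h2 [u hu Ru].
    by apply: (SV (S i u)); [rewrite Ru|exact: onS].
  have res (n : 'I_N) : cint `[0 : R, 1] (fun u => F (S i u) / (S i u - n%:R) * cderive (S i) u) /\
    cintegral `[0 : R, 1] (fun u => F (S i u) / (S i u - n%:R) * cderive (S i) u) =
    F n%:R * cintegral `[0 : R, 1] (fun u => (S i u - n%:R)^-1 * cderive (S i) u).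
    have [nS _] := enc n (ltn_ord n).
    have := @curve_residue F _ _ _ _ _ n%:R cg g01 h1 Flh; rewrite rmorph_nat; apply.
    by move=> u hu gn; apply: nS; rewrite -gn; exact: onS.
  have ci (n : 'I_N) : cint `[0 : R, 1] (fun u => rho n *
      (F (S i u) / (S i u - n%:R) * cderive (S i) u)).
    by apply: cintZ => //; have [] := res n.
  transitivity (cintegral `[0 : R, 1] (fun u => \sum_(n < N) rho n *
      (F (S i u) / (S i u - n%:R) * cderive (S i) u))).
    pose Z := \bigcup_j [set u | S i u = exc j /\ cderive (S i) u != 0].
    have cZ : countable Z by apply: bigcup_countable => // j _; exact: countable_visits.
    apply/esym/(@eq_cintegral_countable _ _ Z) => //; last first.
      by apply: cint_meas; exact: cint_sum.
    move=> u /mem_seg hu nZ.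
    have [-> |dg0] := eqVneq (cderive (S i) u) 0.
      by rewrite mulr0 big1 // => n _; rewrite !mulr0.
    rewrite fE; last 2 first.
    - exact: onS.
    - by move=> j gj; apply: nZ; exists j.
    by rewrite mulr_suml; apply: eq_bigr => n _; rewrite mulrA.
  rewrite cintegral_sum //; apply: eq_bigr => n _.
  by have [c1 c2] := res n; rewrite (cintegralZ _ _ c1) // c2 mulrA.
rewrite /contour_integral (eq_bigr _ (fun i _ => comp i)) exchange_big mulr_sumr.
apply: eq_bigr => n _; rewrite -mulr_sumr mulrC; congr (_ * _).
have [_] := enc n (ltn_ord n); rewrite /winding /contour_integral => w1.
by apply: (mulfI (invr_neq0 two_pi_i_neq0)); rewrite w1 mulVf // two_pi_i_neq0.
Qed.

End residues.

(** * Evaluation of the double contour integral *)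

Section partial_fractions.
Context {F : numFieldType}.
Implicit Types (t : F) (N n : nat).

(** After multiplication by N! the coefficients are signed binomials. The step takes the difference
    of the identities at t - 1 and at t, by 1 / (t - N - 1) - 1 / t = (N + 1) / (t (t - N - 1)), and
    Pascal's rule. *)
Lemma partial_fraction N t : (forall n, (n <= N)%N -> t - n%:R != 0) ->
  \prod_(n < N.+1) (t - n%:R)^-1 =
  \sum_(n < N.+1) (-1) ^+ (N + n) / (n`!%:R * (N - n)`!%:R) * (t - n%:R)^-1.
Proof.
move=> ht.
suff h : N`!%:R * \prod_(n < N.+1) (t - n%:R)^-1 =
    \sum_(n < N.+1) (-1) ^+ (N + n) * 'C(N, n)%:R * (t - n%:R)^-1.
  apply: (mulfI (fact_neq0 (F := F) N)); rewrite h mulr_sumr; apply: eq_bigr => n _.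
  rewrite [RHS]mulrA; congr (_ * _).
  have nN : (n <= N)%N by rewrite -ltnS.
  rewrite -(bin_fact nN) !natrM.
  by field; rewrite !fact_neq0.
elim: N t ht => [|N IH] t ht.
  by rewrite !big_ord_recl !big_ord0 /= bin0 !mulr1 mul1r addr0.
have t0 : t != 0 by have := ht 0%N (leq0n _); rewrite subr0.
have tN := ht N.+1 (leqnn _).
have IH0 := IH t (fun n nN => ht n (leqW nN)).
have IH1 : N`!%:R * \prod_(n < N.+1) (t - n.+1%:R)^-1 =
    \sum_(n < N.+1) (-1) ^+ (N + n) * 'C(N, n)%:R * (t - n.+1%:R)^-1.
  have E n : t - 1 - n%:R = t - n.+1%:R by rewrite -natr1; ring.
  have := IH (t - 1); under eq_bigr do rewrite E; under [in RHS]eq_bigr do rewrite E.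
  by apply => n nN; rewrite E; exact: ht.
set a := \prod_(n < N) (t - n.+1%:R)^-1.
have P0 : \prod_(n < N.+1) (t - n%:R)^-1 = t^-1 * a by rewrite big_ord_recl subr0.
have P1 : \prod_(n < N.+1) (t - n.+1%:R)^-1 = a * (t - N.+1%:R)^-1 by rewrite big_ord_recr.
have P2 : \prod_(n < N.+2) (t - n%:R)^-1 = t^-1 * (a * (t - N.+1%:R)^-1).
  by rewrite big_ord_recl subr0 -P1.
transitivity (N`!%:R * \prod_(n < N.+1) (t - n.+1%:R)^-1 - N`!%:R * \prod_(n < N.+1) (t - n%:R)^-1).
  rewrite P0 P1 P2 factS natrM -mulrBr.
  have -> : a * (t - N.+1%:R)^-1 - t^-1 * a = N.+1%:R * (t^-1 * (a * (t - N.+1%:R)^-1)).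
    by move: (N.+1%:R : F) tN => M tM; field; rewrite t0 tM.
  by ring.
rewrite IH1 IH0 [RHS]big_ord_recl /= bin0 addn0 subr0.
have -> : \sum_(n < N.+1) (-1) ^+ (N + n) * 'C(N, n)%:R * (t - n%:R)^-1 =
    \sum_(n < N.+2) (-1) ^+ (N + n) * 'C(N, n)%:R * (t - n%:R)^-1.
  by rewrite [RHS]big_ord_recr /= bin_small // mulr0 mul0r addr0.
rewrite [X in _ - X]big_ord_recl /= bin0 addn0 subr0 opprD addrCA.
congr (_ + _); first by rewrite exprS; ring.
rewrite -sumrB; apply: eq_bigr => n _.
by rewrite /bump leq0n !add1n !addnS !addSn binS natrD !exprS; ring.
Qed.

End partial_fractions.

(** * Factorisation of the integrand *)

Section integrand.
Context {R : realType}.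
Implicit Types (t s z : R[i]) (b x y : R).
Local Arguments nc : simpl never.
Local Arguments cexp : simpl never.

(** A power is a multiple of [gumbel] at the fixed point ln b, so [holK_gumbel] gives its holomorphy
    in t. *)
Lemma cpow_gumbel b t : cpow b t = (expR (expR (ln b)))%:C * gumbel t (ln b).
Proof. by rewrite /cpow /gumbel -cexp_real -cexpD; congr cexp; ring. Qed.

Lemma hol_cpow b B : hol (disk B) (cpow b).
Proof.
apply: (@hol_eq _ _ (fun t => (expR (expR (ln b)))%:C * gumbel t (ln b))).
  by move=> t _; rewrite cpow_gumbel.
apply: holM; first exact: hol_cst.
apply: (@hol_sub _ _ [set t | - B <= complex.Re t <= B]).
  by move=> t tB; rewrite /= -ler_norml (le_trans (normr_Re_le_nc _)).
do 2 eexists; exact: holK_gumbel.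
Qed.

(** If s is a pole of Gamma and s + n is not, both sides are 0 by the conventions, so the identity
    survives there. *)
Lemma Gamma_quotient s n : rGamma (s + n%:R) != 0 ->
  Gamma s / Gamma (s + n%:R) = (pochhammer s n)^-1.
Proof.
move=> r0; rewrite -/(rGamma (s + n%:R)) GammaV (rGamma_shift s n) invfM.
by rewrite -mulrA mulVf // mulr1.
Qed.

Lemma Gamma_quotient_poles t (N : nat) : (forall j, t + 1 + j%:R != 0) ->
  Gamma (t - N%:R + 1) / Gamma (t + 1) = \prod_(n < N) (t - n%:R)^-1.
Proof.
move=> ht.
have E : t + 1 = t - N%:R + 1 + N%:R by ring.
rewrite E Gamma_quotient -?E ?rGamma_neq0 // -prodfV /pochhammer.
rewrite (reindex_inj rev_ord_inj) /=; apply: eq_bigr => i _; congr (_^-1).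
by rewrite natrB // -natr1; ring.
Qed.

Lemma Gamma_falling s (n : nat) : 0 < complex.Re s ->
  Gamma s / Gamma (s - n%:R) = falling s n.
Proof.
move=> s0; rewrite -/(rGamma _) (rGamma_shift _ n) subrK mulrCA /rGamma.
rewrite divff ?Gamma_neq0 // mulr1 /pochhammer /falling (reindex_inj rev_ord_inj) /=.
by apply: eq_bigr => i _; rewrite natrB // -natr1; ring.
Qed.

Lemma Gamma_line_Gamma s : 0 < complex.Re s -> Gamma s = line_Gamma s.
Proof. by move=> s0; rewrite /Gamma s0 Gamma_integralE. Qed.

Section factors.
Variables (alpha delta x y : R) (nu N : nat).

(** One of the two factors 1 / Gamma (t + 1) is absorbed, with the 0F1, in [bessel_series]; the
    other is paired with Gamma (t - N + 1) in [Gamma_quotient_poles]. *)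
Definition entire_factor t : R[i] :=
  ((1 - delta ^+ 2 / alpha ^+ 2) ^+ nu)%:C * rGamma (t + nu%:R + 1) *
  bessel_series (delta ^+ 2 * x)%:C t *
  (cpow (alpha ^+ 2 - delta ^+ 2) (t + 1) * cpow x t).

Definition line_factor (k m : nat) s : R[i] :=
  falling s (N - m) * line_Gamma s * line_Gamma (s + (nu + k)%:R) * cpow (alpha ^+ 2 * y) (- s).

(** This is Gamma (s - t + m - 1) / Gamma (s - t + k), the only factor that couples s and t. *)
Definition pole_factor (k m : nat) s t : R[i] := \prod_(m <= j < k.+1) (s - t + j%:R - 1)^-1.

Lemma hol_entire_factor B : hol (disk B) entire_factor.
Proof.
have sh (f : R[i] -> R[i]) (a : R[i]) : (forall C, hol (disk C) f) -> hol (disk B) (fun t => f (t + a)).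
  move=> hf; apply: (@hol_shift _ _ (disk (B + nc a))) => // t tB.
  by rewrite /disk /= (le_trans (ncD _ _)) // lerD2r.
apply: holM; first apply: holM; first apply: holM.
- exact: hol_cst.
- apply: (@hol_eq _ _ (fun t => rGamma (t + (nu%:R + 1)))); first by move=> t _; rewrite addrA.
  by apply: sh => C; exact: hol_rGamma.
- exact: hol_bessel_series.
- by apply: holM; [apply: sh => C; exact: hol_cpow|exact: hol_cpow].
Qed.

Lemma integrandE (k m : nat) t s : (m <= k)%N -> (m <= N)%N -> 0 < complex.Re s ->
  (forall j, t + 1 + j%:R != 0) -> (forall j, s - t + k%:R + j%:R != 0) ->
  integrand alpha delta nu N k m x y t s =
  entire_factor t * \prod_(n < N) (t - n%:R)^-1 * (line_factor k m s * pole_factor k m s t).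
Proof.
move=> mk mN s0 ht hst.
have e1 := @Gamma_quotient_poles t N ht.
have e2 := @hyp0F1E _ (delta ^+ 2 * x)%:C t ht.
have e3 := @Gamma_falling s (N - m) s0.
have e4 : Gamma (s - t + m%:R - 1) / Gamma (s - t + k%:R) = pole_factor k m s t.
  have E : s - t + k%:R = s - t + m%:R - 1 + (k.+1 - m)%:R.
    by rewrite natrB ?leqW // -natr1; ring.
  rewrite E Gamma_quotient -?E ?rGamma_neq0 // /pole_factor prodfV.
  rewrite /pochhammer -[in RHS](add0n m) big_addn big_mkord; congr (_^-1); apply: eq_bigr => i _.
  by rewrite natrD; ring.
have sN : s - N%:R + m%:R = s - (N - m)%:R by rewrite natrB //; ring.
have snk : s + nu%:R + k%:R = s + (nu + k)%:R by rewrite natrD addrA.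
have G1 := Gamma_line_Gamma s0.
have G2 : Gamma (s + (nu + k)%:R) = line_Gamma (s + (nu + k)%:R).
  by apply: Gamma_line_Gamma; rewrite ReD Re_nat ltr_wpDr.
rewrite /integrand sN snk /line_factor /entire_factor -e1 -e2 -e3 -e4 -G1 -G2 /rGamma !invfM.
rewrite (addrAC t nu%:R 1).
move: (Gamma s) (Gamma (s + _)) (Gamma (s - t + m%:R - 1)) (Gamma (t - _ + 1)) => g1 g2 g3 g4.
move: (Gamma (t + 1)) (Gamma (t + 1 + _)) (Gamma (s - _%:R)) (Gamma (s - t + _)) => g5 g6 g7 g8.
move: (cpow _ (t + 1)) (cpow x t) (cpow _ (- s)) (hyp0F1 _ _) (_%:C) => p1 p2 p3 h w.
ring.
Qed.

End factors.
End integrand.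

(** * The finite identity behind the sum over k *)

Section kernel_identity.
Context {F : numFieldType}.
Implicit Types (s q : F) (n N nu k l : nat).

Lemma pochhammerN_fact p n : (n <= p)%N ->
  pochhammer (- p%:R : F) n / p`!%:R = (-1) ^+ n / (p - n)`!%:R.
Proof.
move=> np; rewrite pochhammerN_nat -(ffact_fact np) natrM.
by field; rewrite !fact_neq0 /= pnatr_eq0 -lt0n ffact_gt0 np.
Qed.

Lemma pochhammerN_small p n : (p < n)%N -> pochhammer (- p%:R : F) n = 0.
Proof. by move=> pn; rewrite pochhammerN_nat ffact_small // mulr0. Qed.

(** For fixed k, [kernel_sum_closed] is a sum over p from n to N - 1, where p will index the
    products P_p Q_p. Exchanging p and k leaves at each p the right side of [euler_transformation],
    and (-p)_n = 0 for p < n extends the range to all p < N. *)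
Lemma kernel_sum_euler s q n N nu :
  (forall j, (j < N)%N -> s - n%:R + j%:R - 1 != 0) -> (n < N)%N ->
  \sum_(k < N) q ^+ k * ((-1) ^+ (N.-1 + n) / (n`!%:R * (N.-1 - n)`!%:R) *
     kernel_sum s n%:R k N) * pochhammer (s + nu%:R) k =
  \sum_(p < N) pochhammer (- p%:R) n / (n`!%:R * p`!%:R) * (\sum_(l < p.+1)
     (1 - q) ^+ l * (pochhammer (- p%:R) l / ((nu + l)`!%:R * l`!%:R))
     * pochhammer (s + nu%:R) l * (nu + p)`!%:R).
Proof.
move=> hs nN.
pose T p k := q ^+ k * (-1) ^+ (k + p) * 'C(p, k)%:R * pochhammer (s + nu%:R) k * falling s (p - k).
transitivity (\sum_(p < N) pochhammer (- p%:R) n / (n`!%:R * p`!%:R) * \sum_(k < N) T p k); last first.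
  apply: eq_bigr => p _; congr (_ * _); rewrite euler_transformation.
  rewrite (big_ord_widen _ (fun k => T p k) (ltn_ord p)) [RHS]big_mkcond /=.
  apply: eq_bigr => k _; case: ifPn => //; rewrite -leqNgt => pk.
  by rewrite /T bin_small // mulr0 !mul0r.
under [RHS]eq_bigr do rewrite mulr_sumr.
rewrite exchange_big /=; apply: eq_bigr => k _.
have sgn : (-1) ^+ (N.-1 + n) / (n`!%:R * (N.-1 - n)`!%:R) * kernel_sum s n%:R k N =
    n`!%:R^-1 * ((-1) ^+ (N - 1 - n) / (N - 1 - n)`!%:R * kernel_sum s n%:R k N).
  have nN1 : (n <= N.-1)%N by rewrite -ltnS prednK // (leq_ltn_trans _ nN).
  rewrite -{1}(subnK nN1) -addnA addnn exprD -mul2n exprM sqrrN !expr1n mulr1 subn1 invfM.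
  ring.
rewrite sgn kernel_sum_closed //; last by move=> j jk; apply: hs; exact: leq_ltn_trans jk _.
rewrite -(big_mkord xpredT (fun p => pochhammer (- p%:R) n / (n`!%:R * p`!%:R) * T p k)).
rewrite (@big_cat_nat _ _ _ n 0 N) ?leq0n ?(ltnW nN) //=.
rewrite [X in _ = X + _]big_nat_cond [X in _ = X + _]big1 ?add0r; last first.
  by move=> p /andP[/andP[_ pn] _]; rewrite pochhammerN_small // !mul0r.
rewrite [n`!%:R^-1 * _]mulrA mulr_sumr mulr_sumr mulr_suml; rewrite [LHS]big_nat [RHS]big_nat.
apply: eq_bigr => p /andP[np _].
have -> : pochhammer (- p%:R : F) n / (n`!%:R * p`!%:R) = n`!%:R^-1 * ((-1) ^+ n / (p - n)`!%:R).
  by rewrite -pochhammerN_fact // invfM; ring.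
rewrite /T; ring.
Qed.

End kernel_identity.

(** * The integral over the vertical line *)

Section line_transform.
Context {R : realType}.
Variables (alpha delta x y c : R) (nu N : nat).
Hypothesis c0 : 0 < c.
Implicit Types (t s : R[i]) (lo hi B : R) (k m : nat).
Local Arguments nc : simpl never.
Local Arguments cexp : simpl never.
Local Notation lf := (line_factor alpha y nu N).
Local Notation pf := (@pole_factor R).

Let cmeas_line : cmeas setT (fun eta : R => c +i* eta).
Proof. by split => /=; [exact: measurable_cst|exact: measurable_id]. Qed.

Let Re_shift n (eta : R) : complex.Re ((c +i* eta) + n%:R) = c + n%:R.
Proof. by rewrite ReD Re_nat. Qed.

Let shiftE n (eta : R) : (c +i* eta) + n%:R = (c + n%:R) +i* eta.
Proof. by apply: eqc; rewrite ?ReD ?ImD ?Re_nat ?Im_nat //= addr0. Qed.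

Let cn0 n : 0 < c + n%:R. Proof. by rewrite ltr_wpDr. Qed.

Lemma cmeas_line_factor k m : cmeas setT (fun eta => lf k m (c +i* eta)).
Proof.
apply: cmeasM; first apply: cmeasM; first apply: cmeasM.
- apply: cmeas_prod => i; apply: cmeasB; last exact: cmeas_cst.
  by apply: cmeasB => //; exact: cmeas_cst.
- exact: cmeas_line_Gamma.
- apply: cmeas_eq (cmeas_line_Gamma (cn0 (nu + k))) => eta _.
  by rewrite shiftE.
- apply: cmeas_cexp; apply: cmeasM; last exact: cmeas_cst.
  by apply: cmeasN.
Qed.

Lemma rapid_line_factor k m : rapid (fun eta => lf k m (c +i* eta)).
Proof.
have h : rapid (fun eta => line_Gamma (c +i* eta) * (falling (c +i* eta) (N - m) *
    (line_Gamma (c +i* eta + (nu + k)%:R) * cpow (alpha ^+ 2 * y) (- (c +i* eta))))).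
  apply: rapidM; first exact: rapid_line_Gamma.
  apply: poly_growthM; last apply: poly_growthM.
  - apply: poly_growth_prod => i.
    have := poly_growth_vertical c (i%:R + 1 : R[i]).
    by under eq_fun do rewrite opprD addrA.
  - apply: (@poly_growth_bounded _ _ (2 * complex.Re (line_Gamma (c + (nu + k)%:R)%:C))) => eta.
    by rewrite -[c + _](Re_shift (nu + k) eta); apply: nc_line_Gamma_le; rewrite Re_shift.
  - apply: (@poly_growth_bounded _ _ (expR (- c * ln (alpha ^+ 2 * y)))) => eta.
    by rewrite nc_cexp ReM ReN /= mulr0 subr0.
move=> p; have [C C0 hC] := h p; exists C => // eta.
by rewrite (le_trans _ (hC eta)) // le_eqVlt; apply/orP; left; apply/eqP; congr (nc _ * _);
  rewrite /line_factor; ring.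
Qed.

(** The pole s + j - 1 runs on the line Re t = c + j - 1, at positive distance from the strip
    independently of eta, so one constant K serves the whole line. *)
Lemma pole_factor_family lo hi B k m :
  (forall j, (j <= k)%N -> ~~ (lo <= c + j%:R - 1 <= hi)) ->
  exists K F', [/\ forall eta, holK (rect lo hi B) K (pf k m (c +i* eta)) (F' eta),
    forall t, rect lo hi B t -> cmeas setT (fun eta => pf k m (c +i* eta) t) &
    forall t, rect lo hi B t -> cmeas setT (F' ^~ t)].
Proof.
move=> hj; rewrite /pole_factor.
have : forall j, j \in index_iota m k.+1 -> (j <= k)%N by move=> j; rewrite mem_index_iota => /andP[].
elim: (index_iota m k.+1) => [_|j r IH hr].
  exists (nc (1 : R[i])), (fun _ _ => 0); split => [eta|t _|t _].
  - by apply: holK_eq (holK_cst _ 1) => t _; rewrite ?big_nil.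
  - by under eq_fun do rewrite big_nil; exact: cmeas_cst.
  - exact: cmeas_cst.
have [|K [F' [h1 h2 h3]]] := IH; first by move=> i ir; apply: hr; rewrite inE ir orbT.
have jk : (j <= k)%N by apply: hr; rewrite inE eqxx.
have [e e0 he] : exists2 e, 0 < e & forall eta t, rect lo hi B t ->
    e <= nc (t - (c +i* eta + j%:R - 1)).
  have tri (t : R[i]) (eta : R) :
      `|complex.Re t - (c + j%:R - 1)| <= nc (t - (c +i* eta + j%:R - 1)).
    by rewrite (le_trans _ (normr_Re_le_nc _)) // !(ReD, ReN) Re_nat.
  have := hj j jk; rewrite negb_and -!ltNge => /orP[al|ha].
    exists (lo - (c + j%:R - 1)); first by rewrite subr_gt0.
    move=> eta t [/andP[t1 _] _]; rewrite (le_trans _ (tri t eta)) // ger0_norm ?lerD2r //.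
    by rewrite subr_ge0 (le_trans _ t1) // ltW.
  exists (c + j%:R - 1 - hi); first by rewrite subr_gt0.
  move=> eta t [/andP[_ t1] _].
  rewrite (le_trans _ (tri t eta)) // distrC ger0_norm ?lerD2l ?lerN2 //.
  by rewrite subr_ge0 (le_trans t1) // ltW.
have r1 eta := holKM (holK_cst (rect lo hi B) (-1)) (holK_recip e0 (he eta)).
have r2 eta := holKM (r1 eta) (h1 eta).
have mt t : cmeas setT (fun eta : R => t - (c +i* eta + j%:R - 1)).
  apply: cmeasB; first exact: cmeas_cst.
  apply: cmeasB; last exact: cmeas_cst.
  by apply: cmeasD => //; exact: cmeas_cst.
do 2 eexists; split => [eta|t Dt|t Dt].
- apply: holK_eq (r2 eta) => t Dt; last reflexivity.
  rewrite big_cons; congr (_ * _).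
  by rewrite mulN1r -invrN; congr (_^-1); ring.
- under eq_fun do rewrite big_cons.
  apply: cmeasM; last exact: h2.
  apply: cmeasV; apply: cmeasB; last exact: cmeas_cst.
  apply: cmeasD; last exact: cmeas_cst.
  by apply: cmeasB => //; exact: cmeas_cst.
- have mV : cmeas setT (fun eta : R => (t - (c +i* eta + j%:R - 1))^-1) by exact: cmeasV.
  have c1 (z : R[i]) : cmeas setT (fun _ : R => z) by exact: cmeas_cst.
  have mN : cmeas setT (fun eta : R => - (t - (c +i* eta + j%:R - 1)) ^- 2).
    by apply: cmeasN; apply: cmeasV; exact: cmeasX.
  exact: cmeasD (cmeasM (cmeasD (cmeasM (c1 0) mV) (cmeasM (c1 (-1)) mN)) (h2 t Dt))
    (cmeasM (cmeasM (c1 (-1)) mV) (h3 t Dt)).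
Qed.

Definition line_transform k m t := cintegral setT (fun eta : R =>
  lf k m (c +i* eta) * pf k m (c +i* eta) t).

Lemma hol_line_transform lo hi B k m :
  (forall j, (j <= k)%N -> ~~ (lo <= c + j%:R - 1 <= hi)) ->
  hol (rect lo hi B) (line_transform k m).
Proof.
move=> hj; have [K [F' [h1 h2 h3]]] := @pole_factor_family lo hi B k m hj.
have r eta := holKM (holK_cst (rect lo hi B) (lf k m (c +i* eta))) (h1 eta).
have ml := cmeas_line_factor k m.
do 2 eexists; apply: (holK_integral r).
- have i := rint_nc measurableT (rapid_cint ml (@rapid_line_factor k m)).
  by apply: (rint_eq _ _ (rintZ (3 * K) _ i)) => // u _; ring.
- by move=> t Dt; apply: cmeasM => //; exact: h2.
- move=> t Dt; apply: cmeasD; first by apply: cmeasM; [exact: cmeas_cst|exact: h2].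
  by apply: cmeasM => //; exact: h3.
Qed.

Lemma cint_line_transform k m t : (forall j, (j <= k)%N -> complex.Re t != c + j%:R - 1) ->
  cint setT (fun eta : R => lf k m (c +i* eta) * pf k m (c +i* eta) t).
Proof.
move=> ht; pose B := `|complex.Im t|.
have [j jk|K [F' [h1 h2 _]]] := @pole_factor_family (complex.Re t) (complex.Re t) B k m.
  by rewrite -eq_le ht.
have Dt : rect (complex.Re t) (complex.Re t) B t by split; rewrite /= ?lexx.
have ml := cmeas_line_factor k m.
apply: rapid_cint; first by apply: cmeasM => //; exact: h2.
apply: rapidM; first exact: rapid_line_factor.
by apply: (@poly_growth_bounded _ _ K) => eta; have [_ h _ _ _] := h1 eta; exact: h.
Qed.

Lemma vertical_integrandE k m t : (m <= k)%N -> (m <= N)%N ->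
  (forall j, t + 1 + j%:R != 0) -> (forall j, (j <= k)%N -> complex.Re t != c + j%:R - 1) ->
  vertical_integral c (fun s => integrand alpha delta nu N k m x y t s) =
  (0 +i* 1) * entire_factor alpha delta x nu t * line_transform k m t *
    \prod_(n < N) (t - n%:R)^-1.
Proof.
move=> mk mN ht htj; rewrite /vertical_integral.
set E := entire_factor _ _ _ _ t; set P := \prod_(n < N) _.
have -> : (0 +i* 1) * E * line_transform k m t * P = (0 +i* 1) * (E * P * line_transform k m t).
  by ring.
congr (_ * _).
have ci := @cint_line_transform k m t htj.
transitivity (cintegral setT (fun eta : R =>
    E * P * (lf k m (c +i* eta) * pf k m (c +i* eta) t))).
  (* Gamma (s - t + k) can be at a pole only if s - t is real, that is for the single value eta = Im
     t. *)
  apply: esym; apply: (@eq_cintegral_countable _ _ [set complex.Im t]).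
  - exact: measurableT.
  - exact: countable1.
  - move=> eta _ /= nt; rewrite integrandE // => j; apply/eqP => h.
    apply: nt; have := congr1 (fun z => complex.Im z) h.
    rewrite !(ImD, ImN, Im_nat) /= !addr0 => /eqP.
    by rewrite subr_eq0 => /eqP.
  - by apply: cmeasM; [exact: cmeas_cst|exact: cint_meas].
by rewrite (cintegralZ _ measurableT ci).
Qed.

End line_transform.

(** * Values at the integers and the functions P and Q *)

Section evaluation.
Context {R : realType}.
Implicit Types (b v x y : R) (t s q : R[i]) (n k l p : nat).
Local Arguments nc : simpl never.
Local Arguments cexp : simpl never.

Lemma rmorph_pochhammer (A B : pzRingType) (f : {rmorphism A -> B}) (a : A) n :
  f (pochhammer a n) = pochhammer (f a) n.
Proof. by rewrite /pochhammer rmorph_prod; apply: eq_bigr => i _; rewrite rmorphD rmorph_nat. Qed.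

Lemma expR_ln_half v : 0 < v -> expR (ln (v ^+ 2) / 2) = v.
Proof. by move=> v0; rewrite lnXn // mulrC -[ln v *+ 2]mulr_natl mulKf ?pnatr_eq0 // lnK. Qed.

Lemma besselK_Mellin (c v : R) l : 0 < c -> 0 < v ->
  cintegral setT (fun eta : R => line_Gamma (c +i* eta) * line_Gamma (c +i* eta + l%:R) *
     cpow (v ^+ 2) (- (c +i* eta))) = (4 * pi * v ^+ l * besselK l (2 * v))%:C.
Proof.
move=> c0 v0; have := besselK_Mellin_Barnes l (ln (v ^+ 2)) c0.
rewrite expRM_natl expR_ln_half // => <-; apply: eq_cintegral => eta _; rewrite /cpow mulNr //.
Qed.

Lemma bessel_series_nat v k : 0 < v ->
  bessel_series (v ^+ 2)%:C k%:R = (besselI k (2 * v) / v ^+ k)%:C.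
Proof.
move=> v0.
have [|[h1 h2] _] := @bessel_tail_spec R (v ^+ 2)%:C 0 k%:R.
  by rewrite Re_nat addr0 lerDr.
have termE j : bessel_term (v ^+ 2)%:C k%:R j = (v ^+ (2 * j) / (j`!%:R * (j + k)`!%:R))%:C.
  rewrite /bessel_term natr1 -natrD addSn rGamma_nat addnC exprM.
  by rewrite -mulrA -invfM -!natrM [RHS]rmorphM fmorphV rmorph_nat [X in _ = X * _]rmorphXn.
apply: eqc => /=; last first.
  apply: cvg_unique h2 _ => //.
  by apply: (cvg_ext _ (cvg_cst 0)) => n; rewrite Im_sum big1 // => j _; rewrite termE.
suff -> : besselI k (2 * v) = v ^+ k * complex.Re (bessel_series (v ^+ 2)%:C k%:R).
  by rewrite mulrC mulKf // expf_neq0 // gt_eqF.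
apply/cvg_lim => //; apply: (cvg_ext _ (cvgM (cvg_cst (v ^+ k)) h1)) => n.
rewrite /= Re_sum mulr_sumr /series /= big_mkord; apply: eq_bigr => j _.
by rewrite termE /= mulrAC mulfV // mul1r exprD; ring.
Qed.

Lemma cpow_nat b n : 0 < b -> cpow b n%:R = (b ^+ n)%:C.
Proof.
move=> b0; rewrite /cpow -(rmorph_nat (real_complex R)) -rmorphM cexp_real expRM_natl lnK //.
Qed.

Lemma powR_half x k : 0 <= x -> x `^ (k%:R / 2) = Num.sqrt x ^+ k.
Proof.
move=> x0; rewrite mulrC powRrM powR_mulrn ?powR_ge0 //.
by rewrite -powR12_sqrt.
Qed.

Lemma powR_nat_half b k : 0 < b -> b `^ (k%:R + 1 / 2) = b ^+ k * Num.sqrt b.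
Proof.
move=> b0; rewrite powRD; last by rewrite gt_eqF ?implybT.
by rewrite powR_mulrn ?ltW // div1r powR12_sqrt // ltW.
Qed.

Section expansions.
Variables (alpha delta x y : R) (nu : nat).
Hypotheses (a0 : 0 < alpha) (d0 : 0 < delta) (D0 : 0 < alpha ^+ 2 - delta ^+ 2).
Hypotheses (x0 : 0 < x) (y0 : 0 < y).
Let D := alpha ^+ 2 - delta ^+ 2.
Let r := 1 - delta ^+ 2 / alpha ^+ 2.

Let rE : r = D / alpha ^+ 2.
Proof. by rewrite /r /D; field; rewrite gt_eqF. Qed.

Let r0 : r != 0.
Proof. by rewrite rE mulf_neq0 ?invr_eq0 ?expf_neq0 // gt_eqF. Qed.

Let sD0 : Num.sqrt D != 0.
Proof. by rewrite gt_eqF // sqrtr_gt0. Qed.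

Let u0 : 0 < delta * Num.sqrt x.
Proof. by rewrite mulr_gt0 ?sqrtr_gt0. Qed.

Let u2 : (delta * Num.sqrt x) ^+ 2 = delta ^+ 2 * x.
Proof. by rewrite exprMn sqr_sqrtr // ltW. Qed.

(** The value of [entire_factor] at t = n, in which the Bessel series has become I_n. *)
Definition residue_weight n : R := r ^+ nu / (nu + n)`!%:R *
  (besselI n (2 * (delta * Num.sqrt x)) / (delta * Num.sqrt x) ^+ n) * (D ^+ n.+1 * x ^+ n).

Lemma entire_factor_nat n : entire_factor alpha delta x nu n%:R = (residue_weight n)%:C.
Proof.
rewrite /entire_factor -u2 (bessel_series_nat _ u0) natr1 !cpow_nat //.
have -> : n%:R + nu%:R + 1 = (nu + n).+1%:R :> R[i] by rewrite -natrD natr1 addnC.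
by rewrite rGamma_nat -(rmorph_nat (real_complex R)) -fmorphV -!rmorphM.
Qed.

(** The factor [Num.sqrt D * r ^+ nu] divided out here reappears in [Q_expansion] and cancels in the
    product P Q. *)
Lemma P_expansion p : P alpha delta nu p x =
  (-1) ^+ p * (nu + p)`!%:R * p`!%:R / (Num.sqrt D * r ^+ nu) *
  \sum_(k < p.+1) pochhammer (- p%:R) k / k`!%:R * residue_weight k.
Proof.
rewrite /P [LHS]mulr_sumr [RHS]mulr_sumr.
apply: eq_bigr => k _; rewrite -/D powR_nat_half // powR_half ?ltW // /residue_weight.
rewrite -[2 * delta * _]mulrA.
have sx : x = Num.sqrt x ^+ 2 by rewrite sqr_sqrtr // ltW.
have sD : D = Num.sqrt D ^+ 2 by rewrite sqr_sqrtr // ltW.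
have sx0 : Num.sqrt x != 0 by rewrite gt_eqF // sqrtr_gt0.
move: (besselI k _) (pochhammer _ _) => b c.
have xk : x ^+ k = Num.sqrt x ^+ k * Num.sqrt x ^+ k by rewrite -exprMn -expr2 -sx.
have Dk : D ^+ k.+1 = D ^+ k * (Num.sqrt D * Num.sqrt D) by rewrite exprSr -expr2 -sD.
rewrite xk Dk exprMn {sx sD xk Dk}.
field.
by rewrite !fact_neq0 sD0 !expf_neq0 // gt_eqF.
Qed.

Lemma Q_expansion p : Q alpha delta nu p y =
  (-1) ^+ p * (2 / p`!%:R ^+ 2) * (Num.sqrt D * r ^+ nu) *
  \sum_(l < p.+1) r ^+ l * (pochhammer (- p%:R) l / ((nu + l)`!%:R * l`!%:R)) *
     ((alpha * Num.sqrt y) ^+ (nu + l) * besselK (nu + l) (2 * (alpha * Num.sqrt y))).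
Proof.
rewrite /Q -[RHS]mulrA; congr (_ * _); rewrite mulr_sumr; apply: eq_bigr => l _.
rewrite -/D -natrD powR_nat_half // powR_half ?ltW // -[2 * alpha * _]mulrA addnC.
move: (besselK _ _) (pochhammer _ _) => b c.
rewrite rE !exprMn !exprVn -!exprM !mul2n -!addnn !exprD.
by field; rewrite ?fact_neq0 ?expf_neq0 ?gt_eqF.
Qed.

End expansions.

End evaluation.

(** * Summation of the line integrals over k and m *)

Section line_sum.
Context {R : realType}.
Variables (alpha y c : R) (nu N : nat).
Hypotheses (a0 : 0 < alpha) (y0 : 0 < y) (c0 : 0 < c).
Local Arguments nc : simpl never.
Local Arguments cexp : simpl never.
Let v := alpha * Num.sqrt y.

Let v0 : 0 < v. Proof. by rewrite mulr_gt0 // sqrtr_gt0. Qed.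

Let v2 : alpha ^+ 2 * y = v ^+ 2.
Proof. by rewrite exprMn sqr_sqrtr // ltW. Qed.

Let mellin l (eta : R) : R[i] := line_Gamma (c +i* eta) * line_Gamma (c +i* eta + l%:R) *
  cpow (v ^+ 2) (- (c +i* eta)).

Let cint_mellin l : cint setT (mellin l).
Proof.
have ml := cmeas_line_factor alpha y l 0 c0 0 0.
apply: cint_eq (rapid_cint ml (rapid_line_factor alpha y l 0 c0 0 0)) => // eta _.
by rewrite /line_factor /mellin falling0 mul1r addn0 v2.
Qed.

(** The coefficient of 1 / (t - n) in the partial fractions of 1 / (t (t - 1) ... (t - N + 1)). *)
Definition residue_coeff n : R[i] := (-1) ^+ (N.-1 + n) / (n`!%:R * (N.-1 - n)`!%:R).

(** Both sides become integrals of finite sums over the same line, and the integrands agree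
    pointwise by [kernel_sum_euler]; the right side is then evaluated by [besselK_Mellin]. *)
Lemma line_transform_sum (q : R[i]) n : (n < N)%N ->
  (forall j, (j < N)%N -> n%:R != c + j%:R - 1) ->
  \sum_(k < N) q ^+ k * \sum_(m < k.+1) ((-1) ^+ m * 'C(N, m)%:R *
     (residue_coeff n * line_transform alpha y c nu N k m n%:R)) =
  \sum_(p < N) pochhammer (- p%:R) n / (n`!%:R * p`!%:R) * (\sum_(l < p.+1)
     (1 - q) ^+ l * (pochhammer (- p%:R) l / ((nu + l)`!%:R * l`!%:R))
     * (4 * pi * (v ^+ (nu + l) * besselK (nu + l) (2 * v)))%:C * (nu + p)`!%:R).
Proof.
move=> nN hn.
have ne (eta : R) j : (j < N)%N -> (c +i* eta) - n%:R + j%:R - 1 != 0.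
  move=> jN; apply/eqP => h; have := hn j jN; apply/negP/negPn/eqP.
  have := congr1 (fun z : R[i] => complex.Re z) h; rewrite !(ReD, ReN) !Re_nat /=; lra.
pose lf k m eta := line_factor alpha y nu N k m (c +i* eta) *
  @pole_factor R k m (c +i* eta) n%:R.
have ci k m : (k < N)%N -> cint setT (lf k m).
  move=> kN; apply: cint_line_transform => // j jk; rewrite Re_nat; apply: hn.
  exact: leq_ltn_trans jk kN.
transitivity (cintegral setT (fun eta => \sum_(k < N) q ^+ k * \sum_(m < k.+1)
    ((-1) ^+ m * 'C(N, m)%:R * residue_coeff n * lf k m eta))).
  have c1 (k : 'I_N) (m : 'I_k.+1) : cint setT (fun eta =>
      (-1) ^+ m * 'C(N, m)%:R * residue_coeff n * lf k m eta).
    by apply: cintZ => //; exact: ci.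
  have c2 (k : 'I_N) : cint setT (fun eta => \sum_(m < k.+1)
      ((-1) ^+ m * 'C(N, m)%:R * residue_coeff n * lf k m eta)).
    exact: cint_sum.
  have c3 (k : 'I_N) : cint setT (fun eta => q ^+ k * \sum_(m < k.+1)
      ((-1) ^+ m * 'C(N, m)%:R * residue_coeff n * lf k m eta)).
    exact: cintZ.
  rewrite (cintegral_sum _ _ c3) //; apply: eq_bigr => k _.
  rewrite (cintegralZ _ measurableT (c2 k)); congr (_ * _).
  rewrite (cintegral_sum _ _ (c1 k)) //; apply: eq_bigr => m _.
  by rewrite (cintegralZ _ measurableT (ci k m (ltn_ord k))) mulrA.
transitivity (cintegral setT (fun eta => \sum_(p < N)
    pochhammer (- p%:R) n / (n`!%:R * p`!%:R) * (\sum_(l < p.+1)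
     ((1 - q) ^+ l * (pochhammer (- p%:R) l / ((nu + l)`!%:R * l`!%:R)) * (nu + p)`!%:R) *
     mellin (nu + l) eta))); last first.
  have c1 (p : 'I_N) (l : 'I_p.+1) : cint setT (fun eta =>
     ((1 - q) ^+ l * (pochhammer (- p%:R) l / ((nu + l)`!%:R * l`!%:R)) * (nu + p)`!%:R) *
     mellin (nu + l) eta).
    exact: cintZ.
  have c2 (p : 'I_N) : cint setT (fun eta => \sum_(l < p.+1)
     ((1 - q) ^+ l * (pochhammer (- p%:R) l / ((nu + l)`!%:R * l`!%:R)) * (nu + p)`!%:R) *
     mellin (nu + l) eta).
    exact: cint_sum.
  have c3 (p : 'I_N) := cintZ (pochhammer (- p%:R) n / (n`!%:R * p`!%:R)) measurableT (c2 p).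
  rewrite (cintegral_sum _ _ c3) //; apply: eq_bigr => p _.
  rewrite (cintegralZ _ measurableT (c2 p)); congr (_ * _).
  rewrite (cintegral_sum _ _ (c1 p)) //; apply: eq_bigr => l _.
  rewrite (cintegralZ _ measurableT (cint_mellin _)) besselK_Mellin // mulrAC.
  by rewrite (mulrA (4 * pi)).
apply: eq_cintegral => eta _; set s := c +i* eta.
have s0 : 0 < complex.Re (s + nu%:R) by rewrite ReD Re_nat /= ltr_wpDr.
set W := line_Gamma s * line_Gamma (s + nu%:R) * cpow (v ^+ 2) (- s).
(* Writing Gamma (s + nu + l) as (s + nu)_l Gamma (s + nu) gives all terms the common factor [W],
   and what remains is an algebraic identity in s. *)
have WE l : line_Gamma s * line_Gamma (s + (nu + l)%:R) * cpow (v ^+ 2) (- s) =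
    pochhammer (s + nu%:R) l * W.
  by rewrite natrD addrA line_Gamma_shift // /W; ring.
have lhs (k : 'I_N) : q ^+ k * \sum_(m < k.+1)
    ((-1) ^+ m * 'C(N, m)%:R * residue_coeff n * lf k m eta) =
    q ^+ k * (residue_coeff n * kernel_sum s n%:R k N) * pochhammer (s + nu%:R) k * W.
  transitivity (q ^+ k * (residue_coeff n * kernel_sum s n%:R k N * (pochhammer (s + nu%:R) k * W))).
    congr (_ * _); rewrite -WE /kernel_sum mulr_sumr mulr_suml; apply: eq_bigr => m _.
    rewrite /lf /line_factor /pole_factor -/s v2 prodfV; ring.
  ring.
have rhs (p : 'I_N) : \sum_(l < p.+1)
    ((1 - q) ^+ l * (pochhammer (- p%:R) l / ((nu + l)`!%:R * l`!%:R)) * (nu + p)`!%:R) *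
    mellin (nu + l) eta = (\sum_(l < p.+1) (1 - q) ^+ l * (pochhammer (- p%:R) l /
    ((nu + l)`!%:R * l`!%:R)) * pochhammer (s + nu%:R) l * (nu + p)`!%:R) * W.
  rewrite mulr_suml; apply: eq_bigr => l _; rewrite /mellin -/s WE; ring.
under eq_bigr do rewrite lhs; under [RHS]eq_bigr do rewrite rhs.
under [RHS]eq_bigr do rewrite mulrA.
rewrite -!mulr_suml; congr (_ * _).
by rewrite kernel_sum_euler // => j jN; exact: ne.
Qed.

End line_sum.

(** * The correlation kernel in terms of residues *)

Section corr_kernel_expansion.
Context {R : realType}.
Variables (alpha delta x y : R) (nu : nat).
Hypotheses (a0 : 0 < alpha) (d0 : 0 < delta) (D0 : 0 < alpha ^+ 2 - delta ^+ 2).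
Hypotheses (x0 : 0 < x) (y0 : 0 < y).
Let r := 1 - delta ^+ 2 / alpha ^+ 2.
Let M l := (alpha * Num.sqrt y) ^+ l * besselK l (2 * (alpha * Num.sqrt y)).

(** Expanding P_p in the residue weights attaches (-p)_n / (n! p!) to the p-th sum of Bessel
    functions K, which is the coefficient produced by [kernel_sum_euler]. *)
Lemma corr_kernel_expansion N : corr_kernel alpha delta nu N x y =
  \sum_(n < N) residue_weight alpha delta x nu n *
    \sum_(p < N) pochhammer (- p%:R) n / (n`!%:R * p`!%:R) *
      \sum_(l < p.+1) r ^+ l * (pochhammer (- p%:R) l / ((nu + l)`!%:R * l`!%:R)) *
        (2 * M (nu + l)) * (nu + p)`!%:R.
Proof.
under [RHS]eq_bigr do rewrite mulr_sumr.
rewrite exchange_big /=; apply: eq_bigr => p _.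
pose w n := residue_weight alpha delta x nu n.
pose S := \sum_(l < p.+1) r ^+ l * (pochhammer (- p%:R) l / ((nu + l)`!%:R * l`!%:R)) * M (nu + l).
have SE : \sum_(l < p.+1) r ^+ l * (pochhammer (- p%:R) l / ((nu + l)`!%:R * l`!%:R)) *
    (2 * M (nu + l)) * (nu + p)`!%:R = 2 * (nu + p)`!%:R * S.
  by rewrite /S mulr_sumr; apply: eq_bigr => l _; ring.
rewrite P_expansion // Q_expansion // -/r -/S.
(* Since (-p)_n = 0 for n > p, the range can be n < N for every p, as in the sum of residues. *)
have -> : \sum_(k < p.+1) pochhammer (- p%:R) k / k`!%:R * residue_weight alpha delta x nu k =
    \sum_(n < N) pochhammer (- p%:R) n / n`!%:R * w n.
  rewrite (big_ord_widen _ (fun k => pochhammer (- p%:R) k / k`!%:R * w k) (ltn_ord p)).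
  rewrite big_mkcond /=; apply: eq_bigr => k _; case: ifPn => //; rewrite -leqNgt => pk.
  by rewrite pochhammerN_small // !mul0r.
under [RHS]eq_bigr do rewrite SE.
have -> : \sum_(n < N) residue_weight alpha delta x nu n *
    (pochhammer (- p%:R) n / (n`!%:R * p`!%:R) * (2 * (nu + p)`!%:R * S)) =
    (\sum_(n < N) pochhammer (- p%:R) n / n`!%:R * w n) * (2 * (nu + p)`!%:R * S / p`!%:R).
  by rewrite mulr_suml; apply: eq_bigr => n _; rewrite /w invfM; ring.
have r0 : r != 0.
  have -> : r = (alpha ^+ 2 - delta ^+ 2) / alpha ^+ 2 by rewrite /r; field; rewrite gt_eqF.
  by rewrite mulf_neq0 ?invr_eq0 ?expf_neq0 // gt_eqF.
have sD0 : Num.sqrt (alpha ^+ 2 - delta ^+ 2) != 0 by rewrite gt_eqF // sqrtr_gt0.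
have sg : (-1) ^+ p * (-1) ^+ p = 1 :> R by rewrite -exprMn mulrNN mulr1 expr1n.
set A := \sum_(n < N) _; set s := Num.sqrt _ in sD0 *; set e := (-1) ^+ p in sg *.
transitivity (e * e * (A * (2 * (nu + p)`!%:R * S / p`!%:R))); last by rewrite sg mul1r.
by field; rewrite fact_neq0 sD0 expf_neq0.
Qed.

End corr_kernel_expansion.

Theorem theorem3p8 (R : realType) (mu alpha delta : R) (N nu : nat)
    (Sigma : contour R) (c x y : R) :
  0 < mu < 1 ->
  alpha = (1 + mu) / (2 * mu) ->
  delta = (1 - mu) / (2 * mu) ->
  (1 <= N)%N ->
  0 < c ->
  (forall n : nat, (n < N)%N -> encircles_once Sigma (n%:R : R[i])) ->
  (forall (j : nat) (s : R[i]), (j < N)%N -> complex.Re s = c ->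
     is_outside Sigma (s + j%:R - 1)) ->
  0 < x -> 0 < y ->
  (corr_kernel alpha delta nu N x y)%:C =
  \sum_(k < N) corr_kernel_term alpha delta nu N k Sigma c x y
               * ((delta / alpha) ^+ (2 * k))%:C.
Proof.
move=> /andP[mu0 mu1] alphaE deltaE N1 c0 enc out x0 y0.
have a0 : 0 < alpha by rewrite alphaE divr_gt0 ?mulr_gt0 ?addr_gt0.
have d0 : 0 < delta by rewrite deltaE divr_gt0 ?mulr_gt0 ?subr_gt0.
have D0 : 0 < alpha ^+ 2 - delta ^+ 2.
  have -> : alpha ^+ 2 - delta ^+ 2 = mu^-1.
    by rewrite alphaE deltaE; field; rewrite gt_eqF.
  by rewrite invr_gt0.
have on_line t : (exists2 j, (j < N)%N & complex.Re t = c + j%:R - 1) -> ~ on_contour Sigma t.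
  move=> [j jN tj]; have [] := out j (t - j%:R + 1) jN.
    by rewrite !(ReD, ReN) Re_nat tj /=; ring.
  by have -> : t - j%:R + 1 + j%:R - 1 = t by ring.
(* An encircled integer on one of the lines would have winding number both 1 and 0. *)
have pole n j : (n < N)%N -> (j < N)%N -> n%:R != c + j%:R - 1.
  move=> nN jN; apply/eqP => h; have [_ w1] := enc n nN.
  have [] := out j (n%:R - j%:R + 1) jN.
    by rewrite !(ReD, ReN) !Re_nat h /=; ring.
  have -> : n%:R - j%:R + 1 + j%:R - 1 = n%:R :> R[i] by ring.
  by rewrite w1 => _ /eqP; rewrite oner_eq0.
pose F k m t := (0 +i* 1) * entire_factor alpha delta x nu t * line_transform alpha y c nu N k m t.
have residues k m : (k < N)%N -> (m <= k)%N ->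
    contour_integral Sigma (fun t => vertical_integral c (fun s =>
      integrand alpha delta nu N k m x y t s)) =
    two_pi_i R * \sum_(n < N) residue_coeff N n * F k m n%:R.
  move=> kN mk.
  (* The exceptional points are -1, -2, ..., where the values of [integrand] are dictated by
     conventions and may differ from the continuation. *)
  apply: (@contour_residues _ _ (fun v => exists2 j, (j < N)%N & v = c + j%:R - 1)
    _ _ _ _ (fun j => - (1 + j%:R))) => // [lo hi B hV|t tS tj].
    apply: holM; last first.
      apply: hol_line_transform => // j jk; apply: hV; exists j => //.
      exact: leq_ltn_trans jk kN.
    apply: holM; first exact: hol_cst.
    apply: hol_sub (hol_entire_factor alpha delta x nu (`|lo| + `|hi| + B)) => t.
    exact: rect_bounded.
  rewrite vertical_integrandE //; last first.
  - move=> j jk; apply/eqP => h; apply: (on_line t) tS; exists j => //.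
    exact: leq_ltn_trans jk kN.
  - move=> j; apply/eqP => h; apply: (tj j); apply/eqP.
    by rewrite -subr_eq0 opprK addrA h.
  - exact: leq_trans mk (ltnW kN).
  have -> : \prod_(n < N) (t - n%:R)^-1 = \sum_(n < N) residue_coeff N n * (t - n%:R)^-1.
    have := @partial_fraction _ N.-1 t; rewrite /residue_coeff prednK //; apply => n nN.
    rewrite subr_eq0; apply/eqP => tn.
    have [] := enc n; first by rewrite -(prednK N1).
    by rewrite -tn.
  rewrite mulr_sumr; apply: eq_bigr => n _; rewrite -/(F k m t); ring.
pose rho := @residue_coeff R N.
pose LT k m n := line_transform alpha y c nu N k m (n%:R : R[i]).
have termE k : (k < N)%N -> corr_kernel_term alpha delta nu N k Sigma c x y =
    \sum_(n < N) (residue_weight alpha delta x nu n / (2 * pi))%:C *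
      \sum_(m < k.+1) (-1) ^+ m * 'C(N, m)%:R * (rho n * LT k m n).
  move=> kN; rewrite /corr_kernel_term.
  transitivity (\sum_(m < k.+1) \sum_(n < N) (residue_weight alpha delta x nu n / (2 * pi))%:C *
      ((-1) ^+ m * 'C(N, m)%:R * (rho n * LT k m n))); last first.
    by rewrite exchange_big /=; apply: eq_bigr => n _; rewrite mulr_sumr.
  apply: eq_bigr => m _; rewrite residues ?leq_ord //.
  rewrite mulrA mulr_sumr; apply: eq_bigr => n _.
  have wE : (residue_weight alpha delta x nu n / (2 * pi))%:C =
      (residue_weight alpha delta x nu n)%:C / (2 * pi)%:C by rewrite rmorphM fmorphV.
  rewrite /F entire_factor_nat // wE.
  (* The residues use up one factor 2 pi i of the prefactor; the other, with ds = i d eta, leaves 1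
     / (2 pi). *)
  have iE : (0 +i* 1) / two_pi_i R = ((2 * pi)%:C)^-1.
    have p0 : (2 * pi : R)%:C != 0 by rewrite -nc_eq0 nc_real normr_eq0 mulf_neq0 // gt_eqF ?pi_gt0.
    apply: (mulfI p0); rewrite divff // mulrA; apply: (mulIf (two_pi_i_neq0 (R := R))).
    rewrite mulfVK ?two_pi_i_neq0 // mul1r; apply: eqc; rewrite /two_pi_i ?ReM ?ImM /=; ring.
  rewrite -iE /rho /LT; field; exact: two_pi_i_neq0.
pose q : R[i] := ((delta / alpha) ^+ 2)%:C.
transitivity (\sum_(n < N) (residue_weight alpha delta x nu n / (2 * pi))%:C *
    \sum_(k < N) q ^+ k * \sum_(m < k.+1) (-1) ^+ m * 'C(N, m)%:R * (rho n * LT k m n)); last first.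
  under eq_bigr do rewrite mulr_sumr.
  rewrite exchange_big /=; apply: eq_bigr => k _; rewrite termE // mulr_suml.
  have -> : ((delta / alpha) ^+ (2 * k))%:C = q ^+ k by rewrite exprM rmorphXn.
  by apply: eq_bigr => n _; rewrite -[RHS]mulrA; congr (_ * _); rewrite mulrC.
have sumC n (f : 'I_n -> R) : (\sum_(i < n) f i)%:C = \sum_(i < n) (f i)%:C.
  by rewrite rmorph_sum.
have mulC (a b : R) : (a * b)%:C = a%:C * b%:C by rewrite rmorphM.
rewrite corr_kernel_expansion // sumC; apply: eq_bigr => n _.
rewrite line_transform_sum //; last by move=> j; exact: pole.
rewrite [LHS]mulC.
have -> : (residue_weight alpha delta x nu n / (2 * pi))%:C =
    (residue_weight alpha delta x nu n)%:C / (2 * pi)%:C by rewrite rmorphM fmorphV.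
rewrite -[RHS]mulrA; congr (_ * _).
rewrite [LHS]sumC [RHS]mulr_sumr; apply: eq_bigr => p _.
have natC a : (a%:R)%:C = a%:R :> R[i] by rewrite rmorph_nat.
have pochC l : (pochhammer (- p%:R : R) l)%:C = pochhammer (- p%:R) l.
  by rewrite rmorph_pochhammer rmorphN rmorph_nat.
have cE l (d : R) : (pochhammer (- p%:R) l / d)%:C = pochhammer (- p%:R) l / d%:C.
  by rewrite -pochC -fmorphV -rmorphM.
have natMC a b : (a%:R * b%:R)%:C = a%:R * b%:R :> R[i] by rewrite -natrM natC natrM.
rewrite [LHS]mulC [RHS]mulrCA cE natMC; congr (_ * _).
rewrite [LHS]sumC [RHS]mulr_sumr; apply: eq_bigr => l _.
set M := _ * besselK _ _.
have qE : (1 - q) ^+ l = ((1 - delta ^+ 2 / alpha ^+ 2) ^+ l)%:C.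
  by rewrite rmorphXn rmorphB /q expr_div_n.
(* Of the 4 pi in the Mellin-Barnes formula, 2 pi cancels the remaining prefactor and 2 is the one
   in the definition of [Q]. *)
have ME : (4 * pi * M)%:C = (2 * pi)%:C * (2 * M)%:C by rewrite -rmorphM; congr (_%:C); ring.
have p0 : (2 * pi : R)%:C != 0.
  by rewrite -nc_eq0 nc_real normr_eq0 mulf_neq0 // gt_eqF ?pi_gt0.
rewrite qE ME [LHS]mulC natC [X in X * _ = _]mulC [X in X * _ * _ = _]mulC cE natMC.
set A := _ * (pochhammer _ _ / _).
by rewrite [A * (_ * _)]mulrCA -(mulrA (2 * pi)%:C) mulKf.
Qed.
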